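(* Let $X$ be a connected compact complex manifold, let $Z\subset X$ be a connected analytic set of codimension $1$, and let $j\colon Z\hookrightarrow X$ and $i\colon X\setminus Z\hookrightarrow X$ be the canonical embeddings. Let $\mathcal{F}$ be a sheaf of $\mathbb{C}$-vector spaces on $X$ (not necessarily coherent) such that $i^{-1}\mathcal{F}\cong i^{-1}\mathcal{O}_X=\mathcal{O}_{X\setminus Z}$ as sheaves of $\mathbb{C}$-vector spaces and $\dim_{\mathbb{C}}H^{1}(X,\mathcal{F})=m<\infty$. Then the following assertions are equivalent: (1) $X\setminus Z$ admits the Hartogs phenomenon; (2) the canonical homomorphism $\Gamma(X,\mathcal{F})\to\Gamma(Z,j^{-1}\mathcal{F})=\varinjlim_{U\supset Z}\Gamma(U,\mathcal{F})$ is an epimorphism, where the colimit is taken over open neighbourhoods $U$ of $Z$ in $X$; (3) $\dim_{\mathbb{C}} H^{1}_{c}(X\setminus Z,\mathcal{O})\leq m$.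
   Context: $\mathcal{O}_X$ (or $\mathcal{O}$) is the sheaf of holomorphic functions; $i^{-1}$ and $j^{-1}$ are the topological inverse image functors; $H^{*}_{c}$ is sheaf cohomology with compact supports. A complex space $W$ is said to admit the Hartogs phenomenon if $W$ is non-compact and for every compact set $K\subset W$ such that $W\setminus K$ is connected, the restriction homomorphism $\Gamma(W,\mathcal{O}_W)\to\Gamma(W\setminus K,\mathcal{O}_W)$ is an isomorphism. *)

(* Defs.v *)
From HB Require Import structures.
From mathcomp Require Import all_boot all_order all_algebra.
From mathcomp Require Import generic_quotient ring_quotient.
From mathcomp Require Import all_classical all_reals all_analysis.
From mathcomp.real_closed Require Import complex.

Set Implicit Arguments.
Unset Strict Implicit.
Unset Printing Implicit Defensive.

Import Order.TTheory GRing.Theory Num.Theory numFieldNormedType.Exports.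
Local Open Scope classical_set_scope.
Local Open Scope ring_scope.
Local Open Scope quotient_scope.

Identity Coercion fun_of_set : set >-> Funclass.

Section LinearAlgebra.
Context {K : fieldType}.
Implicit Types V W : lmodType K.

Definition linear_of V W (f : V -> W) (lf : linear f) : {linear V -> W} :=
  HB.pack f (GRing.isLinear.Build K V W *:%R f lf).

Record lsub V := LSub {
  lsub_set :> set V;
  lsub0 : lsub_set 0;
  lsubP : forall a u v, lsub_set u -> lsub_set v -> lsub_set (a *: u + v) }.

Definition lsub_pred V (S : lsub V) : {pred V} := fun v => `[< S v >].

Fact lsub_submod_closed V (S : lsub V) : submod_closed (lsub_pred S).
Proof.
split; first exact/asboolP/lsub0.
by move=> a u v /asboolP Su /asboolP Sv; apply/asboolP/lsubP.
Qed.

HB.instance Definition _ V (S : lsub V) :=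
  GRing.isSubmodClosed.Build K V (lsub_pred S) (lsub_submod_closed S).

Record lsub_type V (S : lsub V) :=
  LSubType { lsub_val :> V; _ : lsub_val \in lsub_pred S }.

HB.instance Definition _ V (S : lsub V) := [isSub for @lsub_val V S].
HB.instance Definition _ V (S : lsub V) := [Choice of lsub_type S by <:].
HB.instance Definition _ V (S : lsub V) :=
  [SubChoice_isSubLmodule of lsub_type S by <:].

Definition lsub_in V (S : lsub V) (v : V) (Sv : S v) : lsub_type S :=
  LSubType (introT (asboolP (S v)) Sv).

Lemma lsub_valP V (S : lsub V) (v : lsub_type S) : S (lsub_val v).
Proof. by case: v => v /= /asboolP. Qed.

Lemma lsub_val_linear V (S : lsub V) : linear (@lsub_val V S).
Proof. by []. Qed.

Definition lquot V (S : lsub V) : Type := (Quotient.quot (lsub_pred S)).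

HB.instance Definition _ V (S : lsub V) := GRing.Zmodule.on (lquot S).

Definition lpi V (S : lsub V) (v : V) : lquot S := \pi_(Quotient.quot (lsub_pred S)) v.

Lemma lpi_eq V (S : lsub V) (u v : V) : lpi S u = lpi S v <-> S (u - v).
Proof.
split=> [/eqP|Suv].
  by rewrite /lpi -Quotient.idealrBE => /asboolP.
by apply/eqP; rewrite /lpi -Quotient.idealrBE; apply/asboolP.
Qed.

Lemma lpiK V (S : lsub V) (x : lquot S) : lpi S (repr x) = x.
Proof. exact: (@reprK _ (Quotient.quot (lsub_pred S))). Qed.

Lemma lpiD V (S : lsub V) (u v : V) : lpi S (u + v) = lpi S u + lpi S v.
Proof. by rewrite /lpi !piE. Qed.

Definition lquot_scale V (S : lsub V) (a : K) (x : lquot S) : lquot S :=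
  lpi S (a *: (repr x : V)).

Lemma lquot_scale_pi V (S : lsub V) a (v : V) :
  lquot_scale a (lpi S v) = lpi S (a *: v).
Proof.
apply/lpi_eq; rewrite -scalerBr.
have /lpi_eq : lpi S (repr (lpi S v)) = lpi S v by rewrite lpiK.
by move=> h; have := lsubP a h (lsub0 S); rewrite addr0.
Qed.

Section LquotLmod.
Variables (V : lmodType K) (S : lsub V).

Fact lquot_scaleA a b (x : lquot S) :
  lquot_scale a (lquot_scale b x) = lquot_scale (a * b) x.
Proof. by rewrite -[x]lpiK !lquot_scale_pi scalerA. Qed.

Fact lquot_scale1 : left_id 1 (@lquot_scale V S).
Proof. by move=> x; rewrite -[x]lpiK !lquot_scale_pi scale1r. Qed.

Fact lquot_scaleDr : right_distributive (@lquot_scale V S) +%R.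
Proof.
move=> a x y; rewrite -[x]lpiK -[y]lpiK -lpiD !lquot_scale_pi scalerDr.
exact: lpiD.
Qed.

Fact lquot_scaleDl (x : lquot S) :
  {morph (@lquot_scale V S)^~ x : a b / a + b}.
Proof.
by move=> a b; rewrite -[x]lpiK !lquot_scale_pi scalerDl; exact: lpiD.
Qed.

HB.instance Definition _ := GRing.Zmodule_isLmodule.Build K (lquot S)
  lquot_scaleA lquot_scale1 lquot_scaleDr lquot_scaleDl.

Lemma lpi_linear : linear (lpi S : V -> lquot S).
Proof. by move=> a u v; rewrite lpiD -lquot_scale_pi. Qed.

End LquotLmod.

Section Subspaces.
Variables V W : lmodType K.

Fact lzeroP a (u v : V) : [set 0] u -> [set 0] v -> [set 0] (a *: u + v).
Proof. by move=> -> ->; rewrite /set1 /= scaler0 addr0. Qed.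

Definition lzero : lsub V := LSub (erefl : [set 0] 0) lzeroP.

Definition lfull : lsub V := LSub (I : setT 0) (fun _ _ _ _ _ => I).

Fact lcap0 (A B : lsub V) : (A `&` B) 0.
Proof. by split; exact: lsub0. Qed.

Fact lcapP (A B : lsub V) a u v :
  (A `&` B) u -> (A `&` B) v -> (A `&` B) (a *: u + v).
Proof. by move=> [Au Bu] [Av Bv]; split; exact: lsubP. Qed.

Definition lcap (A B : lsub V) : lsub V := LSub (lcap0 A B) (@lcapP A B).

Variable f : {linear V -> W}.

Fact limage0 (A : lsub V) : (f @` A) 0.
Proof. by exists 0; [exact: lsub0|exact: linear0]. Qed.

Fact limageP (A : lsub V) a u v :
  (f @` A) u -> (f @` A) v -> (f @` A) (a *: u + v).
Proof.
move=> [x Ax <-] [y Ay <-].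
by exists (a *: x + y); [exact: lsubP|exact: linearP].
Qed.

Definition limage (A : lsub V) : lsub W := LSub (limage0 A) (@limageP A).

Fact lpreim0 (B : lsub W) : (f @^-1` B) 0.
Proof. by rewrite /preimage /= linear0; exact: lsub0. Qed.

Fact lpreimP (B : lsub W) a u v :
  (f @^-1` B) u -> (f @^-1` B) v -> (f @^-1` B) (a *: u + v).
Proof. by rewrite /preimage /= linearP; exact: lsubP. Qed.

Definition lpreim (B : lsub W) : lsub V := LSub (lpreim0 B) (@lpreimP B).

End Subspaces.

Definition lker V W (f : {linear V -> W}) : lsub V := lpreim f (lzero W).

Section DProd.
Variables (I : Type) (E : I -> lmodType K).

Definition dprod := forall i, E i.

HB.instance Definition _ := gen_eqMixin dprod.
HB.instance Definition _ := gen_choiceMixin dprod.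

Definition dprod0 : dprod := fun=> 0.
Definition dprod_opp (s : dprod) : dprod := fun i => - s i.
Definition dprod_add (s t : dprod) : dprod := fun i => s i + t i.
Definition dprod_scale (a : K) (s : dprod) : dprod := fun i => a *: s i.

Fact dprod_addA : associative dprod_add.
Proof. by move=> r s t; apply: functional_extensionality_dep => i; exact: addrA. Qed.
Fact dprod_addC : commutative dprod_add.
Proof. by move=> s t; apply: functional_extensionality_dep => i; exact: addrC. Qed.
Fact dprod_add0 : left_id dprod0 dprod_add.
Proof. by move=> s; apply: functional_extensionality_dep => i; exact: add0r. Qed.
Fact dprod_addN : left_inverse dprod0 dprod_opp dprod_add.
Proof. by move=> s; apply: functional_extensionality_dep => i; exact: addNr. Qed.

HB.instance Definition _ := GRing.isZmodule.Build dprod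
  dprod_addA dprod_addC dprod_add0 dprod_addN.

Fact dprod_scaleA a b s :
  dprod_scale a (dprod_scale b s) = dprod_scale (a * b) s.
Proof. by apply: functional_extensionality_dep => i; exact: scalerA. Qed.
Fact dprod_scale1 : left_id 1 dprod_scale.
Proof. by move=> s; apply: functional_extensionality_dep => i; exact: scale1r. Qed.
Fact dprod_scaleDr : right_distributive dprod_scale +%R.
Proof. by move=> a s t; apply: functional_extensionality_dep => i; exact: scalerDr. Qed.
Fact dprod_scaleDl s : {morph dprod_scale^~ s : a b / a + b}.
Proof. by move=> a b; apply: functional_extensionality_dep => i; exact: scalerDl. Qed.

HB.instance Definition _ := GRing.Zmodule_isLmodule.Build K dprod
  dprod_scaleA dprod_scale1 dprod_scaleDr dprod_scaleDl.

End DProd.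

Definition has_dim V (m : nat) : Prop :=
  exists e : 'I_m -> V,
    forall v, exists! c : 'rV[K]_m, v = \sum_(i < m) c 0 i *: e i.

Definition dim_le V (m : nat) : Prop := exists2 k, (k <= m)%N & has_dim V k.

End LinearAlgebra.

Record opens (T : topologicalType) := Opens {
  opens_set :> set T;
  opens_open : open opens_set }.

Definition opensT (T : topologicalType) : opens T := Opens (@openT T).

Definition opensI (T : topologicalType) (U V : opens T) : opens T :=
  Opens (openI (opens_open U) (opens_open V)).

Lemma opensIl (T : topologicalType) (U V : opens T) : opensI U V `<=` U.
Proof. exact: subIsetl. Qed.

Lemma opensIr (T : topologicalType) (U V : opens T) : opensI U V `<=` V.
Proof. exact: subIsetr. Qed.

Record presheaf (K : fieldType) (T : topologicalType) := Presheaf {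
  sections :> opens T -> lmodType K;
  res : forall U V : opens T, V `<=` U -> {linear sections U -> sections V};
  res_id : forall (U : opens T) (UU : U `<=` U) s, res UU s = s;
  res_comp : forall (U V W : opens T) (VU : V `<=` U) (WV : W `<=` V)
    (WU : W `<=` U) s, res WV (res VU s) = res WU s }.

Arguments res {K T} p {U V}.

Definition is_sheaf (K : fieldType) (T : topologicalType) (F : presheaf K T) :=
  forall (I : Type) (U : opens T) (V : I -> opens T)
    (VU : forall i, V i `<=` U) (s : forall i, F (V i)),
    U `<=` \bigcup_i V i ->
    (forall i j, res F (opensIl (U := V i) (V := V j)) (s i)
               = res F (opensIr (U := V i) (V := V j)) (s j)) ->
  exists! t : F U, forall i, res F (VU i) t = s i.

Record sheaf (K : fieldType) (T : topologicalType) := Sheaf {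
  sheaf_presheaf :> presheaf K T;
  sheafP : is_sheaf sheaf_presheaf }.

Definition isomorphic (K : fieldType) (T : topologicalType)
    (F G : presheaf K T) : Prop :=
  exists phi : forall U, {linear F U -> G U},
    (forall (U V : opens T) (VU : V `<=` U) s,
       phi V (res F VU s) = res G VU (phi U s)) /\
    forall U, bijective (phi U).

(** [germs F A] is the colimit of [F U] over the open neighbourhoods [U] of
    [A]; the stalk at [x] is the case [A = [set x]]. *)
Section Germs.
Context {K : fieldType} {T : topologicalType}.
Variables (F : presheaf K T) (A : set T).

Record nbsec := Nbsec {
  nbsec_open :> opens T;
  nbsec_sub : A `<=` nbsec_open;
  nbsec_val : F nbsec_open }.

HB.instance Definition _ := gen_eqMixin nbsec.
HB.instance Definition _ := gen_choiceMixin nbsec.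

Definition nbsec_agree (p q : nbsec) : Prop :=
  exists (W : opens T) (Wp : W `<=` p) (Wq : W `<=` q),
    A `<=` W /\ res F Wp (nbsec_val p) = res F Wq (nbsec_val q).

Fact nbsec_agree_equiv : equiv_class_of (fun p q => `[< nbsec_agree p q >]).
Proof.
split.
- move=> p; apply/asboolP; exists p, (@subset_refl _ _), (@subset_refl _ _).
  by split => //; exact: nbsec_sub.
- move=> p q; apply/asboolP/asboolP => -[W [h1 [h2 [AW e]]]];
  by exists W, h2, h1.
- move=> q p r /asboolP[W [h1 [h2 [AW e]]]] /asboolP[W' [h1' [h2' [AW' e']]]].
  apply/asboolP.
  have s1 : opensI W W' `<=` W by exact: subIsetl.
  have s2 : opensI W W' `<=` W' by exact: subIsetr.
  exists (opensI W W'), (subset_trans s1 h1), (subset_trans s2 h2'); split.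
    by move=> x Ax; split; [exact: AW|exact: AW'].
  rewrite -(res_comp h1 s1) e (res_comp h2 s1 (subset_trans s1 h2)).
  by rewrite -(res_comp h2' s2) -e' (res_comp h1' s2 (subset_trans s1 h2)).
Qed.

Canonical nbsec_equiv := EquivRelPack nbsec_agree_equiv.

Definition germs := {eq_quot nbsec_equiv}.

HB.instance Definition _ := Choice.on germs.

Definition germ (U : opens T) (AU : A `<=` U) (s : F U) : germs :=
  \pi_germs (Nbsec AU s).

Lemma germ_eq (U V : opens T) (AU : A `<=` U) (AV : A `<=` V) s t :
  germ AU s = germ AV t <-> nbsec_agree (Nbsec AU s) (Nbsec AV t).
Proof.
split; first by move/eqmodP/asboolP.
by move=> h; apply/eqmodP/asboolP.
Qed.

Lemma germ_res (U V : opens T) (AU : A `<=` U) (AV : A `<=` V)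
  (VU : V `<=` U) s : germ AV (res F VU s) = germ AU s.
Proof.
apply/germ_eq; exists V, (@subset_refl _ _), VU; split => //=.
by rewrite res_id.
Qed.

Lemma germ_surj (x : germs) :
  exists (U : opens T) (AU : A `<=` U) s, x = germ AU s.
Proof.
exists (repr x), (nbsec_sub (repr x)), (nbsec_val (repr x)).
by rewrite /germ -[LHS]reprK; case: (repr x).
Qed.

Lemma germ_surj2 (x y : germs) :
  exists (U : opens T) (AU : A `<=` U) s t, x = germ AU s /\ y = germ AU t.
Proof.
have [U [AU [s ->]]] := germ_surj x; have [V [AV [t ->]]] := germ_surj y.
have AUV : A `<=` opensI U V by move=> z Az; split; [exact: AU|exact: AV].
exists (opensI U V), AUV, (res F (@opensIl _ _ _) s), (res F (@opensIr _ _ _) t).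
by rewrite !germ_res.
Qed.

Lemma germ_surj3 (x y z : germs) :
  exists (U : opens T) (AU : A `<=` U) s t r,
    [/\ x = germ AU s, y = germ AU t & z = germ AU r].
Proof.
have [U [AU [s [t [-> ->]]]]] := germ_surj2 x y.
have [V [AV [r ->]]] := germ_surj z.
have AUV : A `<=` opensI U V by move=> w Aw; split; [exact: AU|exact: AV].
exists (opensI U V), AUV, (res F (@opensIl _ _ _) s),
  (res F (@opensIl _ _ _) t), (res F (@opensIr _ _ _) r).
by rewrite !germ_res.
Qed.

Definition germs0 : germs := germ (@subsetT _ A : A `<=` opensT T) 0.

Definition germs_opp (x : germs) : germs :=
  germ (nbsec_sub (repr x)) (- nbsec_val (repr x)).

Definition germs_scale (a : K) (x : germs) : germs :=
  germ (nbsec_sub (repr x)) (a *: nbsec_val (repr x)).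

Definition germs_add (x y : germs) : germs :=
  let p := repr x in let q := repr y in
  germ (U := opensI p q) (fun z Az => conj (nbsec_sub p Az) (nbsec_sub q Az))
    (res F (@opensIl _ _ _) (nbsec_val p) + res F (@opensIr _ _ _) (nbsec_val q)).

Lemma repr_germ (U : opens T) (AU : A `<=` U) s :
  nbsec_agree (repr (germ AU s)) (Nbsec AU s).
Proof.
have : germ AU s = germ (nbsec_sub (repr (germ AU s))) (nbsec_val (repr (germ AU s))).
  by rewrite -[LHS]reprK /germ; case: (repr _).
by move/esym/germ_eq; case: (repr _).
Qed.

Lemma germ0 (U : opens T) (AU : A `<=` U) : germs0 = germ AU 0.
Proof.
rewrite /germs0 -(germ_res (U := opensT T) (@subsetT _ A) AU (@subsetT _ U)).
by rewrite linear0.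
Qed.

Lemma germs_oppE (U : opens T) (AU : A `<=` U) s :
  germs_opp (germ AU s) = germ AU (- s).
Proof.
have [W [h1 [h2 [AW e]]]] := repr_germ AU s.
apply/germ_eq; exists W, h1, h2; split => //=.
by rewrite !linearN e.
Qed.

Lemma germs_scaleE a (U : opens T) (AU : A `<=` U) s :
  germs_scale a (germ AU s) = germ AU (a *: s).
Proof.
have [W [h1 [h2 [AW e]]]] := repr_germ AU s.
apply/germ_eq; exists W, h1, h2; split => //=.
by rewrite !linearZ e.
Qed.

Lemma germs_addE (U : opens T) (AU : A `<=` U) s t :
  germs_add (germ AU s) (germ AU t) = germ AU (s + t).
Proof.
have [W [h1 [h2 [AW e]]]] := repr_germ AU s.
have [W' [h1' [h2' [AW' e']]]] := repr_germ AU t.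
have s1 : opensI W W' `<=` W by exact: subIsetl.
have s2 : opensI W W' `<=` W' by exact: subIsetr.
have s3 : opensI W W' `<=` opensI (repr (germ AU s)) (repr (germ AU t)).
  by move=> z [Wz W'z]; exact: (conj (h1 z Wz) (h1' z W'z)).
apply/germ_eq; exists (opensI W W'), s3, (subset_trans s1 h2); split => /=.
  by move=> z Az; split; [exact: AW|exact: AW'].
rewrite !linearD; congr (_ + _).
  rewrite (res_comp _ s3 (subset_trans s1 h1)) -(res_comp h1 s1) e.
  exact: res_comp.
rewrite (res_comp _ s3 (subset_trans s2 h1')) -(res_comp h1' s2) e'.
exact: res_comp.
Qed.

Fact germs_addA : associative germs_add.
Proof.
move=> x y z; have [U [AU [s [t [r [-> -> ->]]]]]] := germ_surj3 x y z.
by rewrite !germs_addE addrA.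
Qed.

Fact germs_addC : commutative germs_add.
Proof.
move=> x y; have [U [AU [s [t [-> ->]]]]] := germ_surj2 x y.
by rewrite !germs_addE addrC.
Qed.

Fact germs_add0 : left_id germs0 germs_add.
Proof.
move=> x; have [U [AU [s ->]]] := germ_surj x.
by rewrite (germ0 AU) germs_addE add0r.
Qed.

Fact germs_addN : left_inverse germs0 germs_opp germs_add.
Proof.
move=> x; have [U [AU [s ->]]] := germ_surj x.
by rewrite germs_oppE germs_addE addNr -germ0.
Qed.

HB.instance Definition _ := GRing.isZmodule.Build germs
  germs_addA germs_addC germs_add0 germs_addN.

Fact germs_scaleA a b x : germs_scale a (germs_scale b x) = germs_scale (a * b) x.
Proof.
have [U [AU [s ->]]] := germ_surj x.
by rewrite !germs_scaleE scalerA.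
Qed.

Fact germs_scale1 : left_id 1 germs_scale.
Proof.
move=> x; have [U [AU [s ->]]] := germ_surj x.
by rewrite germs_scaleE scale1r.
Qed.

Fact germs_scaleDr : right_distributive germs_scale +%R.
Proof.
move=> a x y; have [U [AU [s [t [-> ->]]]]] := germ_surj2 x y.
have -> : germ AU s + germ AU t = germ AU (s + t) by exact: germs_addE.
by rewrite !germs_scaleE scalerDr; symmetry; exact: germs_addE.
Qed.

Fact germs_scaleDl x : {morph germs_scale^~ x : a b / a + b}.
Proof.
move=> a b /=; have [U [AU [s ->]]] := germ_surj x.
by rewrite !germs_scaleE scalerDl; symmetry; exact: germs_addE.
Qed.

HB.instance Definition _ := GRing.Zmodule_isLmodule.Build K germs
  germs_scaleA germs_scale1 germs_scaleDr germs_scaleDl.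

Lemma germ_linear (U : opens T) (AU : A `<=` U) : linear (germ AU).
Proof.
move=> a s t; rewrite -germs_addE -germs_scaleE.
by [].
Qed.

HB.instance Definition _ (U : opens T) (AU : A `<=` U) :=
  GRing.isLinear.Build K (F U) germs *:%R (germ AU) (germ_linear AU).

End Germs.

Section Stalks.
Context {K : fieldType} {T : topologicalType}.
Variable F : presheaf K T.

Definition stalk (x : T) := germs F [set x].

HB.instance Definition _ (x : T) := GRing.Lmodule.on (stalk x).

Lemma opens_sub1 (x : T) (U : opens T) : U x -> [set x] `<=` U.
Proof. by move=> Ux y ->. Qed.

Definition germ_at (x : T) (U : opens T) (Ux : U x) (s : F U) : stalk x :=
  germ (opens_sub1 Ux) s.

Lemma germ_at_linear (x : T) (U : opens T) (Ux : U x) : linear (germ_at Ux).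
Proof. exact: germ_linear. Qed.

HB.instance Definition _ (x : T) (U : opens T) (Ux : U x) :=
  GRing.isLinear.Build K (F U) (stalk x) *:%R (germ_at Ux) (germ_at_linear Ux).

End Stalks.

(** Sheaves of families [y |-> s y] of elements of vector spaces [E y],
    cut out by a linear condition of local nature. *)
Section FamilySheaf.
Context {K : fieldType} {T : topologicalType}.
Variable E : T -> lmodType K.

Definition family (U : opens T) : Type := dprod (fun y : set_type U => E (val y)).

HB.instance Definition _ U := GRing.Lmodule.on (family U).

Definition set_type_incl (U V : opens T) (VU : V `<=` U) (y : set_type V) :
    set_type U :=
  exist _ (val y) (mem_set (VU _ (set_mem (valP y)))).

Definition family_res (U V : opens T) (VU : V `<=` U) (s : family U) :
    family V :=
  fun y => s (set_type_incl VU y).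

Lemma family_irr (U : opens T) (s : family U) x (p q : x \in (U : set T)) :
  s (exist _ x p) = s (exist _ x q).
Proof. by rewrite (bool_irrelevance p q). Qed.

Record local_condition := LocalCondition {
  lc_set :> forall U : opens T, lsub (family U);
  lc_res : forall (U V : opens T) (VU : V `<=` U) s,
    lc_set U s -> lc_set V (family_res VU s);
  lc_local : forall (U : opens T) (s : family U),
    (forall y, U y -> exists (V : opens T) (VU : V `<=` U),
       V y /\ lc_set V (family_res VU s)) -> lc_set U s }.

Variable P : local_condition.

Definition fsections (U : opens T) : lmodType K := lsub_type (P U).

Definition fres_fun (U V : opens T) (VU : V `<=` U) (s : fsections U) :
    fsections V :=
  lsub_in (lc_res VU (lsub_valP s)).

Fact fres_linear U V VU : linear (@fres_fun U V VU).
Proof. by move=> a s t; apply: val_inj. Qed.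

Fact fres_id (U : opens T) (UU : U `<=` U) s :
  linear_of (fres_linear UU) s = s.
Proof.
apply: val_inj; apply: functional_extensionality_dep => -[y Uy].
by rewrite /= /family_res; exact: (family_irr (lsub_val s) _ Uy).
Qed.

Fact fres_comp (U V W : opens T) (VU : V `<=` U) (WV : W `<=` V)
    (WU : W `<=` U) s :
  linear_of (fres_linear WV) (linear_of (fres_linear VU) s)
  = linear_of (fres_linear WU) s.
Proof.
apply: val_inj; apply: functional_extensionality_dep => -[y Wy].
by rewrite /= /family_res; exact: (family_irr (lsub_val s)).
Qed.

Definition family_presheaf : presheaf K T := Presheaf fres_id fres_comp.

Fact family_is_sheaf : is_sheaf family_presheaf.
Proof.
move=> I U V VU s cov agree.
have cov' (y : set_type U) : exists i, V i (val y).
  by have [i _ Viy] := cov _ (set_mem (valP y)); exists i.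
have [i Pi] := choice cov'.
pose t : family U := fun y => lsub_val (s (i y)) (exist _ (val y) (mem_set (Pi y))).
have tE j : family_res (VU j) t = lsub_val (s j).
  apply: functional_extensionality_dep => -[y Vy]; rewrite /family_res /t.
  set y' := set_type_incl _ _.
  have Wy : opensI (V (i y')) (V j) y.
    by split; [exact: (Pi y')|exact: (set_mem Vy)].
  have /(congr1 (@lsub_val _ _ _)) := agree (i y') j.
  move=> /(congr1 (fun f => f (exist _ y (mem_set Wy)))) e.
  transitivity (lsub_val (s (i y')) (set_type_incl (@opensIl _ _ _)
    (exist _ y (mem_set Wy) : set_type (opensI (V (i y')) (V j))))).
    by rewrite /set_type_incl /=; exact: (family_irr (lsub_val (s (i y')))).
  by rewrite [LHS]e /= /family_res; exact: (family_irr (lsub_val (s j))).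
have Pt : P U t.
  apply: lc_local => y Uy; have [j _ Vjy] := cov _ Uy.
  by exists (V j), (VU j); split=> //; rewrite tE; exact: lsub_valP.
exists (lsub_in Pt); split=> [j|t' t'E].
  by apply: val_inj; exact: tE.
apply: val_inj; apply: functional_extensionality_dep => -[y Uy].
set y' : set_type U := exist _ y Uy.
pose z : set_type (V (i y')) := exist _ y (mem_set (Pi y' : V (i y') y)).
have e : lsub_val (res family_presheaf (VU (i y')) t') z = lsub_val (s (i y')) z.
  by rewrite t'E.
by rewrite /= /t -[LHS]e /= /family_res; exact: (family_irr (lsub_val t')).
Qed.

Definition family_sheaf : sheaf K T := Sheaf family_is_sheaf.

End FamilySheaf.

(** Inverse image under a continuous map [f]: the sections of [f^-1 F] over
    [U] are the families of germs [s y] in the stalks of [F] at [f y], [y] in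
    [U], that are locally induced by a section of [F].  With [f = id] this is
    the sheaf associated with [F]. *)
Section InverseImage.
Context {K : fieldType} {S T : topologicalType}.
Variables (f : S -> T) (F : presheaf K T).

Definition induced_by (U : opens S) (s : family (fun y => stalk F (f y)) U)
    (W : opens S) (V : opens T) (t : F V) : Prop :=
  forall (y : set_type U) (Vfy : V (f (val y))),
    W (val y) -> s y = germ_at Vfy t.

Definition locally_induced (U : opens S)
    (s : family (fun y => stalk F (f y)) U) : Prop :=
  forall y, U y -> exists (W : opens S) (V : opens T) (t : F V),
    [/\ W y, W `<=` f @^-1` V & induced_by s W t].

Fact locally_induced0 U : @locally_induced U 0.
Proof.
move=> y Uy; exists (opensT S), (opensT T), 0; split=> // z Vfz _.
by rewrite linear0.
Qed.

Fact locally_inducedP U a (s t : family (fun y => stalk F (f y)) U) :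
  locally_induced s -> locally_induced t -> locally_induced (a *: s + t).
Proof.
move=> hs ht y Uy.
have [W [V [s' [Wy WV e]]]] := hs y Uy.
have [W' [V' [t' [W'y WV' e']]]] := ht y Uy.
exists (opensI W W'), (opensI V V'),
  (a *: res F (@opensIl _ _ _) s' + res F (@opensIr _ _ _) t').
split=> //; first by move=> z [Wz W'z]; split; [exact: WV|exact: WV'].
move=> z [Vz V'z] [Wz W'z].
transitivity (a *: s z + t z); first by [].
rewrite (e z Vz Wz) (e' z V'z W'z) germ_at_linear /germ_at.
by rewrite (germ_res (opens_sub1 Vz)) (germ_res (opens_sub1 V'z)).
Qed.

Definition inverse_image_lsub (U : opens S) :
    lsub (family (fun y => stalk F (f y)) U) :=
  LSub (@locally_induced0 U) (@locally_inducedP U).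

Fact locally_induced_res (U V : opens S) (VU : V `<=` U) s :
  inverse_image_lsub U s -> inverse_image_lsub V (family_res VU s).
Proof.
move=> hs y Vy; have [W [V' [t [Wy WV e]]]] := hs y (VU _ Vy).
exists W, V', t; split=> // z Vfz Wz.
exact (e (set_type_incl VU z) Vfz Wz).
Qed.

Fact locally_induced_local (U : opens S)
    (s : family (fun y => stalk F (f y)) U) :
  (forall y, U y -> exists (V : opens S) (VU : V `<=` U),
     V y /\ inverse_image_lsub V (family_res VU s)) -> inverse_image_lsub U s.
Proof.
move=> h y Uy; have [V [VU [Vy hV]]] := h y Uy.
have [W [V' [t [Wy WV e]]]] := hV y Vy.
exists (opensI W V), V', t; split=> //; first by move=> z [Wz _]; exact: WV.
move=> z Vfz [Wz Vz].
case: z Wz Vz Vfz => z Uz Wz Vz Vfz.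
have <- := e (exist _ z (mem_set Vz)) Vfz Wz.
exact: (family_irr (E := fun y => stalk F (f y))).
Qed.

Definition inverse_image : sheaf K S :=
  family_sheaf (LocalCondition locally_induced_res locally_induced_local).

Fact unit_locally_induced (s : F (opensT T)) :
  inverse_image_lsub (opensT S)
    (fun y => germ_at (I : opensT T (f (val y))) s).
Proof.
move=> y _; exists (opensT S), (opensT T), s; split=> // z Vfz _.
by congr germ_at; exact: Prop_irrelevance.
Qed.

Definition inverse_image_unit (s : F (opensT T)) : inverse_image (opensT S) :=
  lsub_in (unit_locally_induced s).

Fact inverse_image_unit_linear : linear inverse_image_unit.
Proof.
move=> a s t; apply: val_inj; apply: functional_extensionality_dep => y.
exact: germ_at_linear.
Qed.

HB.instance Definition _ := GRing.isLinear.Build K (F (opensT T))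
  (inverse_image (opensT S)) *:%R inverse_image_unit inverse_image_unit_linear.

End InverseImage.

Section GermsToSections.
Context {K : fieldType} {T : topologicalType}.
Variables (F : presheaf K T) (A : set T).

Definition germs_at (x : T) (Ax : A x) (g : germs F A) : stalk F x :=
  germ_at (nbsec_sub (repr g) Ax) (nbsec_val (repr g)).

Lemma germs_at_germ (x : T) (Ax : A x) (U : opens T) (AU : A `<=` U) s :
  germs_at Ax (germ AU s) = germ_at (AU x Ax) s.
Proof.
have [W [h1 [h2 [AW e]]]] := repr_germ AU s.
by apply/germ_eq; exists W, h1, h2; split=> // y ->; exact: AW.
Qed.

Fact germs_locally_induced (g : germs F A) :
  inverse_image_lsub (set_val : A -> T) F (opensT (set_type A))
    (fun y => germs_at (set_mem (valP (val y))) g).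
Proof.
move=> y _; exists (opensT (set_type A)), (repr g), (nbsec_val (repr g)).
split=> // [z _|z Vfz _]; first exact: (nbsec_sub (repr g) (set_mem (valP z))).
by congr germ_at; exact: Prop_irrelevance.
Qed.

(** the canonical map [colim_(U contains A) F U -> Gamma(A, j^-1 F)], with [j]
    the inclusion of [A]; [germs_at_germ] is its independence of the
    representative *)
Definition germs_to_sections (g : germs F A) :
    inverse_image (set_val : A -> T) F (opensT (set_type A)) :=
  lsub_in (germs_locally_induced g).

Fact germs_to_sections_linear : linear germs_to_sections.
Proof.
move=> a g h; apply: val_inj; apply: functional_extensionality_dep => y.
have [U [AU [s [t [-> ->]]]]] := germ_surj2 g h.
rewrite -germ_linear /=.
transitivity (a *: germs_at (set_mem (valP (val y))) (germ AU s)
  + germs_at (set_mem (valP (val y))) (germ AU t)); last by [].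
by rewrite !germs_at_germ germ_at_linear.
Qed.

HB.instance Definition _ := GRing.isLinear.Build K (germs F A)
  (inverse_image (set_val : A -> T) F (opensT (set_type A))) *:%R
  germs_to_sections germs_to_sections_linear.

End GermsToSections.

Section QuotientMap.
Context {K : fieldType}.
Variables (V W : lmodType K) (f : {linear V -> W}) (A : lsub V) (B : lsub W).
Hypothesis fAB : forall v, A v -> B (f v).

Definition lquot_map (x : lquot A) : lquot B := lpi B (f (repr x : V)).

Lemma lquot_mapE v : lquot_map (lpi A v) = lpi B (f v).
Proof.
apply/lpi_eq; rewrite -linearB; apply: fAB.
by apply/lpi_eq; rewrite lpiK.
Qed.

Fact lquot_map_linear : linear lquot_map.
Proof.
move=> a x y; rewrite -[x]lpiK -[y]lpiK -lpi_linear !lquot_mapE linearP.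
exact: lpi_linear.
Qed.

End QuotientMap.

Section Godement.
Context {K : fieldType} {T : topologicalType}.

Section FlasqueEmbedding.
Variable F : presheaf K T.

Definition all_families (U : opens T) : lsub (family (stalk F) U) :=
  LSub (lsub_set := setT) I (fun _ _ _ _ _ => I).

(** the sheaf of discontinuous sections of [F] *)
Definition godement0 : sheaf K T :=
  family_sheaf (@LocalCondition _ _ (stalk F) all_families
    (fun _ _ _ _ _ => I) (fun _ _ _ => I)).

Definition godement_unit (U : opens T) (s : F U) : godement0 U :=
  lsub_in (S := all_families U) (v := fun y => germ_at (set_mem (valP y)) s) I.

Fact godement_unit_linear U : linear (@godement_unit U).
Proof.
move=> a s t; apply: val_inj; apply: functional_extensionality_dep => y.
exact: germ_at_linear.
Qed.

HB.instance Definition _ U := GRing.isLinear.Build K (F U) (godement0 U) *:%R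
  (@godement_unit U) (@godement_unit_linear U).

Lemma godement_unit_res (U V : opens T) (VU : V `<=` U) s :
  res godement0 VU (godement_unit s) = godement_unit (res F VU s).
Proof.
apply: val_inj; apply: functional_extensionality_dep => y.
by symmetry; apply: germ_res.
Qed.

Definition godement_im (U : opens T) : lsub (godement0 U) :=
  limage (@godement_unit U) (lfull _).

Fact godement_im_res (U V : opens T) (VU : V `<=` U) s :
  godement_im U s -> godement_im V (res godement0 VU s).
Proof.
by move=> [t _ <-]; exists (res F VU t) => //; rewrite godement_unit_res.
Qed.

Definition coker_res (U V : opens T) (VU : V `<=` U) :=
  linear_of (lquot_map_linear (godement_im_res VU)).

Fact coker_res_id (U : opens T) (UU : U `<=` U) s : coker_res UU s = s.
Proof.
rewrite -[s]lpiK /= (lquot_mapE (godement_im_res UU)).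
exact (congr1 (lpi _) (@res_id _ _ godement0 U UU _)).
Qed.

Fact coker_res_comp (U V W : opens T) (VU : V `<=` U) (WV : W `<=` V)
    (WU : W `<=` U) s : coker_res WV (coker_res VU s) = coker_res WU s.
Proof.
rewrite -[s]lpiK /=.
rewrite (lquot_mapE (godement_im_res VU)).
rewrite (lquot_mapE (godement_im_res WV)).
rewrite (lquot_mapE (godement_im_res WU)).
exact (congr1 (lpi _) (@res_comp _ _ godement0 U V W VU WV WU _)).
Qed.

Definition coker_presheaf : presheaf K T := Presheaf coker_res_id coker_res_comp.

Definition syzygy : sheaf K T := inverse_image id coker_presheaf.

End FlasqueEmbedding.

Fixpoint syzygies (F : sheaf K T) (n : nat) : sheaf K T :=
  if n is n'.+1 then syzygy (syzygies F n') else F.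

(** [C^n F = godement0 (Z^n F)] with [Z^0 F = F] and [Z^(n+1) F] the cokernel
    of [Z^n F -> C^n F]; the differential is the composite
    [C^n F -> Z^(n+1) F -> C^(n+1) F]. *)
Definition godement (F : sheaf K T) (n : nat) : sheaf K T :=
  godement0 (syzygies F n).

Definition godement_diff (F : sheaf K T) (n : nat)
    (s : godement F n (opensT T)) : godement F n.+1 (opensT T) :=
  godement_unit (inverse_image_unit id (F := coker_presheaf (syzygies F n))
    (lpi (godement_im (syzygies F n) (opensT T)) s)).

Fact godement_diff_linear F n : linear (@godement_diff F n).
Proof.
by move=> a s t; rewrite /godement_diff lpi_linear !linearP.
Qed.

HB.instance Definition _ F n := GRing.isLinear.Build K
  (godement F n (opensT T)) (godement F n.+1 (opensT T)) *:%R
  (@godement_diff F n) (@godement_diff_linear F n).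

Section Supports.
Variable F : presheaf K T.

Definition supp (s : F (opensT T)) : set T :=
  [set x | germ_at (I : opensT T x) s != 0].

Lemma supp_closed (s : F (opensT T)) : closed (supp s).
Proof.
rewrite -[supp s]setCK; apply: open_closedC; rewrite openE => x.
move=> /negP/negPn/eqP; rewrite -[0](linear0 (germ_at (I : opensT T x))).
move=> /germ_eq[W [h1 [h2 [Wx e]]]]; rewrite /interior /=.
apply: (@filterS _ _ _ W); last first.
  by apply: open_nbhs_nbhs; split; [exact: opens_open|exact: Wx].
move=> y Wy; apply/negP/negPn/eqP.
rewrite -[RHS](linear0 (germ_at (I : opensT T y))); apply/germ_eq.
by exists W, h1, h2; split=> // z ->.
Qed.

End Supports.

Record support_family := SupportFamily {
  support_set :> set (set T);
  support0 : support_set set0;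
  supportU : forall A B, support_set A -> support_set B -> support_set (A `|` B);
  support_sub : forall A B,
    support_set A -> closed B -> B `<=` A -> support_set B }.

Fact closed_support_sub (A B : set T) :
  closed A -> closed B -> B `<=` A -> closed B.
Proof. by []. Qed.

Definition closed_supports : support_family :=
  @SupportFamily closed closed0 (@closedU T) closed_support_sub.

Fact compact_support_sub (A B : set T) :
  compact A -> closed B -> B `<=` A -> compact B.
Proof. by move=> cA cB BA; exact: subclosed_compact cB cA BA. Qed.

Definition compact_supports : support_family :=
  @SupportFamily compact compact0 (@compactU T) compact_support_sub.

Section Cohomology.
Variable Phi : support_family.

Section Gamma.
Variable F : presheaf K T.

Fact Gamma0 : Phi (supp (0 : F (opensT T))).
Proof.
apply: support_sub (support0 Phi) (@supp_closed _ _) _ => x /=.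
by rewrite /supp /= linear0 eqxx.
Qed.

Fact GammaP a (s t : F (opensT T)) :
  Phi (supp s) -> Phi (supp t) -> Phi (supp (a *: s + t)).
Proof.
move=> hs ht; apply: support_sub (supportU hs ht) (@supp_closed _ _) _ => x.
rewrite /supp /= linearP /=.
case: (eqVneq (germ_at (I : opensT T x) s) 0) => [->|]; last by left.
by rewrite scaler0 add0r; right.
Qed.

Definition Gamma : lsub (F (opensT T)) :=
  LSub (lsub_set := fun s => Phi (supp s)) Gamma0 GammaP.

End Gamma.

Variable F : sheaf K T.

Definition cocycles (n : nat) : lsub (godement F n (opensT T)) :=
  lcap (Gamma (godement F n)) (lker (@godement_diff F n)).

Definition coboundaries (n : nat) : lsub (godement F n (opensT T)) :=
  if n is n'.+1 then limage (@godement_diff F n') (Gamma (godement F n'))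
  else lzero _.

(** [H^n_Phi(T, F)] is the [n]-th cohomology of the complex of sections with
    support in [Phi] of Godement's canonical flasque resolution.  Coboundaries
    are pulled back to the space of cocycles, so the quotient makes sense
    without a proof that the differential squares to [0]. *)
Definition cohomology_with_supports (n : nat) : lmodType K :=
  lquot (lpreim (linear_of (@lsub_val_linear K _ (cocycles n)))
    (coboundaries n)).

End Cohomology.

Definition cohomology (n : nat) (F : sheaf K T) : lmodType K :=
  cohomology_with_supports closed_supports F n.

Definition compact_cohomology (n : nat) (F : sheaf K T) : lmodType K :=
  cohomology_with_supports compact_supports F n.

End Godement.

Definition complex_field (R : realType) : numClosedFieldType := R[i].

(** complex differentiability at each point; meaningful for [D] open *)
Definition holomorphic_on (C : numClosedFieldType) (V W : normedModType C)
    (D : set V) (f : V -> W) : Prop :=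
  forall z, D z -> differentiable f z.

Section NearDifferentiable.
Variables (C : numFieldType) (V W : normedModType C).

Lemma near_differentiable (f g : V -> W) (x : V) :
  (\forall y \near x, f y = g y) -> differentiable f x -> differentiable g x.
Proof.
move=> fg /diff_locallyP[dfc dfo].
have fgx : f x = g x by exact: nbhs_singleton fg.
have dgo : g \o shift x = cst (g x) + 'd f x +o_ (0 : V) id.
  apply/eqaddoP => e e0.
  have /eqaddoP/(_ e e0) := dfo.
  have : \forall h \near (0 : V), f (h + x) = g (h + x).
    by move: fg; rewrite (near_shift 0 x) subr0.
  apply: filterS2 => h fgh.
  by rewrite /= !fctE /= fgh fgx.
have dE := diff_unique dfc dgo.
by apply/diff_locallyP; rewrite dE.
Qed.

End NearDifferentiable.

Section Manifolds.
Context {R : realType} {n : nat}.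
Local Notation C := (complex_field R).

(** A chart is an open set with a homeomorphism onto an open subset of [C^n];
    only the values of [coord] on [dom] matter. *)
Record chart (T : topologicalType) := Chart {
  dom : opens T;
  coord : T -> 'rV[C]_n;
  coord_inj : forall x y, dom x -> dom y -> coord x = coord y -> x = y;
  coord_continuous : forall x, dom x -> {for x, continuous coord};
  coord_open : forall V : set T, open V -> V `<=` dom -> open (coord @` V) }.

Definition holomorphic_transition (T : topologicalType) (phi psi : chart T) :=
  exists2 t : 'rV[C]_n -> 'rV[C]_n,
    holomorphic_on (coord phi @` (dom phi `&` dom psi)) t &
    forall x, dom phi x -> dom psi x -> coord psi x = t (coord phi x).

Record complexManifold := ComplexManifold {
  mspace :> topologicalType;
  mhausdorff : hausdorff_space mspace;
  msecond_countable : @second_countable mspace;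
  atlas : set (chart mspace);
  atlas_cover : forall x, exists2 phi, atlas phi & dom phi x;
  atlas_compatible : forall phi psi,
    atlas phi -> atlas psi -> holomorphic_transition phi psi }.

Arguments atlas : clear implicits.

Section StructureSheaf.
Variable X : complexManifold.

(** [f] is holomorphic on [U] if [f \o phi^-1] is holomorphic on
    [phi (U `&` dom phi)] for every chart [phi] *)
Definition holomorphic (U : opens X)
    (f : family (fun _ : X => C : lmodType C) U) : Prop :=
  forall phi, atlas X phi ->
    exists2 g : 'rV[C]_n -> C,
      holomorphic_on (coord phi @` (U `&` dom phi)) g &
      forall x : set_type U,
        dom phi (val x) -> f x = g (coord phi (val x)).

Fact holomorphic0 U : @holomorphic U 0.
Proof.
move=> phi _; exists (cst 0) => // z _; exact: differentiable_cst.
Qed.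

Fact holomorphicP U a (f g : family (fun _ : X => C : lmodType C) U) :
  holomorphic f -> holomorphic g -> holomorphic (a *: f + g).
Proof.
move=> hf hg phi Aphi; have [f' df fE] := hf phi Aphi.
have [g' dg gE] := hg phi Aphi.
exists (a *: f' + g') => [z Dz|x Dx].
  by apply: differentiableD; [apply: differentiableZ; exact: df|exact: dg].
by rewrite [LHS]/(a *: f x + g x) fE // gE.
Qed.

Definition holomorphic_lsub (U : opens X) :
    lsub (family (fun _ : X => C : lmodType C) U) :=
  LSub (@holomorphic0 U) (@holomorphicP U).

Fact holomorphic_res (U V : opens X) (VU : V `<=` U) f :
  holomorphic_lsub U f -> holomorphic_lsub V (family_res VU f).
Proof.
move=> hf phi Aphi; have [g dg gE] := hf phi Aphi.
exists g => [z [x [Vx Dx] <-]|x Dx].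
  by apply: dg; exists x => //; split=> //; exact: VU.
exact: (gE (set_type_incl VU x)).
Qed.

Fact holomorphic_local (U : opens X)
    (f : family (fun _ : X => C : lmodType C) U) :
  (forall y, U y -> exists (V : opens X) (VU : V `<=` U),
     V y /\ holomorphic_lsub V (family_res VU f)) -> holomorphic_lsub U f.
Proof.
move=> hf phi Aphi.
have ex z : exists c, forall x : set_type U, dom phi (val x) ->
    coord phi (val x) = z -> f x = c.
  have [[x [Dx xz]]|no] := pselect (exists x : set_type U,
      dom phi (val x) /\ coord phi (val x) = z).
    exists (f x) => y Dy yz; congr f; apply: val_inj.
    by apply: (coord_inj (c := phi)) => //; rewrite xz.
  by exists 0 => x Dx xz; case: no; exists x.
have [g gE] := choice ex.
exists g; last by move=> x Dx; exact: gE.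
move=> z [x [Ux Dx] <-].
have [V [VU [Vx hV]]] := hf x Ux.
have [h dh hE] := hV phi Aphi.
apply: (near_differentiable (f := h)); last by apply: dh; exists x.
have oVD : open (coord phi @` (V `&` dom phi)).
  apply: coord_open; last by move=> y [].
  by apply: openI; exact: opens_open.
apply: (@filterS _ _ _ (coord phi @` (V `&` dom phi))); last first.
  by apply: open_nbhs_nbhs; split=> //; exists x.
move=> _ [y [Vy Dy] <-].
rewrite -(gE _ (exist _ y (mem_set (VU _ Vy)) : set_type U) Dy erefl).
rewrite -(hE (exist _ y (mem_set Vy)) Dy) /family_res.
by congr f; exact: val_inj.
Qed.

Definition structure_sheaf : sheaf C X :=
  family_sheaf (LocalCondition holomorphic_res holomorphic_local).

End StructureSheaf.

Section OpenSubmanifold.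
Variables (X : complexManifold) (W : opens X).

Lemma set_val_continuous (A : set X) : continuous (set_val : A -> X).
Proof. exact: initial_continuous. Qed.

Definition opens_preim (U : opens X) : opens (set_type W) :=
  Opens (open_comp (fun x _ => @set_val_continuous W x) (opens_open U)).

Lemma set_val_open (V : set (set_type W)) : open V -> open (set_val @` V).
Proof.
move=> [B oB <-].
have -> : (set_val : W -> X) @` (set_val @^-1` B) = B `&` W.
  apply/seteqP; split=> [_ [y By <-]|x [Bx Wx]].
    by split=> //; exact: set_mem (valP y).
  by exists (exist _ x (mem_set Wx)).
by apply: openI => //; exact: opens_open.
Qed.

Section Restriction.
Variable phi : chart X.

Fact restr_inj (x y : set_type W) : opens_preim (dom phi) x ->
  opens_preim (dom phi) y -> coord phi (val x) = coord phi (val y) -> x = y.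
Proof.
by move=> Dx Dy e; apply: val_inj; exact: coord_inj Dx Dy e.
Qed.

Fact restr_continuous (x : set_type W) : opens_preim (dom phi) x ->
  {for x, continuous (fun y : set_type W => coord phi (val y))}.
Proof.
move=> Dx; apply: continuous_comp; first exact: set_val_continuous.
exact: coord_continuous.
Qed.

Fact restr_open (V : set (set_type W)) :
  open V -> V `<=` opens_preim (dom phi) ->
  open ((fun y : set_type W => coord phi (val y)) @` V).
Proof.
move=> oV VD; rewrite -(image_comp (set_val : W -> X) (coord phi)).
by apply: coord_open; [exact: set_val_open|move=> _ [x Vx <-]; exact: VD].
Qed.

Definition restr_chart : chart (set_type W) :=
  Chart restr_inj restr_continuous restr_open.

End Restriction.

Fact restr_cover (x : set_type W) :
  exists2 phi, (restr_chart @` atlas X) phi & dom phi x.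
Proof.
have [phi Aphi Dx] := atlas_cover (val x).
by exists (restr_chart phi) => //; exists phi.
Qed.

Fact restr_compatible (phi psi : chart (set_type W)) :
  (restr_chart @` atlas X) phi -> (restr_chart @` atlas X) psi ->
  holomorphic_transition phi psi.
Proof.
move=> [phi' Aphi <-] [psi' Apsi <-].
have [t dt tE] := atlas_compatible Aphi Apsi.
exists t => [z [x [Dx D'x] <-]|x Dx D'x]; last exact: tE.
by apply: dt; exists (val x).
Qed.

Fact restr_hausdorff : hausdorff_space (set_type W).
Proof.
move=> x y xy; apply: val_inj; apply: mhausdorff => A B nA nB.
have [z [Az Bz]] := xy _ _ (set_val_continuous nA) (set_val_continuous nB).
by exists (val z).
Qed.

Fact restr_second_countable : @second_countable (set_type W).
Proof.
have [B cB [oB bB]] := msecond_countable X.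
exists [set set_val @^-1` A | A in B]; first exact: sub_countable (card_image_le _ _) cB.
split.
  move=> _ [A BA <-]; apply: open_comp; last exact: oB.
  by move=> ? _; exact: set_val_continuous.
move=> x V; rewrite nbhsE => -[V' [[U oU UV'] V'x] V'V].
have Ux : U (val x) by move: V'x; rewrite -UV'.
have [A [BA Ax] AU] := bB (val x) U (open_nbhs_nbhs (conj oU Ux)).
exists (set_val @^-1` A); first by split=> //; exists A.
by move=> y Ay; apply: V'V; rewrite -UV'; exact: AU.
Qed.

Definition open_submanifold : complexManifold :=
  ComplexManifold restr_hausdorff restr_second_countable
    restr_cover restr_compatible.

End OpenSubmanifold.

Definition compact_compl (X : complexManifold) (K : set X) (cK : compact K) :
    opens X :=
  Opens (closed_openC (compact_closed (@mhausdorff X) cK)).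

Definition hartogs_phenomenon (W : complexManifold) : Prop :=
  ~ compact [set: W] /\
  forall (K : set W) (cK : compact K), connected (~` K) ->
    bijective (res (structure_sheaf W)
      (@subsetT _ _ : compact_compl cK `<=` opensT W)).

Record analyticSet (X : complexManifold) := AnalyticSet {
  aset :> set X;
  aset_closed : closed aset;
  aset_local : forall x, aset x ->
    exists (U : opens X) (k : nat) (f : 'I_k -> structure_sheaf X U),
      U x /\
      forall y : set_type U, aset (val y) <-> forall i, lsub_val (f i) y = 0 }.

Definition analytic_compl (X : complexManifold) (Z : analyticSet X) : opens X :=
  Opens (closed_openC (@aset_closed X Z)).

(** [Z] is, near [x], a submanifold of dimension [d] *)
Definition regular_point (X : complexManifold) (Z : set X) (d : nat) (x : X) :=
  exists phi : chart X,
    [/\ forall psi, atlas X psi ->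
          holomorphic_transition phi psi /\ holomorphic_transition psi phi,
        Z x, dom phi x, (d <= n)%N &
        forall y, dom phi y ->
          (Z y <-> forall i : 'I_n, (d <= i)%N -> coord phi y 0 i = 0)].

(** the dimension of an analytic set is the largest dimension at its regular
    points *)
Definition analytic_dim (X : complexManifold) (Z : analyticSet X) (d : nat) :=
  (exists x, regular_point Z d x) /\
  forall d' x, regular_point Z d' x -> (d' <= d)%N.

Definition analytic_codim (X : complexManifold) (Z : analyticSet X) (c : nat) :=
  exists2 d, analytic_dim Z d & (d + c = n)%N.

End Manifolds.

Arguments chart R n T : clear implicits.
Arguments complexManifold R n : clear implicits.

(* Main.v *)
Require Import Defs.
From HB Require Import structures.
From mathcomp Require Import all_boot all_order all_algebra.
From mathcomp Require Import all_classical all_reals all_analysis.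
From mathcomp.real_closed Require Import complex.
From mathcomp Require Import ring lra.

Set Implicit Arguments.
Unset Strict Implicit.
Unset Printing Implicit Defensive.

Import Order.TTheory GRing.Theory Num.Theory numFieldNormedType.Exports.
Local Open Scope classical_set_scope.
Local Open Scope ring_scope.

(** Write [W] for the complement of [Z] and [O] for the sheaf of holomorphic
    functions.  The germs of [F] along [Z] are the sections of its restriction to
    [Z] because [Z] is closed in a compact Hausdorff space
    ([germs_to_sections_bij]).  The three assertions are proved in a circle.

    Hartogs extension gives global sections ([hartogs_germs_extend]).  A germ along
    [Z] is a section of [F] on a connected neighbourhood [Q] of [Z]
    ([connected_nbhd]).  Since [Z] is thin, [Q \ Z] is connected
    ([connected_diff_thin]); it is the complement in [W] of the compact set
    [X \ Q].  As [F] is [O] on [W], the section extends to [W], and the extension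
    glues with the section on [Q].

    Global sections give the dimension bound ([compact_cohomology_dim]).
    Extension by zero maps [H^1_c(W, O)] to [H^1(X, F)].  If the extension of a
    compactly supported cocycle is the coboundary of [s], then [s] is a section of
    [F] near [Z].  It has the same germs along [Z] as a global section [t], so
    [s - t] is zero near [Z] and bounds the cocycle with compact support
    ([ext_cochain_cobound]).  The map is thus injective.

    The dimension bound gives Hartogs extension ([hartogs_of_finite_dim]).  Let [K]
    be compact in [W] with connected complement [D], and let [f] be holomorphic on
    [D].  The connecting map from [O(D)] to [H^1_c(W, O)] kills exactly the
    functions that extend to [W], so the polynomials [P] such that [P(f)] extends
    form a subalgebra [S] of finite codimension in [C[x]].  Moreover, if
    [P^2 - c P] and [P (P^2 - c P)] belong to [S], then so does [P]
    ([quotient_extends]): their values [u], [v] at [f] extend to [W] and satisfy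
    [v^2 - c u v = u^3], so [v / u], which is [P(f)] on [D], is integral over the
    holomorphic functions, and a manifold is normal.  An induction on the degree
    of a generator of an ideal inside [S] shows that [S] contains [x]
    ([finite_codim_full]), that is, [f] extends.

    The complex analysis behind this is the identity theorem, the normality
    statement for [v^2 - c u v = u^3] ([local_quotient]), and the holomorphy of
    certain glued functions, all of which reduce to Taylor expansions with
    remainder in one variable ([taylor]). *)

(** * Modulus and complex differentiability *)

Lemma open_from (T : topologicalType) (A : set T) :
  (forall x, A x -> exists2 N : set T, open N /\ N x & N `<=` A) -> open A.
Proof.
move=> h; rewrite openE => x /h[N oNx NA].
exact: filterS NA (open_nbhs_nbhs oNx).
Qed.

Section Nrm.
Variable R : realType.
Local Notation C := (complex_field R).
Implicit Type V : normedModType C.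

(** The norm of a complex normed space takes values in the complex field itself;
    [nrm] is the same number as an element of [R], where the order is total. *)
Definition nrm V (h : V) : R := complex.Re `|h|.

Lemma nrmE V (h : V) : `|h| = (nrm h)%:C%C.
Proof. by rewrite /nrm RRe_real // ger0_real. Qed.

Lemma nrm_ge0 V (h : V) : 0 <= nrm h.
Proof. by rewrite -ler0c -nrmE. Qed.

Lemma nrm0 V : nrm (0 : V) = 0.
Proof. by rewrite /nrm normr0. Qed.

Lemma nrm_eq0 V (h : V) : (nrm h == 0) = (h == 0).
Proof. by rewrite -[RHS]normr_eq0 nrmE fmorph_eq0. Qed.

Lemma nrm_gt0 V (h : V) : (0 < nrm h) = (h != 0).
Proof. by rewrite lt0r nrm_ge0 nrm_eq0 andbT. Qed.

Lemma nrm_le0 V (h : V) : nrm h <= 0 -> h = 0.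
Proof. by move=> h0; apply/eqP; rewrite -nrm_eq0 eq_le nrm_ge0 h0. Qed.

Lemma nrmN V (h : V) : nrm (- h) = nrm h.
Proof. by rewrite /nrm normrN. Qed.

Lemma nrmD V (h k : V) : nrm (h + k) <= nrm h + nrm k.
Proof. by rewrite -lecR rmorphD /= -!nrmE ler_normD. Qed.

Lemma nrmB V (h k : V) : nrm (h - k) <= nrm h + nrm k.
Proof. by rewrite -[nrm k]nrmN nrmD. Qed.

Lemma nrmC V (h k : V) : nrm (h - k) = nrm (k - h).
Proof. by rewrite -nrmN opprB. Qed.

Lemma nrm_tri V (h k l : V) : nrm (h - l) <= nrm (h - k) + nrm (k - l).
Proof. by rewrite -[h - l](subrKA k) nrmD. Qed.

Lemma nrmZ V (a : C) (h : V) : nrm (a *: h) = nrm a * nrm h.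
Proof. by apply: (@complexI R); rewrite rmorphM /= -!nrmE normrZ. Qed.

Lemma nrmM (a b : C) : nrm (a * b) = nrm a * nrm b.
Proof. exact: (@nrmZ C). Qed.

Lemma nrm1 : nrm (1 : C) = 1.
Proof. by rewrite /nrm normr1. Qed.

Lemma nrmX (a : C) k : nrm (a ^+ k) = nrm a ^+ k.
Proof. by elim: k => [|k IH]; rewrite ?nrm1 // !exprS nrmM IH. Qed.

Lemma nrmV (a : C) : nrm a^-1 = (nrm a)^-1.
Proof. by apply: (@complexI R); rewrite fmorphV /= -!nrmE normfV. Qed.

Lemma nrm_real (a : R) : nrm (a%:C%C : C) = `|a|.
Proof. by rewrite /nrm normc_def /= expr0n /= addr0 sqrtr_sqr. Qed.

(** The embedding of the reals, typed in [complex_field R] so that products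
    with complex numbers are products of that field. *)
Definition rc (a : R) : C := a%:C%C.

Lemma rcD a b : rc (a + b) = rc a + rc b. Proof. exact: rmorphD. Qed.
Lemma rcN a : rc (- a) = - rc a. Proof. exact: rmorphN. Qed.
Lemma rcM a b : rc (a * b) = rc a * rc b. Proof. exact: rmorphM. Qed.
Lemma rcV a : rc a^-1 = (rc a)^-1. Proof. exact: fmorphV. Qed.
Lemma rc0 : rc 0 = 0. Proof. by []. Qed.
Lemma rc1 : rc 1 = 1. Proof. by []. Qed.
Lemma nrm_rc a : nrm (rc a) = `|a|. Proof. exact: nrm_real. Qed.

Lemma nrm_Re (a : C) : `|complex.Re a| <= nrm a.
Proof. by rewrite -lecR -nrmE normc_ge_Re. Qed.

Lemma nrm_Im (a : C) : `|complex.Im a| <= nrm a.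
Proof.
case: a => a b; rewrite /nrm normc_def /= -sqrtr_sqr.
by rewrite ler_wsqrtr // lerDr sqr_ge0.
Qed.

Lemma nrm_le (a : C) : nrm a <= `|complex.Re a| + `|complex.Im a|.
Proof.
rewrite {1}[a]complexE; apply: le_trans (nrmD _ _) _.
by rewrite nrmM !nrm_real /nrm normc_def /= expr0n expr1n add0r sqrtr1 mul1r.
Qed.

Lemma near_nrmP V (z : V) (P : V -> Prop) :
  (\forall x \near z, P x) <->
  exists2 d : R, 0 < d & forall x, nrm (x - z) < d -> P x.
Proof.
split=> [|[d d0 h]].
  move=> /nbhs_ballP[e /= e0 h].
  have eR : e = (complex.Re e)%:C%C by rewrite RRe_real // gtr0_real.
  exists (complex.Re e); first by rewrite -ltcR -eR.
  move=> x hx; apply: h; rewrite -ball_normE /= distrC nrmE eR ltcR //.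
apply/nbhs_ballP; exists (d%:C%C) => /=; first by rewrite ltcR.
by move=> x; rewrite -ball_normE /= distrC nrmE ltcR => /h.
Qed.

Lemma differentiable_nrmP V (f : V -> C) (z : V) :
  differentiable f z ->
  forall e : R, 0 < e -> exists2 d : R, 0 < d &
    forall h, nrm h < d -> nrm (f (z + h) - f z - 'd f z h) <= e * nrm h.
Proof.
move=> /diff_locallyP [_ hf] e e0.
have /eqaddoP/(_ (e%:C%C)) := hf; rewrite ltcR e0 => /(_ isT).
move=> /near_nrmP[d d0 h]; exists d => // k kd.
have := h k; rewrite subr0 => /(_ kd).
by rewrite /= !fctE /= !nrmE -rmorphM lecR [k + z]addrC opprD addrA.
Qed.

(** Boundedness of [L] is assumed because a linear map on [V], of possibly
    infinite dimension, need not be continuous. *)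
Lemma nrmP_differentiable V (f : V -> C) (z : V) (L : {linear V -> C}) (M : R) :
  (forall h, nrm (L h) <= M * nrm h) ->
  (forall e : R, 0 < e -> exists2 d : R, 0 < d &
    forall h, nrm h < d -> nrm (f (z + h) - f z - L h) <= e * nrm h) ->
  differentiable f z.
Proof.
move=> LM hf.
have Lc : continuous L.
  apply: bounded_linear_continuous; apply/linear_boundedP.
  exists M%:C%C; split; first by rewrite complex_real.
  move=> x Mx h; apply: (le_trans _ (ler_wpM2r (normr_ge0 _) (ltW Mx))).
  by rewrite !nrmE -rmorphM lecR.
have Lo : f \o shift z = cst (f z) + L +o_ (0 : V) id.
  apply/eqaddoP => e e0.
  have eR : e = (complex.Re e)%:C%C by rewrite RRe_real // gtr0_real.
  have e0' : 0 < complex.Re e by rewrite -ltcR -eR.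
  apply/near_nrmP; have [d d0 h] := hf _ e0'; exists d => // k; rewrite subr0 => /h.
  by rewrite /= !fctE /= !nrmE eR -rmorphM lecR [k + z]addrC opprD addrA.
apply/diff_locallyP; rewrite (diff_unique Lc Lo); split=> //.
Qed.

Lemma diff_mul V (f g : V -> C) (z : V) : differentiable f z ->
  differentiable g z -> differentiable (fun x => f x * g x) z.
Proof. by move=> df dg; exact: differentiableM. Qed.

Lemma diff_add V (f g : V -> C) (z : V) : differentiable f z ->
  differentiable g z -> differentiable (fun x => f x + g x) z.
Proof. by move=> df dg; exact: differentiableD. Qed.

Lemma diff_sub V (f g : V -> C) (z : V) : differentiable f z ->
  differentiable g z -> differentiable (fun x => f x - g x) z.
Proof. by move=> df dg; exact: differentiableB. Qed.

Lemma diff_inv V (f : V -> C) (z : V) : f z != 0 ->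
  differentiable f z -> differentiable (fun x => (f x)^-1) z.
Proof. by move=> fz df; exact: differentiableV. Qed.

Lemma diff_cst V (c : C) (z : V) : differentiable (fun=> c) z.
Proof. exact: differentiable_cst. Qed.

Lemma diff_id (z : C) : differentiable (fun x : C => x) z.
Proof. by []. Qed.

Lemma diff_exp V (f : V -> C) (z : V) k : differentiable f z ->
  differentiable (fun x => f x ^+ k) z.
Proof.
move=> df; elim: k => [|k IH].
  have -> : (fun x => f x ^+ 0) = (fun=> 1) by apply/funext => x; rewrite expr0.
  exact: diff_cst.
have -> : (fun x => f x ^+ k.+1) = (fun x => f x * f x ^+ k).
  by apply/funext => x; rewrite exprS.
exact: diff_mul.
Qed.

Lemma diff_cont V (f : V -> C) (z : V) :
  differentiable f z -> {for z, continuous f}.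
Proof. by move=> /differentiable_continuous. Qed.

Lemma nrm_continuousP V (f : V -> C) (z : V) :
  {for z, continuous f} <->
  forall e : R, 0 < e -> exists2 d : R, 0 < d &
    forall h, nrm h < d -> nrm (f (z + h) - f z) < e.
Proof.
split=> [cf e e0|h].
  have : \forall x \near z, nrm (f x - f z) < e.
    have /cf : nbhs (f z) [set y : C | nrm (y - f z) < e]; last by [].
    by apply/(near_nrmP (V := C)); exists e.
  move=> /near_nrmP[d d0 h]; exists d => // k kd.
  by apply: h; rewrite addrC addKr.
move=> A /(near_nrmP (f z) A)[e e0 eA].
have [d d0 hd] := h e e0; apply/(near_nrmP z (fun x => A (f x))); exists d => // x xz.
by apply: eA; have := hd _ xz; rewrite [z + _]addrC subrK.
Qed.

End Nrm.

(** * Curves in the complex plane *)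

Section Curves.
Variable R : realType.
Local Notation C := (complex_field R).
Local Notation Re := (@complex.Re R).
Local Notation Im := (@complex.Im R).

(** [v] is the velocity at time [t] of the curve [H] in the complex plane. *)
Definition rdiff (H : R -> C) (t : R) (v : C) : Prop :=
  forall e : R, 0 < e -> exists2 d : R, 0 < d &
    forall s : R, `|s| < d -> nrm (H (t + s) - H t - v * rc s) <= e * `|s|.

Definition rcont (h : R -> C) (t : R) : Prop :=
  forall e : R, 0 < e -> exists2 d : R, 0 < d &
    forall s : R, `|s| < d -> nrm (h (t + s) - h t) < e.

Lemma real_is_deriveP (g : R -> R) (t a : R) :
  (forall e : R, 0 < e -> exists2 d : R, 0 < d &
    forall s : R, `|s| < d -> `|g (t + s) - g t - a * s| <= e * `|s|) <->
  is_derive t 1 g a.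
Proof.
split=> [h|ga].
  have cv : (fun s => s^-1 *: ((g \o shift t) (s *: (1 : R)) - g t)) @ 0^' --> a.
    apply/cvgrPdist_le => /= e e0.
    have [d d0 hd] := h e e0.
    apply/nbhs_ballP; exists d => //= s; rewrite /ball /= sub0r normrN => sd s0.
    have sp : 0 < `|s| by rewrite normr_gt0.
    rewrite distrC -(ler_pM2r sp) -normrM.
    rewrite /GRing.scale /= mulr1 mulrBl mulrAC mulVf // mul1r [s + t]addrC.
    exact: hd.
  apply: DeriveDef; first by apply/cvg_ex; exists a.
  by apply: cvg_lim.
case: ga => /derivable_nbhsP dg gE.
move=> e e0; move: dg; rewrite gE => /eqaddoP/(_ e e0).
move=> /nbhs_ballP[d /= d0 hd]; exists d => // s sd.
have := hd s; rewrite /ball /= sub0r normrN => /(_ sd).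
rewrite /= !fctE /=; rewrite /GRing.scale /= mulr1 [s + t]addrC opprD addrA.
by rewrite [s * a]mulrC.
Qed.

Lemma rdiff_Re (c : C) (H : R -> C) (t : R) (v : C) :
  rdiff H t v -> is_derive t 1 (fun s => Re (c * H s)) (Re (c * v)).
Proof.
move=> h; apply/real_is_deriveP => e e0.
have e1 : 0 < e / (nrm c + 1) by rewrite divr_gt0 // ltr_wpDl ?nrm_ge0.
have [d d0 hd] := h _ e1; exists d => // s sd.
have -> : Re (c * H (t + s)) - Re (c * H t) - Re (c * v) * s =
    Re (c * (H (t + s) - H t - v * rc s)).
  by case: c {e1 h hd} v (H _) (H _) => c1 c2 [v1 v2] [a1 a2] [b1 b2] /=; ring.
apply: le_trans (nrm_Re _) _; rewrite nrmM.
apply: le_trans (ler_wpM2l (nrm_ge0 _) (hd s sd)) _.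
rewrite mulrA ler_wpM2r // mulrCA ger_pMr //.
by rewrite ler_pdivrMr ?mul1r ?lerDl // ltr_wpDl ?nrm_ge0.
Qed.

Lemma Re_rdiff (H : R -> C) (t : R) (v : C) :
  is_derive t 1 (Re \o H) (Re v) -> is_derive t 1 (Im \o H) (Im v) ->
  rdiff H t v.
Proof.
move=> /real_is_deriveP h1 /real_is_deriveP h2 e e0.
have e1 : 0 < e / 2 by rewrite divr_gt0.
have [d1 d10 hd1] := h1 _ e1; have [d2 d20 hd2] := h2 _ e1.
exists (Num.min d1 d2); first by rewrite lt_min d10.
move=> s; rewrite lt_min => /andP[s1 s2].
apply: le_trans (nrm_le _) _.
rewrite [e]splitr mulrDl lerD //.
  by move: (hd1 s s1) => /=; case: v {h1 h2 hd1 hd2} (H _) (H _) => [v1 v2] [a1 a2] [b1 b2] /=; rewrite mulr0 subr0.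
move: (hd2 s s2) => /=; case: v {h1 h2 hd1 hd2} (H _) (H _) => [v1 v2] [a1 a2] [b1 b2] /=.
by rewrite mulr0 add0r.
Qed.

(** The mean value inequality: the usual theorem is applied to the real part of
    [c * H], where [c] is the conjugate of [H b - H a]. *)
Lemma rdiff_mvt (H h : R -> C) (a b M : R) : a <= b ->
  (forall t, a <= t <= b -> rdiff H t (h t)) ->
  (forall t, a <= t <= b -> nrm (h t) <= M) ->
  nrm (H b - H a) <= M * (b - a).
Proof.
move=> ab Hh hM; set D := H b - H a.
have [D0|Dn0] := eqVneq (nrm D) 0.
  by rewrite D0 mulr_ge0 ?subr_ge0 // (le_trans (nrm_ge0 _) (hM a _)) ?lexx.
have Dp : 0 < nrm D by rewrite lt0r Dn0 nrm_ge0.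
pose c : C := (D^*)%C.
have nc : nrm c = nrm D by rewrite /nrm normcJ.
have dG t : a <= t <= b -> is_derive t 1 (fun s => Re (c * H s)) (Re (c * h t)).
  by move=> tab; apply: rdiff_Re; apply: Hh.
have [||x xab xE] := @MVT_segment R (fun s => Re (c * H s)) (fun t => Re (c * h t)) a b ab.
- by move=> x; rewrite in_itv /= => /andP[x1 x2]; apply: dG; rewrite !ltW.
- apply: derivable_within_continuous => x; rewrite in_itv /= => xab.
  by have := dG x xab; case.
have DE : Re (c * H b) - Re (c * H a) = nrm D ^+ 2.
  have -> : Re (c * H b) - Re (c * H a) = Re (c * D).
    by rewrite /D mulrBr raddfB.
  rewrite /c mulrC -sqr_normc [`|D|]nrmE -rmorphXn //.
rewrite DE in xE; rewrite -(ler_pM2l Dp) -expr2 xE mulrA ler_wpM2r ?subr_ge0 //.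
apply: le_trans (ler_norm _) _; apply: le_trans (nrm_Re _) _.
by rewrite nrmM nc ler_wpM2l ?nrm_ge0 // hM // -in_itv.
Qed.

Lemma rdiff_const (H : R -> C) (a b : R) : a <= b ->
  (forall t, a <= t <= b -> rdiff H t 0) -> H b = H a.
Proof.
move=> ab h; apply: subr0_eq; apply: nrm_le0.
have := @rdiff_mvt H (fun=> 0) a b 0 ab h; rewrite mul0r; apply => t _.
by rewrite nrm0.
Qed.

(** The integral starts at [a - 1] so that [a] and [b] are interior points. *)
Lemma real_antiderivative (g : R -> R) (a b : R) : continuous g ->
  exists G : R -> R, forall t, a <= t <= b -> is_derive t 1 G (g t).
Proof.
move=> cg.
exists (fun x => (\int[lebesgue_measure]_(t in [set` `[a - 1, x]]) (g t))%R).
move=> t /andP[ta tb].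
have itg : lebesgue_measure.-integrable `[a - 1, b + 1] (EFin \o g).
  apply: continuous_compact_integrable; first exact: segment_compact.
  exact: continuous_subspaceT.
have [|||h1 h2] := @continuous_FTC1_closed R g (a - 1) t (b + 1) _ itg.
- lra.
- lra.
- exact: cg.
apply: DeriveDef; first exact: h1.
by rewrite -derive1E.
Qed.

Lemma antiderivative (h : R -> C) (a b : R) : (forall t, rcont h t) ->
  exists H : R -> C, forall t, a <= t <= b -> rdiff H t (h t).
Proof.
move=> ch.
have c1 : continuous (Re \o h).
  move=> t; apply/cvgrPdist_lt => /= e e0; have [d d0 hd] := ch t e e0.
  apply/nbhs_ballP; exists d => //= s; rewrite /ball /= => ts.
  have := hd (s - t); rewrite distrC => /(_ ts); rewrite [t + _]addrC subrK.
  apply: le_lt_trans; apply: le_trans _ (nrm_Re _).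
  by rewrite distrC; case: (h s) (h t) => [? ?] [? ?] /=.
have c2 : continuous (Im \o h).
  move=> t; apply/cvgrPdist_lt => /= e e0; have [d d0 hd] := ch t e e0.
  apply/nbhs_ballP; exists d => //= s; rewrite /ball /= => ts.
  have := hd (s - t); rewrite distrC => /(_ ts); rewrite [t + _]addrC subrK.
  apply: le_lt_trans; apply: le_trans _ (nrm_Im _).
  by rewrite distrC; case: (h s) (h t) => [? ?] [? ?] /=.
have [G1 h1] := real_antiderivative a b c1.
have [G2 h2] := real_antiderivative a b c2.
exists (fun t => (G1 t +i* G2 t)%C) => t tab.
by apply: Re_rdiff; [exact: h1|exact: h2].
Qed.

End Curves.

(** * Integrals along segments *)

Section SegmentIntegral.
Variable R : realType.
Local Notation C := (complex_field R).
Local Notation Re := (@complex.Re R).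

(** Complex differentiability with an explicit remainder, which the estimates of
    integrals use directly. *)
Definition cder (f : C -> C) (z a : C) : Prop :=
  forall e : R, 0 < e -> exists2 d : R, 0 < d &
    forall h, nrm h < d -> nrm (f (z + h) - f z - a * h) <= e * nrm h.

Lemma differentiable_cder (f : C -> C) (z : C) :
  differentiable f z -> cder f z ('d f z 1).
Proof.
move=> df e e0; have [d d0 hd] := differentiable_nrmP df e0.
exists d => // h hhd; have := hd h hhd.
suff -> : 'd f z h = 'd f z 1 * h by [].
by rewrite -{1}[h]mulr1 -[h * 1]/(h *: (1 : C)) linearZ mulrC.
Qed.

Lemma cder_differentiable (f : C -> C) (z a : C) :
  cder f z a -> differentiable f z.
Proof.
move=> fa.
have La : linear (fun h : C => a * h) by move=> k u v; rewrite mulrDr /GRing.scale /= mulrCA.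
apply: (@nrmP_differentiable _ _ f z (linear_of La) (nrm a)).
  by move=> h; rewrite /= nrmM lexx.
exact: fa.
Qed.

Lemma rdiff_cont (H : R -> C) t v : rdiff H t v -> rcont H t.
Proof.
move=> h e e0; have [d d0 hd] := h 1 ltr01.
have p0 : 0 < 1 + nrm v + 1 by rewrite ltr_wpDl // addr_ge0 ?nrm_ge0.
exists (Num.min d (e / (1 + nrm v + 1))).
  by rewrite lt_min d0 divr_gt0.
move=> s; rewrite lt_min ltr_pdivlMr // => /andP[s1 s2].
have := hd s s1 => hs.
have -> : H (t + s) - H t = (H (t + s) - H t - v * rc s) + v * rc s by rewrite subrK.
apply: le_lt_trans (nrmD _ _) _; rewrite nrmM nrm_rc.
have := normr_ge0 s; nra.
Qed.

Lemma rdiffD H G t v w :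
  rdiff H t v -> rdiff G t w -> rdiff (fun s => H s + G s : C) t (v + w).
Proof.
move=> h g e e0; have e1 : 0 < e / 2 by rewrite divr_gt0.
have [d1 d10 hd1] := h _ e1; have [d2 d20 hd2] := g _ e1.
exists (Num.min d1 d2); first by rewrite lt_min d10.
move=> s; rewrite lt_min => /andP[/hd1 s1 /hd2 s2].
have -> : H (t + s) + G (t + s) - (H t + G t) - (v + w) * rc s =
  (H (t + s) - H t - v * rc s) + (G (t + s) - G t - w * rc s) by ring.
by apply: le_trans (nrmD _ _) _; rewrite [e]splitr mulrDl lerD.
Qed.

Lemma rdiff_comp F H t a v :
  cder F (H t) a -> rdiff H t v -> rdiff (F \o H) t (a * v).
Proof.
move=> hF hH e e0.
have va : 0 < nrm v + 1 by rewrite ltr_wpDl ?nrm_ge0.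
have aa : 0 < nrm a + 1 by rewrite ltr_wpDl ?nrm_ge0.
have [d1 d10 hd1] := hF _ (divr_gt0 (divr_gt0 e0 va) (ltr0n _ 2)).
have [d2 d20 hd2] := hH _ (divr_gt0 (divr_gt0 e0 aa) (ltr0n _ 2)).
have [d3 d30 hd3] := hH _ ltr01.
have [d4 d40 hd4] := rdiff_cont hH d10.
exists (Num.min (Num.min d2 d3) d4); first by rewrite !lt_min d20 d30.
move=> s; rewrite !lt_min => /andP[/andP[/hd2 s2 /hd3 s3] /hd4 s4].
set k := H (t + s) - H t in s2 s3 s4.
have Ek : H (t + s) = H t + k by rewrite /k [RHS]addrC addrNK.
have nk : nrm k <= (nrm v + 1) * `|s|.
  have -> : k = (k - v * rc s) + v * rc s by rewrite addrNK.
  by apply: le_trans (nrmD _ _) _; rewrite nrmM nrm_rc mulrDl addrC lerD2l.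
have -> : (F \o H) (t + s) - (F \o H) t - a * v * rc s =
   (F (H t + k) - F (H t) - a * k) + a * (k - v * rc s).
  by rewrite /= Ek; ring.
apply: le_trans (nrmD _ _) _; rewrite nrmM.
rewrite [e]splitr mulrDl; apply: lerD.
  apply: le_trans (hd1 _ s4) _.
  apply: le_trans (ler_wpM2l _ nk) _; first by rewrite ltW // !divr_gt0.
  have -> : e / (nrm v + 1) / 2 * ((nrm v + 1) * `|s|) = e / 2 * `|s|.
    by field; rewrite lt0r_neq0.
  by [].
apply: le_trans (ler_wpM2l (nrm_ge0 _) s2) _.
rewrite mulrA ler_wpM2r // mulrA ler_wpM2r ?invr_ge0 //.
by rewrite mulrA ler_pdivrMr // mulrC ler_wpM2l ?ltW // ltrDl.
Qed.

Lemma cder_lin (a b z : C) : cder (fun x => a * x + b) z a.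
Proof.
move=> e e0; exists 1 => // h _.
have -> : a * (z + h) + b - (a * z + b) - a * h = 0 by ring.
by rewrite nrm0 mulr_ge0 ?nrm_ge0 // ltW.
Qed.

Lemma rdiffZ H t v (c : C) : rdiff H t v -> rdiff (fun s => c * H s) t (c * v).
Proof.
have -> : (fun s => c * H s) = (fun x => c * x + 0) \o H.
  by apply/funext => s /=; rewrite addr0.
move=> h; apply: rdiff_comp h; exact: cder_lin.
Qed.

Lemma rdiff_comp_affine H (t u s : R) v :
  rdiff H (u + s * t) v -> rdiff (fun t => H (u + s * t)) t (rc s * v).
Proof.
move=> h e e0.
have s1 : 0 < `|s| + 1 by rewrite ltr_wpDl.
have [d d0 hd] := h _ (divr_gt0 e0 s1).
exists (d / (`|s| + 1)); first by rewrite divr_gt0.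
move=> x; rewrite ltr_pdivlMr // => xd.
have sx : `|s * x| < d.
  by apply: le_lt_trans xd; rewrite normrM mulrC ler_wpM2l // lerDl.
have := hd _ sx.
rewrite mulrDr addrA rcM /= mulrA [v * _]mulrC.
move=> h1; apply: le_trans h1 _.
rewrite normrM mulrA ler_wpM2r // mulrAC ler_pdivrMr //.
by apply: ler_wpM2l; [exact: ltW|rewrite lerDl].
Qed.

Lemma rdiff_line (a b : C) t : rdiff (fun s => a + rc s * b) t b.
Proof.
move=> e e0; exists 1 => // s _.
have -> : a + rc (t + s) * b - (a + rc t * b) - b * rc s = 0.
  by rewrite rcD /=; ring.
by rewrite nrm0 mulr_ge0 // ltW.
Qed.

Definition pt (a b : C) (t : R) : C := a + rc t * (b - a).

Definition seg (f : C -> C) (a b : C) (t : R) : C := f (pt a b t) * (b - a).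

(** The integral of [f] along the segment from [a] to [b], defined as the
    increment of an antiderivative of the pulled back form [seg f a b]: all
    estimates then follow from the mean value inequality. *)
Definition is_segint (f : C -> C) (a b j : C) : Prop :=
  exists2 H : R -> C, forall t, 0 <= t <= 1 -> rdiff H t (seg f a b t) &
    j = H 1 - H 0.

Definition segint (f : C -> C) (a b : C) : C := xget 0 [set j | is_segint f a b j].

(** If [f] is uniformly close to a function [g] with a primitive [G], its
    integral is close to the increment of [G].  This is the form in which
    differentiability enters the proofs below. *)
Lemma segint_approx_is (f g G : C -> C) (a b j : C) (M : R) : is_segint f a b j ->
  (forall t, 0 <= t <= 1 -> cder G (pt a b t) (g (pt a b t))) ->
  (forall t, 0 <= t <= 1 -> nrm (f (pt a b t) - g (pt a b t)) <= M) ->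
  nrm (j - (G b - G a)) <= M * nrm (b - a).
Proof.
move=> [H hH ->] hG hM.
have := @rdiff_mvt _ (fun t => H t + -1 * G (pt a b t))
  (fun t => (f (pt a b t) - g (pt a b t)) * (b - a)) 0 1 (M * nrm (b - a)) ler01.
rewrite subr0 mulr1 /pt mul0r addr0 mul1r [a + _]addrC subrK.
have -> : H 1 + -1 * G b - (H 0 + -1 * G a) = H 1 - H 0 - (G b - G a) by ring.
apply=> t t01.
  have -> : (f (a + rc t * (b - a)) - g (a + rc t * (b - a))) * (b - a) =
    seg f a b t + -1 * (g (pt a b t) * (b - a)) by rewrite /seg /pt; ring.
  apply: rdiffD; first exact: hH.
  apply: rdiffZ; apply: (rdiff_comp (H := pt a b)); first exact: hG.
  exact: rdiff_line.
by rewrite nrmM ler_wpM2r ?nrm_ge0 //; exact: hM.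
Qed.

Lemma is_segint_uniq (f : C -> C) (a b j j' : C) : is_segint f a b j -> is_segint f a b j' -> j = j'.
Proof.
move=> [H hH ->] [G hG ->].
have := @rdiff_const _ (fun t => H t + -1 * G t) 0 1 ler01.
move=> h; have {}h : H 1 + -1 * G 1 = H 0 + -1 * G 0.
  apply: h => t t01.
  have -> : (0 : C) = seg f a b t + -1 * seg f a b t by ring.
  by apply: rdiffD; [exact: hH|apply: rdiffZ; exact: hG].
apply: subr0_eq.
have -> : H 1 - H 0 - (G 1 - G 0) = (H 1 + -1 * G 1) - (H 0 + -1 * G 0) by ring.
by rewrite h subrr.
Qed.

Lemma segint_uniq (f : C -> C) (a b j : C) : is_segint f a b j -> segint f a b = j.
Proof.
by move=> h; apply: (is_segint_uniq _ h); exact: (@xgetI _ 0 _ j).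
Qed.

Section Convex.
Variables (S : set C) (f : C -> C).
Hypothesis convS : forall a b t, S a -> S b -> 0 <= t <= 1 -> S (pt a b t).
Hypothesis contf : forall z, S z -> {for z, continuous f}.

(** The parameter is retracted to [0, 1], which makes the integrand continuous on
    the whole line. *)
Let clamp (t : R) : R := Num.max 0 (Num.min 1 t).

Let clamp01 t : 0 <= clamp t <= 1.
Proof. by rewrite /clamp le_max lexx ge_max ler01 ge_min lexx. Qed.

Let clamp_id t : 0 <= t <= 1 -> clamp t = t.
Proof. by move=> /andP[t0 t1]; rewrite /clamp min_r // max_r. Qed.

Let clamp_lip t s : `|clamp (t + s) - clamp t| <= `|s|.
Proof.
rewrite /clamp !maxEle !minEle.
by case: (lerP 0 s) => s0; rewrite ?(ger0_norm s0) ?(ltr0_norm s0);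
  repeat case: ifP => //; intros; rewrite ler_norml; apply/andP; split; lra.
Qed.

Lemma segint_ex a b : S a -> S b -> is_segint f a b (segint f a b).
Proof.
move=> Sa Sb.
have ch t : rcont (fun s => seg f a b (clamp s)) t.
  move=> e e0.
  have ab1 : 0 < nrm (b - a) + 1 by rewrite ltr_wpDl ?nrm_ge0.
  have /nrm_continuousP/(_ _ (divr_gt0 e0 ab1))[d d0 hd] :=
    contf (convS Sa Sb (clamp01 t)).
  exists (d / (nrm (b - a) + 1)); first by rewrite divr_gt0.
  move=> s; rewrite ltr_pdivlMr // => sd.
  rewrite /seg -mulrBl nrmM.
  have -> : pt a b (clamp (t + s)) = pt a b (clamp t) +
      rc (clamp (t + s) - clamp t) * (b - a).
    by rewrite /pt rcD rcN; ring.
  have /hd : nrm (rc (clamp (t + s) - clamp t) * (b - a) : C) < d.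
    apply: le_lt_trans sd; rewrite nrmM nrm_rc.
    by apply: ler_pM; rewrite ?nrm_ge0 ?clamp_lip // lerDl.
  rewrite ltr_pdivlMr // => h; apply: le_lt_trans h.
  by rewrite ler_wpM2l ?nrm_ge0 // lerDl.
have [H hH] := antiderivative 0 1 ch.
have h : is_segint f a b (H 1 - H 0).
  by exists H => // t t01; have := hH t t01; rewrite clamp_id.
by rewrite (segint_uniq h).
Qed.

Lemma segint_rev a b : S a -> S b -> segint f b a = - segint f a b.
Proof.
move=> Sa Sb; have [H hH ->] := segint_ex Sa Sb; apply: segint_uniq.
exists (fun t => H (1 + -1 * t)) => [t t01|].
  have -> : seg f b a t = rc (-1) * seg f a b (1 + -1 * t).
    have e1 : rc (1 + -1 * t) = 1 - rc t :> C by rewrite mulN1r rcD rcN rc1.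
    have e2 : rc (-1) = -1 :> C by rewrite rcN rc1.
    rewrite /seg /pt e1 e2.
    have -> : a + (1 - rc t) * (b - a) = b + rc t * (a - b) by ring.
    by ring.
  apply: rdiff_comp_affine; apply: hH; lra.
by rewrite mulr1 mulr0 addr0 subrr opprB.
Qed.

Lemma segint_split a b s : S a -> S b -> 0 <= s <= 1 ->
  segint f a (pt a b s) + segint f (pt a b s) b = segint f a b.
Proof.
move=> Sa Sb s01; have [H hH ->] := segint_ex Sa Sb.
have -> : segint f a (pt a b s) = H s - H 0.
  apply: segint_uniq; exists (fun t => H (0 + s * t)) => [t t01|].
    have -> : seg f a (pt a b s) t = rc s * seg f a b (0 + s * t).
      rewrite /seg /pt add0r rcM /=.
      have -> : a + rc t * (a + rc s * (b - a) - a) =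
        a + rc s * rc t * (b - a) by ring.
      by ring.
    by apply: rdiff_comp_affine; apply: hH; nra.
  by rewrite mulr1 mulr0 !add0r.
have -> : segint f (pt a b s) b = H 1 - H s.
  apply: segint_uniq; exists (fun t => H (s + (1 - s) * t)) => [t t01|].
    have -> : seg f (pt a b s) b t = rc (1 - s) * seg f a b (s + (1 - s) * t).
      have e1 : rc (1 - s) = 1 - rc s :> C by rewrite rcD rcN rc1.
      rewrite /seg /pt e1 rcD rcM e1 /=.
      have -> : a + rc s * (b - a) + rc t * (b - (a + rc s * (b - a))) =
        a + (rc s + (1 - rc s) * rc t) * (b - a) by ring.
      by ring.
    by apply: rdiff_comp_affine; apply: hH; nra.
  by rewrite mulr1 mulr0 addr0 [s + _]addrC subrK.
by ring.
Qed.

Lemma segint_approx (g G : C -> C) (a b : C) (M : R) : S a -> S b ->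
  (forall t, 0 <= t <= 1 -> cder G (pt a b t) (g (pt a b t))) ->
  (forall t, 0 <= t <= 1 -> nrm (f (pt a b t) - g (pt a b t)) <= M) ->
  nrm (segint f a b - (G b - G a)) <= M * nrm (b - a).
Proof. by move=> Sa Sb; apply: segint_approx_is; exact: segint_ex. Qed.

Lemma segint_bound (a b : C) (M : R) : S a -> S b ->
  (forall t, 0 <= t <= 1 -> nrm (f (pt a b t)) <= M) ->
  nrm (segint f a b) <= M * nrm (b - a).
Proof.
move=> Sa Sb h; have := @segint_approx (fun=> 0) (fun=> 0) a b M Sa Sb.
rewrite subrr subr0; apply=> t t01; last by rewrite subr0 h.
have -> : (fun=> 0) = (fun x : C => 0 * x + 0).
  by apply/funext => x; rewrite mul0r addr0.
exact: cder_lin.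
Qed.

End Convex.
End SegmentIntegral.

(** * Goursat's theorem *)

Section Goursat.
Variable R : realType.
Local Notation C := (complex_field R).
Local Notation Re := (@complex.Re R).
Local Notation Im := (@complex.Im R).

(** [u n - 2 L / 2 ^ n] increases and [u n + 2 L / 2 ^ n] decreases; the limit is
    the supremum of the former. *)
Lemma real_halving_limit (u : nat -> R) (L : R) :
  (forall n, `|u n.+1 - u n| <= L / 2 ^+ n) ->
  exists p, forall n, `|p - u n| <= 2 * L / 2 ^+ n.
Proof.
move=> hu; have L0 : 0 <= L by have := hu 0%N; rewrite expr0 divr1; apply: le_trans.
pose v n := u n - 2 * L / 2 ^+ n; pose w n := u n + 2 * L / 2 ^+ n.
have half n : 2 * L / 2 ^+ n.+1 = L / 2 ^+ n :> R.
  by rewrite exprS; field; rewrite expf_neq0.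
have dbl n : 2 * L / 2 ^+ n = L / 2 ^+ n + L / 2 ^+ n :> R by ring.
have pos n : 0 <= L / 2 ^+ n :> R by rewrite divr_ge0 ?exprn_ge0.
have vS n : v n <= v n.+1.
  rewrite /v half dbl; have := hu n; rewrite ler_norml => /andP[h1 h2]; lra.
have wS n : w n.+1 <= w n.
  rewrite /w half dbl; have := hu n; rewrite ler_norml => /andP[h1 h2]; lra.
have vm n k : v n <= v (n + k)%N.
  by elim: k => [|k IH]; rewrite ?addn0 // addnS (le_trans IH).
have wm n k : w (n + k)%N <= w n.
  by elim: k => [|k IH]; rewrite ?addn0 // addnS (le_trans _ IH).
have vw n m : v n <= w m.
  apply: le_trans (vm n m) _; apply: le_trans (wm m n).
  by rewrite addnC /v /w; have := pos (m + n)%N; rewrite dbl; lra.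
have hs : has_sup (range v).
  by split; [exists (v 0%N), 0%N|exists (w 0%N) => _ [n _ <-]; exact: vw].
exists (sup (range v)) => n.
have h1 : v n <= sup (range v) by apply: sup_upper_bound => //; exists n.
have h2 : sup (range v) <= w n.
  by apply: ge_sup; [case: hs|move=> _ [m _ <-]; exact: vw].
by move: h1 h2; rewrite /v /w ler_norml => h1 h2; apply/andP; split; lra.
Qed.

Lemma halving_limit (u : nat -> C) (L : R) :
  (forall n, nrm (u n.+1 - u n) <= L / 2 ^+ n) ->
  exists p, forall n, nrm (p - u n) <= 4 * L / 2 ^+ n.
Proof.
move=> hu.
have [|p hp] := @real_halving_limit (fun n => Re (u n)) L.
  by move=> n; apply: le_trans (hu n); rewrite -raddfB nrm_Re.
have [|q hq] := @real_halving_limit (fun n => Im (u n)) L.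
  by move=> n; apply: le_trans (hu n); rewrite -raddfB nrm_Im.
exists (p +i* q)%C => n; apply: le_trans (nrm_le _) _.
have := lerD (hp n) (hq n).
have -> : 2 * L / 2 ^+ n + 2 * L / 2 ^+ n = 4 * L / 2 ^+ n :> R by ring.
by case: (u n).
Qed.

Lemma cder_quad (a b z : C) : cder (fun x => a * x + b * x ^+ 2) z (a + 2 * b * z).
Proof.
move=> e e0.
have b1 : 0 < nrm b + 1 by rewrite ltr_wpDl ?nrm_ge0.
exists (e / (nrm b + 1)); first by rewrite divr_gt0.
move=> h; rewrite ltr_pdivlMr // => hd.
have -> : a * (z + h) + b * (z + h) ^+ 2 - (a * z + b * z ^+ 2) - (a + 2 * b * z) * h
  = b * h * h by ring.
rewrite !nrmM; apply: ler_wpM2r; first exact: nrm_ge0.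
apply: le_trans (ltW hd); rewrite mulrC ler_wpM2l ?nrm_ge0 //.
by rewrite lerDl.
Qed.

Definition convex_set (S : set C) :=
  forall a b t, S a -> S b -> 0 <= t <= 1 -> S (pt a b t).

Lemma convex_cball (r : R) : convex_set [set z | nrm z <= r].
Proof.
move=> a b t /= ar br /andP[t0 t1].
have -> : pt a b t = rc (1 - t) * a + rc t * b.
  by rewrite /pt rcD rcN rc1; ring.
apply: le_trans (nrmD _ _) _; rewrite !nrmM !nrm_rc.
rewrite (ger0_norm t0) ger0_norm ?subr_ge0 //.
have := nrm_ge0 a; have := nrm_ge0 b; nra.
Qed.

Lemma convex_ball (r : R) : convex_set [set z | nrm z < r].
Proof.
move=> a b t /= ar br t01.
have : nrm (pt a b t) <= Num.max (nrm a) (nrm b).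
  by apply: convex_cball t01; rewrite /= le_max lexx ?orbT.
by move/le_lt_trans; apply; rewrite gt_max ar.
Qed.

Lemma nrm_pt (a b : C) t : 0 <= t <= 1 -> nrm (pt a b t - a) <= nrm (b - a).
Proof.
move=> /andP[t0 t1]; rewrite /pt [a + _]addrC addrK nrmM nrm_rc ger0_norm //.
by rewrite ler_piMl // nrm_ge0.
Qed.

Lemma four_quarters (u v w x y : R) : u <= v + w + x + y ->
  4 * v < u -> 4 * w < u -> 4 * x < u -> 4 * y < u -> False.
Proof. lra. Qed.

Section Triangle.
Variables (S : set C) (f : C -> C).
Hypothesis convS : convex_set S.
Hypothesis closS : forall p, (forall e : R, 0 < e -> exists2 a, S a & nrm (p - a) < e) -> S p.
Hypothesis diffS : forall z, S z -> differentiable f z.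

Let contS z : S z -> {for z, continuous f}.
Proof. by move=> /diffS/differentiable_continuous. Qed.

Let tri (x : C * C * C) := segint f x.1.1 x.1.2 + segint f x.1.2 x.2 + segint f x.2 x.1.1.
Let per (x : C * C * C) := nrm (x.1.2 - x.1.1) + nrm (x.2 - x.1.2) + nrm (x.1.1 - x.2).
Let inS (x : C * C * C) := [/\ S x.1.1, S x.1.2 & S x.2].

Let mid (a b : C) := pt a b (1 / 2).

Let midE a b : mid a b = (a + b) / 2.
Proof.
rewrite /mid /pt; have -> : rc (1 / 2) = 2^-1 :> C.
  by rewrite div1r rcV; congr (_^-1); rewrite -[2]/(1 + 1) rcD rc1.
by field.
Qed.

Let nrm_half (a : C) : nrm (a / 2) = nrm a / 2.
Proof.
rewrite nrmM nrmV; congr (_ / _).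
have -> : 2 = rc 2 :> C by rewrite -[2 in RHS]/(1 + 1) rcD rc1.
by rewrite nrm_rc ger0_norm.
Qed.

Let half01 : 0 <= (1 / 2 : R) <= 1.
Proof. apply/andP; split; lra. Qed.

(** The midpoints of the sides cut a triangle into four triangles of half its
    perimeter, and one of the four carries at least a quarter of the integral.
    The vertex [y.1.1] followed through the subdivision moves by at most the
    perimeter. *)
Lemma triangle_step x : exists y, inS x ->
  [/\ inS y, nrm (tri x) <= 4 * nrm (tri y), per y = per x / 2 &
      nrm (y.1.1 - x.1.1) <= per x].
Proof.
have [nS|iS] := pselect (~ inS x); first by exists x.
have {iS}[Sa Sb Sc] : inS x by apply: contrapT.
case: x Sa Sb Sc => [[a b] c] /= Sa Sb Sc.
have Sm : forall u v, S u -> S v -> S (mid u v) by move=> u v Su Sv; apply: convS.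
set m1 := mid a b; set m2 := mid b c; set m3 := mid c a.
have S1 : S m1 by exact: Sm.
have S2 : S m2 by exact: Sm.
have S3 : S m3 by exact: Sm.
have e1 := segint_split convS contS Sa Sb half01.
have e2 := segint_split convS contS Sb Sc half01.
have e3 := segint_split convS contS Sc Sa half01.
rewrite -/(mid a b) -/m1 in e1; rewrite -/(mid b c) -/m2 in e2; rewrite -/(mid c a) -/m3 in e3.
have r12 := segint_rev convS contS S1 S2.
have r23 := segint_rev convS contS S2 S3.
have r31 := segint_rev convS contS S3 S1.
have sum : tri (a, b, c) = tri (a, m1, m3) + tri (m1, b, m2) + tri (m3, m2, c) + tri (m1, m2, m3).
  rewrite /tri /= -e1 -e2 -e3 r12 r23 r31; ring.
have d1 : m1 - a = (b - a) / 2 by rewrite /m1 midE; field.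
have d1' : b - m1 = (b - a) / 2 by rewrite /m1 midE; field.
have d2 : m2 - b = (c - b) / 2 by rewrite /m2 midE; field.
have d2' : c - m2 = (c - b) / 2 by rewrite /m2 midE; field.
have d3 : m3 - c = (a - c) / 2 by rewrite /m3 midE; field.
have d3' : a - m3 = (a - c) / 2 by rewrite /m3 midE; field.
have d12 : m2 - m1 = - ((a - c) / 2) by rewrite /m1 /m2 !midE; field.
have d23 : m3 - m2 = - ((b - a) / 2) by rewrite /m3 /m2 !midE; field.
have d31 : m1 - m3 = - ((c - b) / 2) by rewrite /m3 /m1 !midE; field.
have p1 : per (a, m1, m3) = per (a, b, c) / 2.
  by rewrite /per /= d1 -[m3 - m1]opprB d31 d3' opprK !nrm_half; ring.
have p2 : per (m1, b, m2) = per (a, b, c) / 2.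
  by rewrite /per /= d1' d2 -[m1 - m2]opprB d12 opprK !nrm_half; ring.
have p3 : per (m3, m2, c) = per (a, b, c) / 2.
  by rewrite /per /= -[m2 - m3]opprB d23 d2' d3 opprK !nrm_half; ring.
have p4 : per (m1, m2, m3) = per (a, b, c) / 2.
  by rewrite /per /= d12 d23 d31 !nrmN !nrm_half; ring.
have le4 : nrm (tri (a, b, c)) <= nrm (tri (a, m1, m3)) + nrm (tri (m1, b, m2))
   + nrm (tri (m3, m2, c)) + nrm (tri (m1, m2, m3)).
  rewrite sum; apply: le_trans (nrmD _ _) _; rewrite lerD2r.
  by apply: le_trans (nrmD _ _) _; rewrite lerD2r; exact: nrmD.
have na := nrm_ge0 (b - a); have nb := nrm_ge0 (c - b); have nc := nrm_ge0 (a - c).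
have h1 : nrm (m1 - a) <= per (a, b, c) by rewrite d1 nrm_half /per /=; lra.
have h3 : nrm (m3 - a) <= per (a, b, c).
  by rewrite nrmC d3' nrm_half /per /=; lra.
have h0 : nrm (a - a) <= per (a, b, c) by rewrite subrr nrm0 /per /=; lra.
have [k1|k1] := lerP (nrm (tri (a, b, c))) (4 * nrm (tri (a, m1, m3))).
  by exists (a, m1, m3).
have [k2|k2] := lerP (nrm (tri (a, b, c))) (4 * nrm (tri (m1, b, m2))).
  by exists (m1, b, m2).
have [k3|k3] := lerP (nrm (tri (a, b, c))) (4 * nrm (tri (m3, m2, c))).
  by exists (m3, m2, c).
have [k4|k4] := lerP (nrm (tri (a, b, c))) (4 * nrm (tri (m1, m2, m3))).
  by exists (m1, m2, m3).
by case: (four_quarters le4 k1 k2 k3 k4).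
Qed.

(** The triangles obtained by repeated subdivision shrink to a point [p] of [S].
    There [f] is affine up to [o(|z - p|)], affine functions have primitives,
    and the remaining error is small against the square of the perimeter, which
    decreases at the same rate [4 ^ n] as the bound on the integral. *)
Lemma goursat a b c : S a -> S b -> S c -> segint f a b + segint f b c + segint f c a = 0.
Proof.
move=> Sa Sb Sc; have [step hstep] := choice triangle_step.
pose x n := iter n step (a, b, c).
have xS n : inS (x n).
  by elim: n => [//|n IH]; rewrite /x iterS; have [] := hstep _ IH.
set L := per (a, b, c).
have xper n : per (x n) = L / 2 ^+ n.
  elim: n => [|n IH]; first by rewrite expr0 divr1.
  have [_ _ h _] := hstep _ (xS n); rewrite /x iterS h -/(x n) IH.
  by rewrite exprSr invfM mulrA.
have xT n : nrm (tri (a, b, c)) <= 4 ^+ n * nrm (tri (x n)).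
  elim: n => [|n IH]; first by rewrite expr0 mul1r.
  have [_ h _ _] := hstep _ (xS n); rewrite /x iterS -/(x n).
  apply: le_trans IH _; rewrite exprSr -mulrA ler_wpM2l ?exprn_ge0 //.
have [|p hp] := @halving_limit (fun n => (x n).1.1) L.
  by move=> n; rewrite -xper; have [_ _ _] := hstep _ (xS n).
have L0 : 0 <= L by rewrite /L /per !addr_ge0 ?nrm_ge0.
have small (d : R) : 0 < d -> exists n, 5 * L / 2 ^+ n < d.
  move=> d0; have k0 : 0 <= 5 * L / d by rewrite divr_ge0 ?mulr_ge0 // ltW.
  exists (Num.bound (5 * L / d)); have := archi_boundP k0.
  set n := Num.bound _ => hn; rewrite ltr_pdivrMr ?exprn_gt0 // [d * _]mulrC -ltr_pdivrMr //.
  by apply: lt_trans hn _; rewrite -natrX ltr_nat ltn_expl.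
have Sp : S p.
  apply: closS => e e0; have [n hn] := small e e0.
  exists (x n).1.1; first by have [] := xS n.
  apply: le_lt_trans (hp n) _; apply: le_lt_trans hn.
  by rewrite ler_wpM2r ?invr_ge0 ?exprn_ge0 // ler_wpM2r // ler_nat.
have fp := differentiable_cder (diffS Sp); set a' := 'd f p 1 in fp.
apply: nrm_le0.
rewrite -[segint f a b + _ + _]/(tri (a, b, c)).
apply/ler_addgt0Pr => e e0; rewrite add0r.
have L1 : 0 < 5 * L ^+ 2 + 1 by rewrite ltr_wpDl // mulr_ge0 ?exprn_ge0.
have e1 : 0 < e / (5 * L ^+ 2 + 1) by rewrite divr_gt0.
have [d d0 hd] := fp _ e1.
have [n hn] := small d d0.
set m := 5 * L / 2 ^+ n in hn.
(* the affine approximation of f at p, with its primitive *)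
pose g z := f p + a' * (z - p).
pose G z := (f p - a' * p) * z + a' / 2 * z ^+ 2.
have gG z : cder G z (g z).
  have -> : g z = (f p - a' * p) + 2 * (a' / 2) * z by rewrite /g; field.
  exact: cder_quad.
have side u v : S u -> S v -> nrm (u - p) + nrm (v - u) <= m ->
    nrm (segint f u v - (G v - G u)) <= e / (5 * L ^+ 2 + 1) * m * nrm (v - u).
  move=> Su Sv uv; apply: (segint_approx convS contS (g := g)) => // t t01.
  have near_p : nrm (pt u v t - p) <= m.
    apply: (le_trans _ uv); apply: (le_trans (nrm_tri (pt u v t) u p)).
    by rewrite addrC lerD2l nrm_pt.
  move: near_p; set q := pt u v t => near_p.
  have := hd (q - p) (le_lt_trans near_p hn); rewrite [p + _]addrC subrK => h.
  have -> : f q - g q = f q - f p - a' * (q - p) by rewrite /g; ring.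
  by apply: le_trans h _; rewrite ler_wpM2l // ltW.
have [Xa Xb Xc] := xS n.
move: (xT n) (hp n) (xper n) Xa Xb Xc; rewrite /per /tri.
case: (x n) => [[a1 b1] c1] /= xTn hpn xpn Xa Xb Xc.
have na := nrm_ge0 (b1 - a1); have nb := nrm_ge0 (c1 - b1); have nc := nrm_ge0 (a1 - c1).
rewrite nrmC in hpn.
have mE : m = 4 * L / 2 ^+ n + L / 2 ^+ n by rewrite /m; ring.
have bp : nrm (b1 - p) <= nrm (a1 - p) + nrm (b1 - a1).
  by rewrite [leRHS]addrC; exact: (nrm_tri b1 a1 p).
have cp : nrm (c1 - p) <= nrm (b1 - p) + nrm (c1 - b1).
  by rewrite [leRHS]addrC; exact: (nrm_tri c1 b1 p).
have s1 := side _ _ Xa Xb; have s2 := side _ _ Xb Xc; have s3 := side _ _ Xc Xa.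
have {}s1 := s1 ltac:(lra); have {}s2 := s2 ltac:(lra); have {}s3 := s3 ltac:(lra).
have T1 : nrm (segint f a1 b1 + segint f b1 c1 + segint f c1 a1) <= e / (5 * L ^+ 2 + 1) * m * (L / 2 ^+ n).
  have -> : segint f a1 b1 + segint f b1 c1 + segint f c1 a1 = (segint f a1 b1 - (G b1 - G a1)) +
    (segint f b1 c1 - (G c1 - G b1)) + (segint f c1 a1 - (G a1 - G c1)) by ring.
  apply: le_trans (nrmD _ _) _; rewrite -xpn !mulrDr lerD //.
  by apply: le_trans (nrmD _ _) _; rewrite lerD.
apply: le_trans xTn _.
apply: le_trans (ler_wpM2l _ T1) _; first by rewrite exprn_ge0.
have -> : 4 ^+ n * (e / (5 * L ^+ 2 + 1) * m * (L / 2 ^+ n)) =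
   e * (5 * L ^+ 2 / (5 * L ^+ 2 + 1)).
  have -> : 4 = 2 * 2 :> R by ring.
  rewrite /m exprMn; field.
  by rewrite expf_neq0 // lt0r_neq0.
by rewrite ger_pMr // ler_pdivrMr // mul1r lerDl.
Qed.

End Triangle.
End Goursat.

(** * Primitives on a disc *)

Section Primitive.
Variable R : realType.
Local Notation C := (complex_field R).
Local Notation Re := (@complex.Re R).
Local Notation Im := (@complex.Im R).

Lemma ReD (a b : C) : Re (a + b) = Re a + Re b. Proof. exact: raddfD. Qed.
Lemma Re_rcM (t : R) (a : C) : Re (rc t * a) = t * Re a.
Proof. by case: a => x y /=; rewrite mul0r subr0. Qed.

(** A vector that differs little from [u] lies in the half plane of [u]. *)
Lemma Re_conjM (u v : C) : nrm u ^+ 2 - nrm u * nrm v <= Re ((u^*)%C * (u + v)).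
Proof.
rewrite mulrDr ReD; apply: lerD.
  case: u => a b; rewrite /nrm normc_def /= sqr_sqrtr ?addr_ge0 ?sqr_ge0 //.
  by have -> : a * a - - b * b = a ^+ 2 + b ^+ 2 by ring.
have := nrm_Re ((u^*)%C * v); rewrite nrmM.
have -> : nrm ((u^*)%C : C) = nrm u by rewrite /nrm normcJ.
by rewrite ler_norml => /andP[].
Qed.

Lemma le_small (x K e0 : R) : 0 < e0 ->
  (forall e, 0 < e < e0 -> x <= e * K) -> x <= 0.
Proof.
move=> e00 h; case: (lerP K 0) => K0.
  have e1 : 0 < e0 / 2 < e0 by apply/andP; split; lra.
  have := h _ e1; have : e0 / 2 * K <= 0 by rewrite mulr_ge0_le0 //; lra.
  lra.
apply/ler_addgt0Pr => d d0; rewrite add0r.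
pose e := Num.min (e0 / 2) (d / K).
have e1 : 0 < e < e0.
  by rewrite lt_min divr_gt0 // divr_gt0 //= gt_min ltr_pdivrMr // ltr_pMr // ltr1n.
apply: le_trans (h _ e1) _; rewrite -ler_pdivlMr // ge_min lexx orbT //.
Qed.

(** [f] is holomorphic on the disc except perhaps at [w], where it is only
    continuous.  This is what difference quotients at [w] satisfy. *)
Section OnBall.
Variables (rho : R) (w : C) (f : C -> C).
Let B : set C := [set z | nrm z < rho].
Hypothesis Bw : B w.
Hypothesis cf : forall z, B z -> {for z, continuous f}.
Hypothesis df : forall z, B z -> z != w -> differentiable f z.

Let convB : convex_set B := @convex_ball R rho.

(** The triangle [w, z, z'] may have its vertex at the exceptional point.  It is
    cut at the points [p], [p'] at a small ratio [e] from [w].  The quadrilateral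
    [p, z, z', p'] lies in the half plane [S], which avoids [w], and is handled
    by Goursat's theorem; the small triangle [w, p, p'] contributes [O(e)]. *)
Lemma primitive_add z z' : B z -> B z' -> 0 < Re (((z - w)^*)%C * (z' - w)) ->
  z != w -> segint f w z + segint f z z' = segint f w z'.
Proof.
move=> Bz Bz' pos zw.
set c : C := ((z - w)^*)%C in pos.
have posz : 0 < Re (c * (z - w)).
  have := Re_conjM (z - w) 0; rewrite nrm0 mulr0 subr0 addr0 -/c.
  by apply: lt_le_trans; rewrite exprn_gt0 // nrm_gt0 subr_eq0.
have [d d0 hd] := (nrm_continuousP f w).1 (cf Bw) 1 ltr01.
set K := (nrm (f w) + 1) * (nrm (z - w) + nrm (z' - w) + nrm (z - z')).
set len := nrm (z - w) + nrm (z' - w) + 1.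
have len0 : 0 < len by rewrite ltr_wpDl // addr_ge0 ?nrm_ge0.
apply: subr0_eq; apply: nrm_le0.
apply: (@le_small _ K (Num.min 1 (d / len))); first by rewrite lt_min ltr01 divr_gt0.
move=> e /andP[e0]; rewrite lt_min ltr_pdivlMr // => /andP[e1 ed].
have e01 : 0 <= e <= 1 by rewrite !ltW.
pose p := pt w z e; pose p' := pt w z' e.
have Bp : B p by exact: convB.
have Bp' : B p' by exact: convB.
have pE : p - w = rc e * (z - w) by rewrite /p /pt [w + _]addrC addrK.
have pE' : p' - w = rc e * (z' - w) by rewrite /p' /pt [w + _]addrC addrK.
pose r := Num.max (nrm w) (Num.max (nrm z) (nrm z')).
have rr : r < rho by rewrite !gt_max; apply/and3P; split.
pose dl := e * Num.min (Re (c * (z - w))) (Re (c * (z' - w))).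
pose S : set C := [set x | nrm x <= r /\ dl <= Re (c * (x - w))].
have dl1 : dl <= e * Re (c * (z - w)) by rewrite ler_wpM2l ?ge_min ?lexx // ltW.
have dl2 : dl <= e * Re (c * (z' - w)).
  by rewrite ler_wpM2l ?ge_min ?lexx ?orbT // ltW.
have dl0 : 0 < dl by rewrite mulr_gt0 // lt_min posz pos.
have cw : convex_set S.
  move=> a b t [a1 a2] [b1 b2] t01; split; first exact: convex_cball.
  have -> : c * (pt a b t - w) = rc (1 - t) * (c * (a - w)) + rc t * (c * (b - w)).
    by rewrite /pt rcD rcN rc1; ring.
  rewrite ReD !Re_rcM; move/andP: t01 => [t0 t1]; nra.
have clS : forall q, (forall e : R, 0 < e -> exists2 a, S a & nrm (q - a) < e) -> S q.
  move=> q hq; split.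
    apply/ler_addgt0Pr => x x0; have [a [ar _] qa] := hq x x0.
    rewrite -[q](subrK a); apply: le_trans (nrmD _ _) _.
    by rewrite addrC lerD // ltW.
  apply/ler_addgt0Pr => x x0.
  have c1 : 0 < nrm c + 1 by rewrite ltr_wpDl ?nrm_ge0.
  have [a [_ ad] qa] := hq _ (divr_gt0 x0 c1).
  have -> : c * (q - w) = c * (a - w) + c * (q - a) by ring.
  rewrite ReD -addrA; apply: le_trans ad _; rewrite lerDl.
  have := nrm_Re (c * (q - a)); rewrite nrmM ler_norml => /andP[h _].
  move: qa; rewrite ltr_pdivlMr // => qa.
  have := nrm_ge0 (q - a); have := nrm_ge0 c; nra.
have SB : forall q, S q -> B q by move=> q [qr _]; exact: le_lt_trans qr rr.
have Snw : forall q, S q -> q != w.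
  move=> q [_ qd]; apply/negP => /eqP qw.
  by move: qd; rewrite qw subrr mulr0 leNgt dl0.
have dS q : S q -> differentiable f q.
  by move=> Sq; apply: df; [exact: SB|exact: Snw].
have wr : nrm w <= r by rewrite le_max lexx.
have zr : nrm z <= r by rewrite !le_max lexx orbT.
have zr' : nrm z' <= r by rewrite !le_max lexx !orbT.
have Sz : S z by split=> //; apply: le_trans dl1 _; rewrite ler_piMl // ltW.
have Sz' : S z' by split=> //; apply: le_trans dl2 _; rewrite ler_piMl // ltW.
have Sp : S p.
  by split; [exact: convex_cball|rewrite pE mulrCA Re_rcM].
have Sp' : S p'.
  by split; [exact: convex_cball|rewrite pE' mulrCA Re_rcM].
have g1 := goursat cw clS dS Sp Sz Sz'.
have g2 := goursat cw clS dS Sp Sz' Sp'.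
have s1 := segint_split convB cf Bw Bz e01.
have s2 := segint_split convB cf Bw Bz' e01.
have r1 := segint_rev convB cf Bp Bz'.
have r2 := segint_rev convB cf Bp' Bz'.
have {g1 g2}-> : segint f w z + segint f z z' - segint f w z' = segint f w p - segint f w p' - segint f p' p.
  rewrite -s1 -s2 -/p -/p'.
  have -> : segint f p' p = segint f p' z' - segint f p z'.
    apply/eqP; rewrite eq_sym -subr_eq0 -oppr_eq0; apply/eqP.
    by rewrite -[RHS]g2 r2; ring.
  have -> : segint f z z' = segint f p z' - segint f p z.
    apply: subr0_eq.
    by rewrite -[RHS]g1 r1; ring.
  by ring.
have fb h : nrm h < d -> nrm (f (w + h)) <= nrm (f w) + 1.
  move=> /hd hh; rewrite -[f (w + h)](subrK (f w)); apply: le_trans (nrmD _ _) _.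
  by rewrite addrC lerD2l ltW.
have b a a' k k' : B a -> B a' -> a = w + rc e * k -> a' = w + rc e * k' ->
    nrm k + nrm k' <= len -> nrm (segint f a a') <= (nrm (f w) + 1) * (e * nrm (k' - k)).
  move=> Ba Ba' aE aE' kl.
  have -> : e * nrm (k' - k) = nrm (a' - a).
    rewrite aE aE'; have -> : w + rc e * k' - (w + rc e * k) = rc e * (k' - k) by ring.
    by rewrite nrmM nrm_rc gtr0_norm.
  apply: (segint_bound convB cf) => // t /andP[t0 t1].
  have -> : pt a a' t = w + rc e * (rc (1 - t) * k + rc t * k').
    by rewrite /pt aE aE' rcD rcN rc1; ring.
  apply: fb; rewrite nrmM nrm_rc gtr0_norm //.
  apply: le_lt_trans ed; rewrite ler_wpM2l ?(ltW e0) //.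
  apply: le_trans (nrmD _ _) _; apply: le_trans kl.
  rewrite !nrmM !nrm_rc !ger0_norm ?subr_ge0 //.
  by apply: lerD; rewrite ler_piMl ?nrm_ge0 // gerBl.
have l1 := nrm_ge0 (z - w); have l2 := nrm_ge0 (z' - w).
have b1 : nrm (segint f w p) <= (nrm (f w) + 1) * (e * nrm (z - w)).
  have := b w p 0 (z - w); rewrite subr0; apply=> //.
  - by rewrite mulr0 addr0.
  - by rewrite nrm0 add0r /len; lra.
have b2 : nrm (segint f w p') <= (nrm (f w) + 1) * (e * nrm (z' - w)).
  have := b w p' 0 (z' - w); rewrite subr0; apply=> //.
  - by rewrite mulr0 addr0.
  - by rewrite nrm0 add0r /len; lra.
have b3 : nrm (segint f p' p) <= (nrm (f w) + 1) * (e * nrm (z - z')).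
  have -> : z - z' = z - w - (z' - w) by ring.
  by apply: b => //; rewrite /len; lra.
apply: le_trans (nrmB _ _) _.
have -> : e * K = (nrm (f w) + 1) * (e * nrm (z - w)) + (nrm (f w) + 1) * (e * nrm (z' - w))
   + (nrm (f w) + 1) * (e * nrm (z - z')) by rewrite /K; ring.
by apply: lerD => //; apply: le_trans (nrmB _ _) _; apply: lerD.
Qed.

(** The primitive is the integral from [w]; by additivity its increments are
    integrals over short segments, on which [f] is almost constant. *)
Lemma primitive_on_ball : exists F, forall z, B z -> cder F z (f z).
Proof.
exists (segint f w) => z Bz e e0.
have [d d0 hd] := (nrm_continuousP f z).1 (cf Bz) e e0.
have rz : 0 < rho - nrm z by rewrite subr_gt0.
pose m := Num.min d (rho - nrm z).
have m0 : 0 < m by rewrite lt_min d0.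
have Bh h : nrm h < m -> B (z + h).
  rewrite lt_min => /andP[_ h2]; apply: le_lt_trans (nrmD _ _) _.
  by rewrite -ltrBrDl.
have loc h : nrm h < m -> nrm (segint f z (z + h) - f z * h) <= e * nrm h.
  move=> hm; have -> : f z * h = f z * (z + h) + 0 - (f z * z + 0) by ring.
  have := @segint_approx R B f convB cf (fun=> f z) (fun x => f z * x + 0) z (z + h) e Bz (Bh h hm).
  rewrite [z + h - z]addrAC subrr add0r; apply=> t t01; first exact: cder_lin.
  have -> : pt z (z + h) t = z + (pt z (z + h) t - z) by rewrite [RHS]addrC subrK.
  apply/ltW/hd; move: hm; rewrite lt_min => /andP[h1 _]; apply: le_lt_trans h1.
  by apply: le_trans (nrm_pt _ _ t01) _; rewrite addrAC subrr add0r.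
have [zw|zw] := eqVneq z w.
  exists m => // h hm.
  have -> : segint f w z = 0.
    apply: nrm_le0; rewrite zw.
    have h0 := segint_rev convB cf Bw Bw.
    have : segint f w w + segint f w w = 0 by rewrite {1}h0 addNr.
    by rewrite -mulr2n -mulr_natl => /eqP; rewrite mulf_eq0 pnatr_eq0 /= => /eqP ->; rewrite nrm0.
  by rewrite subr0 -[X in segint f X]zw; exact: loc.
have u0 : 0 < nrm (z - w) by rewrite nrm_gt0 subr_eq0.
exists (Num.min m (nrm (z - w))); first by rewrite lt_min m0.
move=> h; rewrite lt_min => /andP[hm hu].
rewrite -(@primitive_add z (z + h)) //; last 2 first.
- exact: Bh.
- have -> : z + h - w = (z - w) + h by ring.
  apply: lt_le_trans (Re_conjM _ _); rewrite expr2 -mulrBr mulr_gt0 // subr_gt0 //.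
by rewrite [segint f w z + _]addrC addrK; exact: loc.
Qed.

End OnBall.
End Primitive.

(** * Integrals over a circle *)

Section Circle.
Variable R : realType.
Local Notation C := (complex_field R).
Local Notation Re := (@complex.Re R).
Local Notation Im := (@complex.Im R).
Local Notation i1 := (Complex 0 1 : C).

Definition cis (x : R) : C := (cos x +i* sin x)%C.

Lemma nrm_cis x : nrm (cis x) = 1.
Proof. by rewrite /nrm normc_def /= cos2Dsin2 sqrtr1. Qed.

Lemma cisD x y : cis (x + y) = cis x * cis y.
Proof. by rewrite /cis cosD sinD; congr (Complex _ _); rewrite addrC. Qed.

Lemma cis0 : cis 0 = 1.
Proof. by rewrite /cis cos0 sin0. Qed.

Lemma cisN x : cis (- x) = (cis x)^-1.
Proof.
have h : cis x != 0 by rewrite -nrm_eq0 nrm_cis oner_eq0.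
by apply: (mulfI h); rewrite -cisD subrr cis0 divff.
Qed.

Lemma cisMn x k : cis (x *+ k) = cis x ^+ k.
Proof. by elim: k => [|k IH]; rewrite ?mulr0n ?cis0 // mulrS cisD IH exprS. Qed.

Lemma cis2pi : cis (pi *+ 2) = 1.
Proof. by rewrite /cis cos2pi sin2pi. Qed.

Lemma rdiff_cis x : rdiff cis x (i1 * cis x).
Proof.
apply: Re_rdiff.
  have -> : Re (i1 * cis x) = - sin x by rewrite /= !mul0r mul1r add0r.
  exact: is_derive_cos.
have -> : Im (i1 * cis x) = cos x by rewrite /= !mul0r mul1r add0r.
exact: is_derive_sin.
Qed.

(** The integral of [h] over one period of [cis]. *)
Definition is_circint (h : R -> C) (j : C) : Prop :=
  exists2 H : R -> C, forall t, 0 <= t <= pi *+ 2 -> rdiff H t (h t) &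
    j = H (pi *+ 2) - H 0.

Lemma twopi_ge0 : 0 <= pi *+ 2 :> R.
Proof. by rewrite mulrn_wge0 // pi_ge0. Qed.

Lemma is_circintD h g j k : is_circint h j -> is_circint g k -> is_circint (fun t => h t + g t) (j + k).
Proof.
move=> [H hH ->] [G hG ->]; exists (fun t => H t + G t); last by ring.
by move=> t ht; apply: rdiffD; [exact: hH|exact: hG].
Qed.

Lemma is_circintZ c h j : is_circint h j -> is_circint (fun t => c * h t) (c * j).
Proof.
move=> [H hH ->]; exists (fun t => c * H t); last by ring.
by move=> t ht; apply: rdiffZ; exact: hH.
Qed.

Lemma is_circint_eq h g j k : h =1 g -> j = k -> is_circint h j -> is_circint g k.
Proof. by move=> /funext -> ->. Qed.

Lemma is_circint_bound h j M : is_circint h j ->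
  (forall t, 0 <= t <= pi *+ 2 -> nrm (h t) <= M) ->
  nrm j <= M * (pi *+ 2).
Proof.
move=> [H hH ->] hM; have := @rdiff_mvt _ H h 0 (pi *+ 2) M twopi_ge0.
by rewrite subr0; exact.
Qed.

Lemma is_circint_ex (r : R) (g : C -> C) :
  (forall t, {for rc r * cis t, continuous g}) ->
  exists j, is_circint (fun t => g (rc r * cis t)) j.
Proof.
move=> cg; have cont t : rcont (fun t => g (rc r * cis t)) t.
  move=> e e0; have [d d0 hd] := (nrm_continuousP g _).1 (cg t) e e0.
  have [d' d'0 hd'] := rdiff_cont (rdiffZ (rc r) (rdiff_cis t)) d0.
  exists d' => // s sd'; have := hd _ (hd' s sd').
  by rewrite [rc r * cis t + _]addrC subrK.
have [H hH] := antiderivative 0 (pi *+ 2) cont.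
by exists (H (pi *+ 2) - H 0), H.
Qed.

Lemma is_circint_cst (c : C) : is_circint (fun=> c) (rc (pi *+ 2) * c).
Proof.
exists (fun t => 0 + rc t * c) => [t _|]; first exact: rdiff_line.
by rewrite rc0; ring.
Qed.

Lemma is_circint_cis k : (0 < k)%N -> is_circint (fun t => (cis t)^-1 ^+ k) 0.
Proof.
move=> k_gt0; pose q : R := k%:R.
have q0 : rc q != 0 by rewrite -nrm_eq0 nrm_rc normr_eq0 pnatr_eq0 -lt0n.
have ii : i1 * i1 = -1 by rewrite -expr2 sqr_i.
exists (fun t => (i1 / rc q) * cis (0 + (- q) * t)) => [t _|].
  have -> : (cis t)^-1 ^+ k = (i1 / rc q) * (rc (- q) * (i1 * cis (0 + (- q) * t))).
    have -> : cis (0 + (- q) * t) = (cis t)^-1 ^+ k.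
      by rewrite add0r mulNr mulr_natl -mulNrn cisMn cisN.
    rewrite rcN.
    have -> : forall x y : C, y != 0 -> i1 / y * (- y * (i1 * x)) = - (i1 * i1) * x.
    - by move=> x y y0; field.
    - by rewrite ii opprK mul1r.
    - exact: q0.
  by apply: rdiffZ; apply: rdiff_comp_affine; exact: rdiff_cis.
rewrite mulr0 addr0 cis0 add0r.
have -> : - q * (pi *+ 2) = - ((pi *+ 2) *+ k) by rewrite mulNr mulr_natl.
by rewrite cisN cisMn cis2pi expr1n invr1 subrr.
Qed.

End Circle.

(** * Taylor expansion *)

Section Taylor.
Variable R : realType.
Local Notation C := (complex_field R).
Local Notation i1 := (Complex 0 1 : C).

Section Expand.
Variables (r M : R) (psi : C -> C) (a : nat -> C).
Hypothesis r0 : 0 < r.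
Hypothesis M0 : forall t, 0 <= t <= pi *+ 2 -> nrm (psi (rc r * cis t)) <= M.
Hypothesis ha : forall k, is_circint (fun t => psi (rc r * cis t) * (rc r * cis t)^-1 ^+ k) (a k).

(** The geometric series of the Cauchy kernel: with [z] on the circle,
    [z / (z - w)] is the sum of the [(w / z) ^ k] for [k < N] plus
    [(w / z) ^ N * (z / (z - w))], and the last factor is at most [2]. *)
Lemma cauchy_expand (w j : C) N : nrm w <= r / 2 ->
  is_circint (fun t => psi (rc r * cis t) * (rc r * cis t / (rc r * cis t - w))) j ->
  nrm (j - \sum_(k < N) a k * w ^+ k) <= 2 * M * (nrm w / r) ^+ N * (pi *+ 2).
Proof.
move=> wr hj.
have nz t : nrm (rc r * cis t) = r by rewrite nrmM nrm_rc nrm_cis mulr1 gtr0_norm.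
have z0 t : rc r * cis t != 0 by rewrite -nrm_eq0 nz lt0r_neq0.
have zw t : r / 2 <= nrm (rc r * cis t - w).
  have := nrmD (rc r * cis t - w) w; rewrite subrK nz => h; lra.
have zw0 t : rc r * cis t - w != 0.
  by rewrite -nrm_eq0 lt0r_neq0 // (lt_le_trans _ (zw t)) // divr_gt0.
have step : is_circint (fun t => psi (rc r * cis t) * (w / (rc r * cis t)) ^+ N *
    (rc r * cis t / (rc r * cis t - w))) (j - \sum_(k < N) a k * w ^+ k).
  elim: N => [|N IH].
    rewrite big_ord0 subr0; by apply: is_circint_eq hj => [t|]; [rewrite expr0 mulr1|].
  have := is_circintD IH (is_circintZ (- w ^+ N) (ha N)).
  apply: is_circint_eq => [t|]; last by rewrite big_ord_recr /=; ring.
  rewrite !exprMn !exprS; move: (z0 t) (zw0 t); move: (rc r * cis t) => z h1 h2.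
  by field; rewrite h1 h2.
apply: is_circint_bound step _ => t /M0.
move: (nz t) (zw t); move: (rc r * cis t) => z nzt zwt Mz.
rewrite !nrmM nrmX !nrmM !nrmV nzt.
have -> : 2 * M * (nrm w / r) ^+ N = M * (nrm w / r) ^+ N * 2 by ring.
apply: ler_pM.
- by rewrite mulr_ge0 ?nrm_ge0 // exprn_ge0 // divr_ge0 ?nrm_ge0 // ltW.
- by rewrite divr_ge0 ?nrm_ge0 // ltW.
- by rewrite ler_wpM2r // exprn_ge0 // divr_ge0 ?nrm_ge0 // ltW.
rewrite ler_pdivrMr; last by rewrite (lt_le_trans _ zwt) // divr_gt0.
lra.
Qed.

End Expand.

Lemma geom_small (e K : R) : 0 < e -> exists N : nat, K * 2^-1 ^+ N <= e.
Proof.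
move=> e0; have k0 : 0 <= `|K| / e by rewrite divr_ge0 // ltW.
exists (Num.bound (`|K| / e)); have := archi_boundP k0.
set n := Num.bound _ => hn; rewrite exprVn ler_pdivrMr ?exprn_gt0 //.
apply: le_trans (ler_norm K) _; rewrite [e * _]mulrC -ler_pdivrMr //.
by apply: ltW; apply: lt_trans hn _; rewrite -natrX ltr_nat ltn_expl.
Qed.

(** The same expansion for the constant function [1]: all coefficients but the
    first vanish, and the remainder tends to zero. *)
Lemma cauchy_kernel (r : R) (w : C) : 0 < r -> nrm w <= r / 2 ->
  is_circint (fun t => rc r * cis t / (rc r * cis t - w)) (rc (pi *+ 2)).
Proof.
move=> r0 wr.
have nz t : nrm (rc r * cis t) = r by rewrite nrmM nrm_rc nrm_cis mulr1 gtr0_norm.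
have z0 t : rc r * cis t != 0 by rewrite -nrm_eq0 nz lt0r_neq0.
have zw0 t : rc r * cis t - w != 0.
  rewrite -nrm_eq0 lt0r_neq0 //.
  have := nrmD (rc r * cis t - w) w; rewrite subrK nz => h; lra.
have [j hj] : exists j, is_circint (fun t => rc r * cis t / (rc r * cis t - w)) j.
  apply: (@is_circint_ex R r (fun z => z / (z - w))) => t.
  apply: diff_cont; apply: diff_mul; first exact: diff_id.
  by apply: diff_inv => //; apply: diff_sub.
suff -> : rc (pi *+ 2) = j by [].
pose a k : C := if k == 0%N then rc (pi *+ 2) else 0.
have ha k : is_circint (fun t => 1 * (rc r * cis t)^-1 ^+ k) (a k).
  rewrite /a; case: eqP => [->|/eqP k0].
    apply: is_circint_eq (is_circint_cst 1) => [t|]; first by rewrite expr0 mulr1.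
    by rewrite mulr1.
  have := is_circintZ ((rc r)^-1 ^+ k) (@is_circint_cis R k _); rewrite lt0n mulr0 => /(_ k0).
  by apply: is_circint_eq => [t|]; [rewrite mul1r invfM exprMn|].
have h1 (t : R) : 0 <= t <= pi *+ 2 -> nrm (1 : C) <= 1 by rewrite nrm1.
have hj' : is_circint (fun t => 1 * (rc r * cis t / (rc r * cis t - w))) j.
  by apply: is_circint_eq hj => [t|]; [rewrite mul1r|].
apply/eqP; rewrite eq_sym -subr_eq0 -nrm_eq0 eq_le nrm_ge0 andbT.
apply/ler_addgt0Pr => e e0; rewrite add0r.
have [N hN] := geom_small (2 * (pi *+ 2)) e0.
have := cauchy_expand (psi := fun=> 1) r0 h1 ha N.+1 wr hj'.
rewrite big_ord_recl /= {1}/a eqxx expr0 mulr1 big1 => [|i _]; last first.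
  by rewrite /a /= mul0r.
rewrite addr0 => h; apply: le_trans h _; apply: le_trans hN.
rewrite mulr1 mulrAC ler_wpM2l ?mulr_ge0 ?twopi_ge0 //.
have q0 : 0 <= nrm w / r by rewrite divr_ge0 ?nrm_ge0 // ltW.
have q1 : nrm w / r <= 2^-1 by rewrite ler_pdivrMr // mulrC.
apply: le_trans (_ : 2^-1 ^+ N.+1 <= _).
  by rewrite lerXn2r // nnegrE invr_ge0.
by rewrite exprS ler_piMl ?exprn_ge0 ?invr_ge0 // invf_le1 // ler1n.
Qed.

(** The difference quotient [phi] of [f] at [w] is holomorphic off [w] and
    continuous at [w], so it has a primitive and its integral over the circle
    vanishes.  This is Cauchy's integral formula for [f w], and the coefficients
    come from expanding its kernel. *)
Lemma taylor (f : C -> C) (rho r M : R) : 0 < r -> r < rho ->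
  (forall z, nrm z < rho -> differentiable f z) ->
  (forall t, 0 <= t <= pi *+ 2 -> nrm (f (rc r * cis t)) <= M) ->
  exists c : nat -> C, forall N w, nrm w <= r / 2 ->
    nrm (f w - \sum_(k < N) c k * w ^+ k) <= 2 * M * (nrm w / r) ^+ N.
Proof.
move=> r0 rrho df fM.
have nz t : nrm (rc r * cis t) = r by rewrite nrmM nrm_rc nrm_cis mulr1 gtr0_norm.
have z0 t : rc r * cis t != 0 by rewrite -nrm_eq0 nz lt0r_neq0.
have ex k : exists a, is_circint (fun t => f (rc r * cis t) * (rc r * cis t)^-1 ^+ k) a.
  apply: (@is_circint_ex R r (fun z => f z * z^-1 ^+ k)) => t; apply: diff_cont.
  apply: diff_mul; first by apply: df; rewrite nz.
  by apply: diff_exp; apply: diff_inv => //; exact: diff_id.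
have [a ha] := choice ex.
have P0 : rc (pi *+ 2) != 0 :> C.
  by rewrite -nrm_eq0 nrm_rc normr_eq0 mulrn_eq0 /= lt0r_neq0 // pi_gt0.
have Pp : 0 < pi *+ 2 :> R by rewrite mulrn_wgt0 // pi_gt0.
exists (fun k => a k / rc (pi *+ 2)) => N w wr.
have wrho : nrm w < rho by apply: le_lt_trans wr _; lra.
have zw0 t : rc r * cis t - w != 0.
  rewrite -nrm_eq0 lt0r_neq0 //.
  have := nrmD (rc r * cis t - w) w; rewrite subrK nz => h; lra.
pose phi z := if z == w then 'd f w 1 else (f z - f w) / (z - w).
have phiE z : phi z * (z - w) = f z - f w.
  rewrite /phi; case: eqP => [->|/eqP zw]; first by rewrite !subrr mulr0.
  by rewrite mulfVK // subr_eq0.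
have dphi z : nrm z < rho -> z != w -> differentiable phi z.
  move=> zr zw; apply: (@near_differentiable _ _ _ (fun z => (f z - f w) / (z - w))).
    apply/near_nrmP; exists (nrm (z - w)); first by rewrite nrm_gt0 subr_eq0.
    move=> x hx; rewrite /phi; case: eqP => // xw.
    by move: hx; rewrite xw nrmC ltxx.
  apply: diff_mul; first by apply: diff_sub; [exact: df|exact: diff_cst].
  apply: diff_inv; first by rewrite subr_eq0.
  by apply: diff_sub; [exact: diff_id|exact: diff_cst].
have cphi z : nrm z < rho -> {for z, continuous phi}.
  move=> zr; have [->|zw] := eqVneq z w; last exact/differentiable_continuous/dphi.
  apply/nrm_continuousP => e e0.
  have e1 : 0 < e / 2 by rewrite divr_gt0.
  have [d d0 hd] := differentiable_cder (df w wrho) e1.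
  exists d => // h hh; rewrite /phi eqxx; case: eqP => [_|/eqP wh].
    by rewrite subrr nrm0.
  have h0 : h != 0 by move: wh; rewrite -subr_eq0 addrAC subrr add0r.
  have hp : 0 < nrm h by rewrite nrm_gt0.
  have -> : (f (w + h) - f w) / (w + h - w) - 'd f w 1 =
      (f (w + h) - f w - 'd f w 1 * h) / h.
    by have -> : w + h - w = h; [ring|field].
  rewrite nrmM nrmV ltr_pdivrMr //; apply: le_lt_trans (hd h hh) _.
  by rewrite ltr_pM2r // ltr_pdivrMr // ltr_pMr // ltr1n.
have [F hF] := primitive_on_ball (f := phi) wrho cphi dphi.
have ii : i1 * i1 = -1 by rewrite -expr2 sqr_i.
(* the curve t |-> rc r * cis t has velocity i1 times itself *)
have K0 : is_circint (fun t => phi (rc r * cis t) * (rc r * cis t)) 0.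
  exists (fun t => (- i1) * F (rc r * cis t)) => [t _|]; last first.
    by rewrite cis2pi cis0 subrr.
  have -> : phi (rc r * cis t) * (rc r * cis t) =
     (- i1) * (phi (rc r * cis t) * (rc r * (i1 * cis t))).
    have -> : forall x y u v : C, - i1 * (x * (y * (i1 * u))) = - (i1 * i1) * (x * (y * u)).
    - by move=> *; ring.
    - by rewrite ii opprK mul1r.
    - exact: 0.
  apply: rdiffZ; apply: (rdiff_comp (H := fun t => rc r * cis t)).
    by apply: hF; rewrite /= nz.
  by apply: rdiffZ; exact: rdiff_cis.
have KJ := is_circintZ (f w) (cauchy_kernel r0 wr).
have KF : is_circint (fun t => f (rc r * cis t) * (rc r * cis t / (rc r * cis t - w)))
    (f w * rc (pi *+ 2)).
  have := is_circintD K0 KJ; rewrite add0r; apply: is_circint_eq => [t|]; last by [].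
  move: (phiE (rc r * cis t)) (zw0 t); move: (rc r * cis t) => z hz zw.
  have -> : phi z = (f z - f w) / (z - w) by rewrite -hz mulfK.
  by field; exact: zw.
have := cauchy_expand r0 fM ha N wr KF.
have -> : f w * rc (pi *+ 2) - \sum_(k < N) a k * w ^+ k =
   rc (pi *+ 2) * (f w - \sum_(k < N) a k / rc (pi *+ 2) * w ^+ k).
  rewrite mulrBr mulrC mulr_sumr; congr (_ - _); apply: eq_bigr => i _.
  by rewrite mulrA [rc _ * _]mulrC mulfVK.
by rewrite nrmM nrm_rc gtr0_norm // mulrC ler_pM2r.
Qed.

End Taylor.

(** * Holomorphic functions of one variable *)

Section OneVariable.
Variable R : realType.
Local Notation C := (complex_field R).

Lemma circle_bound (f : C -> C) (r : R) :
  (forall t, {for rc r * cis t, continuous f}) ->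
  exists M, forall t, 0 <= t <= pi *+ 2 -> nrm (f (rc r * cis t)) <= M.
Proof.
move=> cf.
suff cF : {within `[0, pi *+ 2], continuous (fun t => nrm (f (rc r * cis t)))}.
  have [c _ hc] := EVT_max (twopi_ge0 R) cF.
  by exists (nrm (f (rc r * cis c))) => t ht; apply: hc; rewrite in_itv.
apply: continuous_subspaceT => t; apply/cvgrPdist_lt => /= e e0.
have [d d0 hd] := (nrm_continuousP f _).1 (cf t) e e0.
have [d' d'0 hd'] := rdiff_cont (rdiffZ (rc r) (rdiff_cis t)) d0.
apply/nbhs_ballP; exists d' => //= s; rewrite /ball /= distrC => ts.
have := hd _ (hd' _ ts); rewrite [t + _]addrC subrK [_ + (_ - _)]addrC subrK.
move: (f _) (f _) => x y; apply: le_lt_trans; rewrite ler_norml.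
have := nrmD (y - x) x; have := nrmD (x - y) y; rewrite !subrK [nrm (y - x)]nrmC => h1 h2.
by apply/andP; split; lra.
Qed.

Lemma taylor_ex (f : C -> C) (rho r : R) : 0 < r -> r < rho ->
  (forall z, nrm z < rho -> differentiable f z) ->
  exists c : nat -> C, exists2 M, 0 <= M & forall N w, nrm w <= r / 2 ->
    nrm (f w - \sum_(k < N) c k * w ^+ k) <= M * (nrm w / r) ^+ N.
Proof.
move=> r0 rrho df.
have [t|M hM] := @circle_bound f r.
  apply: diff_cont; apply: df.
  by rewrite nrmM nrm_rc nrm_cis mulr1 gtr0_norm.
have [c hc] := taylor r0 rrho df hM; exists c, (2 * M) => //.
by rewrite mulr_ge0 // (le_trans _ (hM 0 _)) ?nrm_ge0 // lexx twopi_ge0.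
Qed.

(** All Taylor coefficients vanish, one after the other. *)
Lemma zero_near_zero (f : C -> C) (rho d : R) : 0 < d ->
  (forall z, nrm z < rho -> differentiable f z) ->
  (forall z, nrm z < d -> f z = 0) ->
  forall w, nrm w < rho / 2 -> f w = 0.
Proof.
move=> d0 df f0 w wrho.
pose r := (2 * nrm w + rho) / 2; have w0 := nrm_ge0 w.
have r0 : 0 < r by rewrite /r; lra.
have rrho : r < rho by rewrite /r; lra.
have wr : nrm w <= r / 2 by rewrite /r; lra.
have [c [M M0 hc]] := taylor_ex r0 rrho df.
have c0 k : c k = 0.
  elim/ltn_ind: k => k IH; apply: nrm_le0.
  pose K := M / r ^+ k.+1.
  apply: (@le_small _ _ K (Num.min d (r / 2))); first by rewrite lt_min d0 divr_gt0.
  move=> e /andP[e0]; rewrite lt_min => /andP[ed er].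
  have ne : nrm (rc e) = e by rewrite nrm_rc gtr0_norm.
  have := hc k.+1 (rc e); rewrite ne => /(_ (ltW er)).
  rewrite f0 ?ne // big_ord_recr /= big1 => [|i _]; last by rewrite IH // mul0r.
  rewrite !add0r nrmN nrmM nrmX ne expr_div_n => h.
  rewrite -(ler_pM2r (exprn_gt0 k e0)); apply: le_trans h _.
  by rewrite /K exprS; have -> : e * (M / r ^+ k.+1) * e ^+ k = M * (e * e ^+ k / r ^+ k.+1) by ring.
apply: nrm_le0.
apply/ler_addgt0Pr => e e0; rewrite add0r.
have [N hN] := geom_small M e0; apply: (le_trans _ hN).
have := hc N w wr; rewrite big1 => [|i _]; last by rewrite c0 mul0r.
rewrite subr0 => h; apply: le_trans h _; rewrite ler_wpM2l // lerXn2r // ?nnegrE ?invr_ge0 //.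
  by rewrite divr_ge0 // ltW.
by rewrite ler_pdivrMr // mulrC.
Qed.

(** Schwarz's lemma to first and second order; the constants depend on the bound
    and the radius only. *)
Lemma bounded_taylor2 (f : C -> C) (rho M : R) : 0 < rho ->
  (forall z, nrm z < rho -> differentiable f z) ->
  (forall z, nrm z < rho -> nrm (f z) <= M) ->
  exists c : C, forall w, nrm w <= rho / 4 ->
    nrm (f w - f 0) <= 4 * M / rho * nrm w /\
    nrm (f w - f 0 - c * w) <= 8 * M / rho ^+ 2 * nrm w ^+ 2.
Proof.
move=> rho0 df fM; have r0 : 0 < rho / 2 by rewrite divr_gt0.
have rrho : rho / 2 < rho by lra.
have [|c hc] := @taylor _ f rho (rho / 2) M r0 rrho df.
  by move=> t _; apply: fM; rewrite nrmM nrm_rc nrm_cis mulr1 gtr0_norm.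
have c0 : f 0 = c 0%N.
  have := hc 1%N 0; rewrite nrm0 mul0r expr1 mulr0 => /(_ ltac:(lra)).
  rewrite big_ord_recl big_ord0 expr0 mulr1 addr0 => h.
  by apply: subr0_eq; apply: nrm_le0.
exists (c 1%N) => w wr; have {}wr : nrm w <= rho / 2 / 2 by lra.
have h1 := hc 1%N w wr; have h2 := hc 2%N w wr.
rewrite big_ord_recl big_ord0 expr0 mulr1 addr0 -c0 in h1.
rewrite !big_ord_recl big_ord0 /= expr0 expr1 mulr1 addr0 -c0 opprD addrA in h2.
split.
  have -> : 4 * M / rho * nrm w = 2 * M * (nrm w / (rho / 2)) ^+ 1.
    by field; rewrite lt0r_neq0.
  exact: h1.
have -> : 8 * M / rho ^+ 2 * nrm w ^+ 2 = 2 * M * (nrm w / (rho / 2)) ^+ 2.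
  by field; rewrite lt0r_neq0.
exact: h2.
Qed.

(** [f z / z] extends by the first Taylor coefficient, and the remainder of order
    three shows that the extension is differentiable at [0]. *)
Lemma divide_coordinate (f : C -> C) (rho : R) : 0 < rho ->
  (forall z, nrm z < rho -> differentiable f z) -> f 0 = 0 ->
  exists2 g : C -> C, forall z, nrm z < rho -> differentiable g z &
    forall z, nrm z < rho -> f z = z * g z.
Proof.
move=> rho0 df f0; have r0 : 0 < rho / 2 by rewrite divr_gt0.
have rrho : rho / 2 < rho by lra.
have [c [M M0 hc]] := taylor_ex r0 rrho df.
have c0 : c 0%N = 0.
  have := hc 1%N 0; rewrite nrm0 mul0r expr1 mulr0 => /(_ ltac:(lra)).
  rewrite big_ord_recl big_ord0 expr0 mulr1 addr0 f0 sub0r nrmN => h.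
  by apply: nrm_le0.
pose g z := if z == 0 then c 1%N else f z / z.
exists g => z zr; last first.
  rewrite /g; case: eqP => [->|/eqP z0]; first by rewrite f0 mul0r.
  by rewrite mulrC mulfVK.
have [->|z0] := eqVneq z 0; last first.
  apply: (@near_differentiable _ _ _ (fun z => f z / z)).
    apply/near_nrmP; exists (nrm z); first by rewrite nrm_gt0.
    move=> x hx; rewrite /g; case: eqP => // x0.
    by move: hx; rewrite x0 sub0r nrmN ltxx.
  by apply: diff_mul; [exact: df|apply: diff_inv; [|exact: diff_id]].
apply: (@cder_differentiable _ _ _ (c 2)) => e e0.
pose K := M / (rho / 2) ^+ 3; have K0 : 0 <= K by rewrite divr_ge0 // exprn_ge0 // ltW.
have K1 : 0 < K + 1 by rewrite ltr_wpDl.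
exists (Num.min (rho / 4) (e / (K + 1))); first by rewrite lt_min divr_gt0 // divr_gt0.
move=> h; rewrite lt_min => /andP[h1]; rewrite ltr_pdivlMr // => h2.
rewrite add0r; have [->|h0] := eqVneq h 0; first by rewrite /g eqxx mulr0 subr0 subrr nrm0 mulr0.
rewrite /g eqxx (negbTE h0); have hp : 0 < nrm h by rewrite nrm_gt0.
have hr : nrm h <= rho / 2 / 2 by move: h1; clear; lra.
have := hc 3 h hr; rewrite !big_ord_recl big_ord0 /= /bump /=.
rewrite c0 mul0r add0r addr0 expr1 expr_div_n.
have -> : f h - (c 1%N * h + c 2 * h ^+ 2) = (f h / h - c 1%N - c 2 * h) * h.
  by field.
rewrite nrmM => hh; rewrite -(ler_pM2r hp); apply: le_trans hh _.
have -> : M * (nrm h ^+ 3 / (rho / 2) ^+ 3) = K * nrm h * nrm h * nrm h by rewrite /K; ring.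
rewrite ler_pM2r // ler_pM2r //.
by apply: (le_trans _ (ltW h2)); rewrite mulrC ler_wpM2l ?nrm_ge0 // lerDl.
Qed.

(** From [v ^ 2 = u ^ 3] and [u 0 = 0] the order of vanishing of [u] is at least
    two and that of [v] at least three.  Dividing by the coordinate, [b z / z]
    has a holomorphic square [u2] and cube [v3], hence has a limit at [0]:
    either [0], or [v3 0 / u2 0]. *)
Lemma cusp_one_variable (b u v : C -> C) (rho : R) : 0 < rho ->
  (forall z, nrm z < rho -> differentiable u z) ->
  (forall z, nrm z < rho -> differentiable v z) ->
  (forall z, nrm z < rho -> b z ^+ 2 = u z) ->
  (forall z, nrm z < rho -> b z ^+ 3 = v z) ->
  b 0 = 0 -> differentiable b 0.
Proof.
move=> rho0 du dv bu bv b0.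
have B0 : nrm (0 : C) < rho by rewrite nrm0.
have lim0 (g : C -> C) : {for 0, continuous g} ->
    (forall z, nrm z < rho -> z != 0 -> g z = 0) -> g 0 = 0.
  move=> cg g0; apply: nrm_le0.
  apply/ler_addgt0Pr => e e0; rewrite add0r.
  have [d d0 hd] := (nrm_continuousP g 0).1 cg e e0.
  pose t := Num.min (d / 2) (rho / 2).
  have t0 : 0 < t by rewrite lt_min !divr_gt0.
  have nt : nrm (rc t) = t by rewrite nrm_rc gtr0_norm.
  have td : t < d by rewrite gt_min; apply/orP; left; lra.
  have tr : t < rho by rewrite gt_min; apply/orP; right; lra.
  have := hd (rc t); rewrite nt add0r g0 ?nt // -?nrm_eq0 ?nt ?lt0r_neq0 //.
  by rewrite sub0r nrmN => /(_ td)/ltW.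
have c_of (g : C -> C) : (forall z, nrm z < rho -> differentiable g z) -> {for 0, continuous g}.
  by move=> dg; apply: diff_cont; exact: dg.
have [u1 du1 u1E] : exists2 g : C -> C, forall z, nrm z < rho -> differentiable g z &
    forall z, nrm z < rho -> u z = z * g z.
  by apply: divide_coordinate => //; rewrite -bu // b0 expr0n.
have [v1 dv1 v1E] : exists2 g : C -> C, forall z, nrm z < rho -> differentiable g z &
    forall z, nrm z < rho -> v z = z * g z.
  by apply: divide_coordinate => //; rewrite -bv // b0 expr0n.
have rel z : nrm z < rho -> v z ^+ 2 = u z ^+ 3.
  by move=> zr; rewrite -bu // -bv // -!exprM.
have v10 : v1 0 = 0.
  have := lim0 (fun z => v1 z * v1 z - z * (u1 z * (u1 z * u1 z))); rewrite mul0r subr0.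
  move=> h; apply/eqP; rewrite -[_ == 0]orbb -mulf_eq0; apply/eqP; apply: h.
    apply: c_of => z zr; apply: diff_sub.
      by apply: diff_mul; exact: dv1.
    apply: diff_mul => //; apply: diff_mul; first exact: du1.
    by apply: diff_mul; exact: du1.
  move=> z zr z0; have := rel z zr; rewrite u1E // v1E // => h'.
  apply: (mulfI (mulf_neq0 z0 z0)).
  by rewrite mulr0 -[RHS](subrr ((z * u1 z) ^+ 3)) -{1}h'; ring.
have [v2 dv2 v2E] := divide_coordinate rho0 dv1 v10.
have u10 : u1 0 = 0.
  have := lim0 (fun z => u1 z * (u1 z * u1 z) - z * (v2 z * v2 z)); rewrite mul0r subr0.
  move=> h; apply/eqP; rewrite -[_ == 0]orbb -[X in _ || X]orbb -!mulf_eq0; apply/eqP; apply: h.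
    apply: c_of => z zr; apply: diff_sub.
      by apply: diff_mul; [|apply: diff_mul]; exact: du1.
    by apply: diff_mul => //; apply: diff_mul; exact: dv2.
  move=> z zr z0; have := rel z zr; rewrite u1E // v1E // v2E // => h'.
  apply: (mulfI (mulf_neq0 z0 (mulf_neq0 z0 z0))).
  by rewrite mulr0 -[RHS](subrr ((z * u1 z) ^+ 3)) -{2}h'; ring.
have [u2 du2 u2E] := divide_coordinate rho0 du1 u10.
have v20 : v2 0 = 0.
  have := lim0 (fun z => v2 z * v2 z - z * (z * (u2 z * (u2 z * u2 z)))); rewrite mul0r subr0.
  move=> h; apply/eqP; rewrite -[_ == 0]orbb -mulf_eq0; apply/eqP; apply: h.
    apply: c_of => z zr; apply: diff_sub.
      by apply: diff_mul; exact: dv2.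
    apply: diff_mul => //; apply: diff_mul => //.
    by apply: diff_mul; [|apply: diff_mul]; exact: du2.
  move=> z zr z0; have := rel z zr; rewrite u1E // v1E // v2E // u2E // => h'.
  apply: (mulfI (mulf_neq0 (mulf_neq0 z0 z0) (mulf_neq0 z0 z0))).
  by rewrite mulr0 -[RHS](subrr ((z * (z * v2 z)) ^+ 2)) {2}h'; ring.
have [v3 dv3 v3E] := divide_coordinate rho0 dv2 v20.
(* for z != 0, the quotient q = b z / z has q^2 = u2 z and q^3 = v3 z *)
have q2 z : nrm z < rho -> z != 0 -> (b z / z) ^+ 2 = u2 z.
  by move=> zr z0; rewrite expr_div_n bu // u1E // u2E //; field.
have q3 z : nrm z < rho -> z != 0 -> (b z / z) ^+ 3 = v3 z.
  by move=> zr z0; rewrite expr_div_n bv // v1E // v2E // v3E //; field.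
suff [a ha] : exists a : C, forall e : R, 0 < e -> exists2 d : R, 0 < d &
    forall h, nrm h < d -> h != 0 -> nrm (b h / h - a) <= e.
  apply: (@cder_differentiable _ _ _ a) => e e0; have [d d0 hd] := ha e e0.
  exists d => // h hh; rewrite b0 subr0 add0r.
  have [->|h0] := eqVneq h 0; first by rewrite b0 mulr0 subr0 nrm0 mulr0.
  have -> : b h - a * h = (b h / h - a) * h by field.
  by rewrite nrmM ler_wpM2r ?nrm_ge0 // hd.
have [u20|u20] := eqVneq (u2 0) 0.
  exists 0 => e e0.
  have [d d0 hd] := (nrm_continuousP u2 0).1 (c_of _ du2) (e ^+ 2) (exprn_gt0 2 e0).
  exists (Num.min d rho); first by rewrite lt_min d0.
  move=> h; rewrite lt_min => /andP[h1 h2] h0; have := hd h h1.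
  rewrite u20 add0r subr0 -q2 // nrmX subr0 => h3.
  by rewrite -(@ler_pXn2r _ 2) ?nnegrE ?nrm_ge0 // ltW.
exists (v3 0 / u2 0) => e e0.
have cq : {for 0, continuous (fun z => v3 z / u2 z)}.
  apply: diff_cont; apply: diff_mul; first exact: dv3.
  by apply: diff_inv => //; exact: du2.
have [d d0 hd] := (nrm_continuousP _ 0).1 cq e e0.
have [d' d'0 hd'] := (nrm_continuousP u2 0).1 (c_of _ du2) (nrm (u2 0)) ltac:(by rewrite nrm_gt0).
exists (Num.min (Num.min d d') rho); first by rewrite !lt_min d0 d'0.
move=> h; rewrite !lt_min => /andP[/andP[h1 h2] h3] h0.
have := hd h h1; rewrite add0r; have uh : u2 h != 0.
  apply/eqP => uh; have := hd' h h2; rewrite add0r uh sub0r nrmN ltxx //.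
have -> : v3 h / u2 h = b h / h; last by move/ltW.
by apply: (mulIf uh); rewrite mulfVK // -q2 // -q3 // -exprS.
Qed.

End OneVariable.

(** * Holomorphic functions on normed spaces *)

Section SeveralVariables.
Variable R : realType.
Local Notation C := (complex_field R).
Variable V : normedModType C.
Implicit Types (p q h k : V) (f g u v : V -> C).

Lemma cder_shift (f : C -> C) (t a : C) :
  cder (fun s => f (s + t)) 0 a -> cder f t a.
Proof.
move=> h e e0; have [d d0 hd] := h e e0; exists d => // x xd.
by have := hd x xd; rewrite !add0r [t + x]addrC.
Qed.

Lemma differentiable_line f p h (t : C) : differentiable f (p + t *: h) ->
  differentiable (fun s : C => f (p + s *: h)) t.
Proof.
move=> df; apply: (@cder_differentiable _ _ _ ('d f (p + t *: h) h)) => e e0.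
have h1 : 0 < nrm h + 1 by rewrite ltr_wpDl ?nrm_ge0.
have [d d0 hd] := differentiable_nrmP df (divr_gt0 e0 h1).
exists (d / (nrm h + 1)); first by rewrite divr_gt0.
move=> s; rewrite ltr_pdivlMr // => sd.
have sh : nrm (s *: h) < d.
  by rewrite nrmZ; apply: le_lt_trans sd; rewrite ler_wpM2l ?nrm_ge0 // lerDl.
have e2 : 'd f (p + t *: h) (s *: h) = 'd f (p + t *: h) h * s by rewrite linearZ mulrC.
have := hd _ sh; rewrite e2 nrmZ scalerDl addrA => h2.
apply: (le_trans h2); rewrite mulrCA mulrC ler_wpM2r ?nrm_ge0 //.
by rewrite mulrAC ler_pdivrMr // ler_wpM2l ?ltW // ltrDl.
Qed.

(** Restriction to the complex lines through [p] reduces this to one variable. *)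
Lemma zero_ball f p (rho d : R) : 0 < d ->
  (forall x, nrm (x - p) < rho -> differentiable f x) ->
  (forall x, nrm (x - p) < d -> f x = 0) ->
  forall x, nrm (x - p) < rho / 2 -> f x = 0.
Proof.
move=> d0 df f0 x xr; set h := x - p in xr.
have [hz|hn] := eqVneq h 0; first by apply: f0; rewrite -/h hz nrm0.
have hp : 0 < nrm h by rewrite nrm_gt0.
have -> : x = p + 1 *: h by rewrite scale1r addrC subrK.
have line (s : C) : nrm (p + s *: h - p) = nrm s * nrm h by rewrite addrAC subrr add0r nrmZ.
apply: (@zero_near_zero R (fun s : C => f (p + s *: h)) (rho / nrm h) (d / nrm h)).
- by rewrite divr_gt0.
- move=> z; rewrite ltr_pdivlMr // => zr; apply: differentiable_line.
  by apply: df; rewrite line.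
- by move=> z; rewrite ltr_pdivlMr // => zr; apply: f0; rewrite line.
- by rewrite nrm1 mulrAC ltr_pdivlMr // mul1r.
Qed.

(** If [f y != 0] near [p], then [g] vanishes near [y], hence around [p] by the
    identity theorem on a ball with centre [y]. *)
Lemma mul_zero_ball f g p (rho : R) : 0 < rho ->
  (forall x, nrm (x - p) < rho -> differentiable f x) ->
  (forall x, nrm (x - p) < rho -> differentiable g x) ->
  (forall x, nrm (x - p) < rho -> f x * g x = 0) ->
  (forall x, nrm (x - p) < rho / 8 -> f x = 0) \/
  (forall x, nrm (x - p) < rho / 8 -> g x = 0).
Proof.
move=> r0 df dg fg.
have [f0|nf] := pselect (forall x, nrm (x - p) < rho / 4 -> f x = 0).
  by left=> x xr; apply: f0; lra.
right.
have [y [yr fy]] : exists y, nrm (y - p) < rho / 4 /\ f y != 0.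
  apply: contrapT => no; apply: nf => x xr; apply/eqP/negPn/negP => fx.
  by apply: no; exists x.
have yr' : nrm (y - p) < rho by lra.
have [d d0 hd] := (nrm_continuousP f y).1 (diff_cont (df y yr')) (nrm (f y)) ltac:(by rewrite nrm_gt0).
have dgy x : nrm (x - y) < rho * 3 / 4 -> differentiable g x.
  by move=> xy; apply: dg; have := nrm_tri x y p; lra.
have g0 x : nrm (x - y) < Num.min d (rho / 2) -> g x = 0.
  rewrite lt_min => /andP[x1 x2].
  have xp : nrm (x - p) < rho by have := nrm_tri x y p; lra.
  have fx : f x != 0.
    apply/negP => /eqP fx; have := hd _ x1; rewrite [y + _]addrC subrK fx sub0r.
    by rewrite nrmN ltxx.
  by have /eqP := fg x xp; rewrite mulf_eq0 (negbTE fx) => /eqP.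
have d1 : 0 < Num.min d (rho / 2) by rewrite lt_min d0 divr_gt0.
move=> x xr; apply: (zero_ball d1 dgy g0).
have := nrm_tri x p y; rewrite [nrm (p - y)]nrmC; lra.
Qed.

Lemma differentiable_lip f p : differentiable f p -> f p = 0 ->
  exists2 K : R, 0 < K & exists2 d : R, 0 < d &
    forall h, nrm h < d -> nrm (f (p + h)) <= K * nrm h.
Proof.
move=> df f0; have cd : continuous 'd f p by have [] := (diff_locallyP p f).1 df.
have [k k0 hk] := linear_lipschitz cd.
have kR : k = (complex.Re k)%:C%C by rewrite RRe_real // gtr0_real.
have K0 : 0 < complex.Re k by rewrite -ltcR -kR.
have [d d0 hd] := differentiable_nrmP df ltr01.
exists (complex.Re k + 1); first by rewrite addr_gt0.
exists d => // h hh; have := hd h hh; rewrite f0 subr0 mul1r => h1.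
rewrite -[f (p + h)](subrK ('d f p h)); apply: le_trans (nrmD _ _) _.
rewrite mulrDl mul1r addrC lerD //.
by have := hk h; rewrite !nrmE kR -rmorphM lecR.
Qed.

(** Used to show that a function glued from pieces is holomorphic at the points
    where the pieces meet: those are zeros of some [f], of second order for
    [g]. *)
Lemma differentiable_square_bound f g p (K d0 : R) : 0 < d0 ->
  differentiable f p -> f p = 0 ->
  (forall x, nrm (x - p) < d0 -> nrm (g x) <= K * nrm (f x) ^+ 2) ->
  differentiable g p.
Proof.
move=> d0_gt0 df f0 gK.
have [L L0 [d d_gt0 hd]] := differentiable_lip df f0.
have gp : g p = 0.
  apply: nrm_le0.
  by have := gK p; rewrite subrr nrm0 f0 nrm0 expr0n mulr0; apply.
have K1 : 0 < `|K| + 1 by rewrite ltr_wpDl.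
have lin0 : linear (fun=> 0 : C) by move=> a x y; rewrite scaler0 addr0.
apply: (@nrmP_differentiable _ _ g p (linear_of (lin0 V)) 0).
  by move=> h /=; rewrite nrm0 mul0r.
move=> e e0; pose m := (`|K| + 1) * L ^+ 2.
have m0 : 0 < m by rewrite mulr_gt0 // exprn_gt0.
exists (Num.min (Num.min d0 d) (e / m)); first by rewrite !lt_min d0_gt0 d_gt0 divr_gt0.
move=> h; rewrite !lt_min => /andP[/andP[h1 h2]]; rewrite ltr_pdivlMr // => h3.
rewrite gp !subr0; apply: le_trans (gK (p + h) _) _; first by rewrite addrAC subrr add0r.
have hf := hd h h2; have nf := nrm_ge0 (f (p + h)); have nh := nrm_ge0 h.
have sq : nrm (f (p + h)) ^+ 2 <= (L * nrm h) ^+ 2.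
  by rewrite lerXn2r // nnegrE mulr_ge0 // ltW.
apply: (@le_trans _ _ ((`|K| + 1) * (L * nrm h) ^+ 2)).
  have KK : K <= `|K| + 1 by apply: le_trans (ler_norm K) _; rewrite lerDl.
  by apply: (le_trans (ler_wpM2r (sqr_ge0 _) KK)); rewrite ler_wpM2l // ltW.
have -> : (`|K| + 1) * (L * nrm h) ^+ 2 = (nrm h * m) * nrm h by rewrite /m; ring.
by rewrite ler_wpM2r // ltW.
Qed.

End SeveralVariables.

(** * Bounded functions that are holomorphic on lines *)

Section Gateaux.
Variable R : realType.
Local Notation C := (complex_field R).
Variable V : normedModType C.
Implicit Types (p q h k : V) (f g u v b : V -> C).

Variables (b : V -> C) (p : V) (rho M : R).
Hypothesis rho0 : 0 < rho.
Hypothesis line_b : forall q h (t : C), nrm (q + t *: h - p) < rho ->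
  differentiable (fun s : C => b (q + s *: h)) t.
Hypothesis bM : forall x, nrm (x - p) < rho -> nrm (b x) <= M.

(** The derivative of [b] at [p] in the direction [h] is [c], with a remainder of
    second order as Schwarz's lemma provides. *)
Let dir h (c : C) := exists2 K : R, 0 <= K & exists2 d : R, 0 < d &
  forall t : C, nrm t < d -> nrm (b (p + t *: h) - b p - c * t) <= K * nrm t ^+ 2.

Let M_ge0 : 0 <= M.
Proof. by apply: le_trans (bM (x := p) _); rewrite ?nrm_ge0 // subrr nrm0. Qed.

Let pos_quot (c r : R) : 0 <= c -> 0 <= c * M / r ^+ 2.
Proof. by move=> c0; apply: divr_ge0; [apply: mulr_ge0|apply: sqr_ge0]. Qed.

Let dir_uniq h c c' : dir h c -> dir h c' -> c = c'.
Proof.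
move=> [K K0 [d d0 hd]] [K' K'0 [d' d'0 hd']].
apply: subr0_eq; apply: nrm_le0.
apply: (@le_small _ _ (K + K') (Num.min d d')); first by rewrite lt_min d0.
move=> e /andP[e0]; rewrite lt_min => /andP[ed ed'].
have ne : nrm (rc e) = e by rewrite nrm_rc gtr0_norm.
have h1 := hd (rc e); rewrite ne in h1; have {}h1 := h1 ed.
have h2 := hd' (rc e); rewrite ne in h2; have {}h2 := h2 ed'.
rewrite -(ler_pM2r e0) -{1}ne -nrmM.
set x := b _ - b p in h1 h2.
have -> : (c - c') * rc e = (x - c' * rc e) - (x - c * rc e) by ring.
apply: le_trans (nrmB _ _) _; have := lerD h2 h1.
by have -> : K' * e ^+ 2 + K * e ^+ 2 = e * (K + K') * e by ring.
Qed.

Let line_nrm h (t : C) : nrm (p + t *: h - p) = nrm t * nrm h.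
Proof. by rewrite addrAC subrr add0r nrmZ. Qed.

Let dir_strong h : h != 0 -> exists c, forall t : C, nrm t <= rho / nrm h / 4 ->
  nrm (b (p + t *: h) - b p - c * t) <= 8 * M / (rho / nrm h) ^+ 2 * nrm t ^+ 2.
Proof.
move=> h0; have hp : 0 < nrm h by rewrite nrm_gt0.
have r0 : 0 < rho / nrm h by rewrite divr_gt0.
have [||c hc] := @bounded_taylor2 R (fun t : C => b (p + t *: h)) (rho / nrm h) M r0.
- by move=> z; rewrite ltr_pdivlMr // => zr; apply: line_b; rewrite line_nrm.
- by move=> z; rewrite ltr_pdivlMr // => zr; apply: bM; rewrite line_nrm.
exists c => t ht; have [_] := hc t ht.
by rewrite scale0r addr0.
Qed.

Let dir_ex h : exists c, dir h c.
Proof.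
have [->|h0] := eqVneq h 0.
  exists 0, 0 => //; exists 1 => // t _.
  by rewrite scaler0 addr0 subrr sub0r mul0r nrmN nrm0 mul0r.
have [c hc] := dir_strong h0; exists c.
have hp : 0 < nrm h by rewrite nrm_gt0.
exists (8 * M / (rho / nrm h) ^+ 2).
  by apply: pos_quot.
exists (rho / nrm h / 4); first by rewrite !divr_gt0.
by move=> t /ltW; exact: hc.
Qed.

Let dirZ a h c : dir h c -> dir (a *: h) (a * c).
Proof.
move=> [K K0 [d d0 hd]].
have a1 : 0 < nrm a + 1 by rewrite ltr_wpDl ?nrm_ge0.
exists (K * nrm a ^+ 2); first by apply: mulr_ge0; [exact: K0|exact: sqr_ge0].
exists (d / (nrm a + 1)); first by rewrite divr_gt0.
move=> t; rewrite ltr_pdivlMr // => ht.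
have ta : nrm (t * a) < d.
  by rewrite nrmM; apply: le_lt_trans ht; rewrite ler_wpM2l ?nrm_ge0 // lerDl.
have := hd _ ta; rewrite scalerA nrmM.
have -> : c * (t * a) = a * c * t by ring.
by have -> : K * (nrm t * nrm a) ^+ 2 = K * nrm a ^+ 2 * nrm t ^+ 2 by ring.
Qed.

(** Schwarz's lemma is applied to [b (p + s h + t k)] in [t], then in [s]. *)
Let second_difference h k : exists2 K : R, 0 <= K & exists2 d : R, 0 < d &
  forall t : C, nrm t < d ->
  nrm (b (p + t *: h + t *: k) - b (p + t *: h) - b (p + t *: k) + b p) <= K * nrm t ^+ 2.
Proof.
pose l := nrm h + nrm k + 1.
have l0 : 0 < l by rewrite ltr_wpDl // addr_ge0 ?nrm_ge0.
pose s := rho / l; have s0 : 0 < s by rewrite divr_gt0.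
have inB (x y : C) : nrm x < s -> nrm y < s -> nrm (p + x *: h + y *: k - p) < rho.
  rewrite /s !ltr_pdivlMr // => x1 y1.
  have -> : p + x *: h + y *: k - p = x *: h + y *: k by rewrite addrAC [p + _ - p]addrAC subrr add0r.
  apply: le_lt_trans (nrmD _ _) _; rewrite !nrmZ.
  have := nrm_ge0 h; have := nrm_ge0 k; have := nrm_ge0 x; have := nrm_ge0 y.
  move: x1 y1; rewrite /l; set a := nrm h; set c := nrm k; set x' := nrm x; set y' := nrm y.
  move=> x1 y1 y0 x0 c0 a0.
  have [xy|xy] := lerP x' y'.
    by apply: le_lt_trans y1; nra.
  by apply: le_lt_trans x1; nra.
have first (x y : C) : nrm x < s -> nrm y <= s / 4 ->
    nrm (b (p + x *: h + y *: k) - b (p + x *: h)) <= 4 * M / s * nrm y.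
  move=> x1 y1.
  have [||c hc] := @bounded_taylor2 R (fun y : C => b (p + x *: h + y *: k)) s M s0.
  - by move=> z zs; apply: line_b; apply: inB.
  - by move=> z zs; apply: bM; apply: inB.
  by have [] := hc y y1; rewrite scale0r addr0.
exists (16 * M / s ^+ 2); first by apply: pos_quot.
exists (s / 4); first by rewrite divr_gt0.
move=> t ts; have ts' : nrm t <= s / 4 by exact: ltW.
have [||c hc] := @bounded_taylor2 R (fun x : C => b (p + t *: k + x *: h) - b (p + x *: h))
    s (4 * M / s * nrm t) s0.
- move=> z zs; apply: diff_sub; apply: line_b.
    by rewrite [p + t *: k + _]addrAC; apply: inB => //; lra.
  by have := inB z 0 zs; rewrite scale0r addr0 nrm0; apply.
- by move=> z zs; rewrite [p + t *: k + _]addrAC; apply: first.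
have [+ _] := hc t ts'; rewrite scale0r !addr0 [p + t *: k + _]addrAC opprB => h1.
have {h1} : nrm (b (p + t *: h + t *: k) - b (p + t *: h) - b (p + t *: k) + b p) <=
   4 * (4 * M / s * nrm t) / s * nrm t.
  apply: le_trans h1; rewrite le_eqVlt; apply/orP; left; apply/eqP; congr nrm.
  by ring.
by have -> : 4 * (4 * M / s * nrm t) / s * nrm t = 16 * M / s ^+ 2 * nrm t ^+ 2;
  [field; rewrite lt0r_neq0|].
Qed.

Let dirD h k c c' : dir h c -> dir k c' -> dir (h + k) (c + c').
Proof.
move=> [K K0 [d d0 hd]] [K' K'0 [d' d'0 hd']].
have [K2 K20 [d2 d20 hd2]] := second_difference h k.
exists (K + K' + K2); first by rewrite !addr_ge0.
exists (Num.min (Num.min d d') d2); first by rewrite !lt_min d0 d'0.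
move=> t; rewrite !lt_min => /andP[/andP[/hd h1 /hd' h2] /hd2 h3].
rewrite scalerDr addrA.
move: h1 h2 h3; move: (b (p + t *: h + _)) (b (p + t *: h)) (b (p + t *: k)) (b p).
move=> x y z w h1 h2 h3.
have -> : x - w - (c + c') * t = (y - w - c * t) + (z - w - c' * t) + (x - y - z + w) by ring.
apply: le_trans (nrmD _ _) _; rewrite mulrDl; apply: lerD => //.
by apply: le_trans (nrmD _ _) _; rewrite mulrDl; apply: lerD.
Qed.

(** The directional derivatives [D h] exist by Schwarz's lemma on lines, with a
    remainder that is uniform in [h] because [b] is bounded.  [D] is
    additive because the second differences of [b] are [O(|t| ^ 2)]. *)
Lemma gateaux_differentiable : differentiable b p.
Proof.
have [D hD] := choice dir_ex.
have Dlin : linear D.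
  move=> a h k; apply: (dir_uniq (hD _)); apply: dirD; last exact: hD.
  by apply: dirZ; exact: hD.
have strong h : nrm h <= rho / 4 ->
    nrm (b (p + h) - b p - D h) <= 8 * M / rho ^+ 2 * nrm h ^+ 2.
  move=> hr; have [h0|h0] := eqVneq h 0.
    have -> : D h = 0 by rewrite h0; exact: (linear0 (linear_of Dlin)).
    by rewrite h0 addr0 subrr subr0 !nrm0 expr0n mulr0.
  have hp : 0 < nrm h by rewrite nrm_gt0.
  have [c hc] := dir_strong h0.
  have cD : c = D h.
    apply: (dir_uniq _ (hD h)); exists (8 * M / (rho / nrm h) ^+ 2).
      by apply: pos_quot.
    exists (rho / nrm h / 4); first by rewrite !divr_gt0.
    by move=> t /ltW; exact: hc.
  have := hc 1; rewrite scale1r cD mulr1 nrm1 expr1n mulr1.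
  have -> : 8 * M / (rho / nrm h) ^+ 2 = 8 * M / rho ^+ 2 * nrm h ^+ 2.
    by field; rewrite !lt0r_neq0.
  by apply; rewrite mulrAC ler_pdivlMr // mul1r.
have Dbound h : nrm (D h) <= 10 * M / rho * nrm h.
  have [h0|h0] := eqVneq h 0.
    have -> : D h = 0 by rewrite h0; exact: (linear0 (linear_of Dlin)).
    by rewrite h0 !nrm0 mulr0.
  have hp : 0 < nrm h by rewrite nrm_gt0.
  pose t := rho / nrm h / 4; have t0 : 0 < t by rewrite !divr_gt0.
  have nt : nrm (rc t) = t by rewrite nrm_rc gtr0_norm.
  have th : nrm (rc t *: h) = rho / 4 by rewrite nrmZ nt /t; field; rewrite lt0r_neq0.
  have := strong (rc t *: h); rewrite th => /(_ (lexx _)).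
  have -> : D (rc t *: h) = rc t * D h by exact: (dir_uniq (hD _) (dirZ _ (hD h))).
  set x := b _ - b p => hx.
  have nx : nrm x <= 2 * M.
    apply: le_trans (nrmB _ _) _; have -> : 2 * M = M + M by ring.
    apply: lerD; apply: bM; last by rewrite subrr nrm0.
    by rewrite addrAC subrr add0r th ltr_pdivrMr // ltr_pMr // ltr1n.
  rewrite -(ler_pM2l t0) -{1}nt -nrmM.
  have -> : rc t * D h = x - (x - rc t * D h) by ring.
  apply: le_trans (nrmB _ _) _; apply: le_trans (lerD nx hx) _.
  have -> : 8 * M / rho ^+ 2 * (rho / 4) ^+ 2 = M / 2 by field; rewrite lt0r_neq0.
  have -> : t * (10 * M / rho * nrm h) = 10 * M / 4 by rewrite /t; field; rewrite !lt0r_neq0.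
  by suff -> : 2 * M + M / 2 = 10 * M / 4; [rewrite lexx|field].
apply: (@nrmP_differentiable _ _ b p (linear_of Dlin) (10 * M / rho)).
  exact: Dbound.
move=> e e0; pose K := 8 * M / rho ^+ 2.
have K0 : 0 <= K by apply: pos_quot.
have K1 : 0 < K + 1 by rewrite ltr_wpDl.
exists (Num.min (rho / 4) (e / (K + 1))); first by rewrite lt_min divr_gt0 // divr_gt0.
move=> h; rewrite lt_min => /andP[h1]; rewrite ltr_pdivlMr // => h2.
apply: le_trans (strong h (ltW h1)) _; rewrite -/K expr2 mulrA ler_wpM2r ?nrm_ge0 //.
by apply: (le_trans _ (ltW h2)); rewrite mulrC ler_wpM2l ?nrm_ge0 // lerDl.
Qed.

End Gateaux.

(** * Normality for equations of degree two *)

Section Quotient.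
Variable R : realType.
Local Notation C := (complex_field R).
Variable V : normedModType C.
Implicit Types (p q h k : V) (f g u v b : V -> C).

Lemma near_eq_differentiable f g p (d : R) : 0 < d ->
  (forall x, nrm (x - p) < d -> f x = g x) ->
  differentiable f p -> differentiable g p.
Proof.
by move=> d0 h; apply: near_differentiable; apply/near_nrmP; exists d.
Qed.

Lemma nonzero_near f p : differentiable f p -> f p != 0 ->
  exists2 d : R, 0 < d & forall x, nrm (x - p) < d -> f x != 0.
Proof.
move=> df fp.
have [d d0 hd] := (nrm_continuousP f p).1 (diff_cont df) (nrm (f p)) ltac:(by rewrite nrm_gt0).
exists d => // x xd; apply/negP => /eqP fx; have := hd _ xd.
by rewrite [p + _]addrC subrK fx sub0r nrmN ltxx.
Qed.

(** Where [u != 0], [b = v / u] has square [u] and cube [v]; with value [0] at the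
    zeros of [u] this holds everywhere.  So [b] is bounded, and it is holomorphic
    on lines by the one variable case. *)
Lemma cusp_quotient u v p (rho : R) : 0 < rho ->
  (forall x, nrm (x - p) < rho -> differentiable u x) ->
  (forall x, nrm (x - p) < rho -> differentiable v x) ->
  (forall x, nrm (x - p) < rho -> v x ^+ 2 = u x ^+ 3) ->
  exists b, exists2 d : R, 0 < d & forall x, nrm (x - p) < d ->
    differentiable b x /\ b x * u x = v x.
Proof.
move=> r0 du dv uv.
pose b x := if u x == 0 then 0 else v x / u x.
have b2 x : nrm (x - p) < rho -> b x ^+ 2 = u x.
  move=> xr; rewrite /b; case: eqP => [->|/eqP u0]; first by rewrite expr0n.
  by rewrite expr_div_n uv // exprSr mulrAC divff ?mul1r // expf_neq0.
have b3 x : nrm (x - p) < rho -> b x ^+ 3 = v x.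
  move=> xr; rewrite /b; case: eqP => [u0|/eqP u0].
    have v0 : v x = 0.
      by have /eqP := uv x xr; rewrite u0 expr0n expf_eq0 => /eqP.
    by rewrite v0 expr0n.
  by rewrite expr_div_n exprS uv // mulfK // expf_neq0.
have bu x : nrm (x - p) < rho -> b x * u x = v x.
  by move=> xr; rewrite -b2 // -exprS b3.
have line q h (t : C) : nrm (q + t *: h - p) < rho ->
    differentiable (fun s : C => b (q + s *: h)) t.
  move=> xr; have [u0|u0] := eqVneq (u (q + t *: h)) 0; last first.
    have [d d0 hd] := nonzero_near (du _ xr) u0.
    apply: differentiable_line.
    apply: (@near_eq_differentiable (fun x => v x / u x) _ _ d d0) => [x xd|].
      by rewrite /b (negbTE (hd x xd)).
    by apply: diff_mul; [exact: dv|apply: diff_inv => //; exact: du].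
  set x0 := q + t *: h in xr u0.
  have h1 : 0 < nrm h + 1 by rewrite ltr_wpDl ?nrm_ge0.
  pose s := (rho - nrm (x0 - p)) / (nrm h + 1).
  have s0 : 0 < s by rewrite divr_gt0 // subr_gt0.
  have shiftE (z : C) : q + (z + t) *: h = x0 + z *: h.
    by rewrite /x0 scalerDl [z *: h + _]addrC addrA.
  have inB (z : C) : nrm z < s -> nrm (q + (z + t) *: h - p) < rho.
    rewrite /s ltr_pdivlMr // => zs.
    rewrite shiftE addrAC; apply: le_lt_trans (nrmD _ _) _; rewrite nrmZ.
    have := nrm_ge0 z; have := nrm_ge0 h; nra.
  have db : differentiable (fun z : C => b (q + (z + t) *: h)) 0.
    apply: (@cusp_one_variable R _ (fun z : C => u (q + (z + t) *: h))
      (fun z : C => v (q + (z + t) *: h)) s s0).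
    - move=> z zs; have -> : (fun z => u (q + (z + t) *: h)) = (fun z => u (x0 + z *: h)).
        by apply/funext => y; rewrite shiftE.
      by apply: differentiable_line; apply: du; rewrite -shiftE; exact: inB.
    - move=> z zs; have -> : (fun z => v (q + (z + t) *: h)) = (fun z => v (x0 + z *: h)).
        by apply/funext => y; rewrite shiftE.
      by apply: differentiable_line; apply: dv; rewrite -shiftE; exact: inB.
    - by move=> z zs; rewrite b2 //; exact: inB.
    - by move=> z zs; rewrite b3 //; exact: inB.
    - by rewrite add0r /b -/x0 u0 eqxx.
  by apply: cder_differentiable; apply: cder_shift; exact: (differentiable_cder db).
have pr : nrm (p - p) < rho by rewrite subrr nrm0.
have [d d0 hd] := (nrm_continuousP u p).1 (diff_cont (du p pr)) 1 ltr01.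
have bM x : nrm (x - p) < Num.min d rho -> nrm (b x) <= nrm (u p) + 2.
  rewrite lt_min => /andP[x1 x2].
  have := hd _ x1; rewrite [p + _]addrC subrK => h1.
  have h2 : nrm (u x) <= nrm (u p) + 1.
    by rewrite -[u x](subrK (u p)); apply: le_trans (nrmD _ _) _; rewrite addrC lerD2l ltW.
  have h3 : nrm (b x) ^+ 2 = nrm (u x) by rewrite -nrmX b2.
  have := nrm_ge0 (b x); have := nrm_ge0 (u p); nra.
exists b, (Num.min d rho / 2); first by rewrite divr_gt0 // lt_min d0.
set m := Num.min d rho in bM *.
have m0 : 0 < m by rewrite lt_min d0.
have mr : m <= rho by rewrite ge_min lexx orbT.
move=> x xm; split; last by apply: bu; lra.
apply: (@gateaux_differentiable R V b x (m / 2) (nrm (u p) + 2)).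
- by rewrite divr_gt0.
- move=> q h t ht; apply: line; have := nrm_tri (q + t *: h) x p; lra.
- by move=> y yx; apply: bM; have := nrm_tri y x p; lra.
Qed.

(** The quotient [b = v / u], set to [0] at the zeros of [u], is a root of
    [X ^ 2 - c X - u].  Being far from [c], it satisfies [|b| <= K |u|]; so at a
    zero of [u] the equation [c b = b ^ 2 - u] expresses [b] through a
    function dominated by [u ^ 2]. *)
Lemma small_root_quotient (c : C) u v p (rho : R) : c != 0 -> 0 < rho ->
  (forall x, nrm (x - p) < rho -> differentiable u x) ->
  (forall x, nrm (x - p) < rho -> differentiable v x) ->
  (forall x, nrm (x - p) < rho -> v x ^+ 2 - c * u x * v x = u x ^+ 3) ->
  (forall x, nrm (x - p) < rho -> u x != 0 -> nrm (v x / u x) < nrm c / 2) ->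
  exists b, forall x, nrm (x - p) < rho -> differentiable b x /\ b x * u x = v x.
Proof.
move=> c0 r0 du dv uv small; have cp : 0 < nrm c by rewrite nrm_gt0.
pose b x := if u x == 0 then 0 else v x / u x.
have bu x : nrm (x - p) < rho -> b x * u x = v x.
  move=> xr; rewrite /b; case: eqP => [u0|/eqP u0]; last by rewrite mulfVK.
  have /eqP := uv x xr; rewrite u0 mulr0 mul0r subr0 expr0n expf_eq0 => /eqP ->.
  by rewrite mul0r.
have beq x : nrm (x - p) < rho -> b x ^+ 2 - c * b x = u x.
  move=> xr; rewrite /b; case: eqP => [->|/eqP u0]; first by rewrite expr0n mulr0 subr0.
  have -> : (v x / u x) ^+ 2 - c * (v x / u x) = (v x ^+ 2 - c * u x * v x) / u x ^+ 2.
    by field.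
  by rewrite uv // exprSr mulrAC divff ?mul1r // expf_neq0.
have bE x : nrm (x - p) < rho -> b x = c^-1 * b x ^+ 2 - c^-1 * u x.
  by move=> /beq <-; field.
have bs x : nrm (x - p) < rho -> nrm (b x) < nrm c / 2.
  move=> xr; have := small x xr; rewrite /b; case: eqP => [_ _|/eqP u0]; last exact.
  by rewrite nrm0 divr_gt0.
have bK x : nrm (x - p) < rho -> nrm (b x) <= 2 / nrm c * nrm (u x).
  move=> xr; have h := bs x xr.
  have E : nrm (b x) * nrm (b x - c) = nrm (u x).
    by rewrite -nrmM -beq //; congr nrm; ring.
  have far : nrm c / 2 <= nrm (b x - c).
    by have := nrmD (b x - c) (- b x); rewrite addrC addKr !nrmN; lra.
  rewrite -E mulrAC ler_pdivlMr //.
  by have := nrm_ge0 (b x); nra.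
exists b => x xr; split; last exact: bu.
have [u0|u0] := eqVneq (u x) 0; last first.
  have [d d0 hd] := nonzero_near (du _ xr) u0.
  apply: (@near_eq_differentiable (fun x => v x / u x) _ _ d d0) => [y yd|].
    by rewrite /b (negbTE (hd y yd)).
  by apply: diff_mul; [exact: dv|apply: diff_inv => //; exact: du].
have rx : 0 < rho - nrm (x - p) by rewrite subr_gt0.
apply: (@near_eq_differentiable (fun y => c^-1 * b y ^+ 2 - c^-1 * u y) _ _ _ rx).
  by move=> y yx; rewrite -bE //; have := nrm_tri y x p; lra.
apply: diff_sub; last by apply: diff_mul; [exact: diff_cst|exact: du].
apply: diff_mul; first exact: diff_cst.
apply: (differentiable_square_bound (K := (2 / nrm c) ^+ 2) rx (du x xr) u0).
move=> y yx; have yr : nrm (y - p) < rho by have := nrm_tri y x p; lra.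
rewrite nrmX -exprMn lerXn2r // ?nnegrE ?nrm_ge0 //; last exact: bK.
by rewrite mulr_ge0 ?nrm_ge0 // divr_ge0 // ltW.
Qed.

(** The hypothesis says that [v / u] satisfies the monic equation
    [X ^ 2 - c X - u = 0] with holomorphic coefficients, so this is a case of the
    normality of the ring of holomorphic germs.  When [c != 0], the root is close
    to [0] or to [c] near a zero of [u], and [E] is [u ^ 2] where the first
    happens and zero elsewhere.  Both [E] and [E - u ^ 2] are holomorphic with
    product zero, so one of them vanishes and the same case holds at all points;
    the second case reduces to the first by exchanging [b] and [c - b]. *)
Lemma local_quotient (c : C) u v p (rho : R) : 0 < rho ->
  (forall x, nrm (x - p) < rho -> differentiable u x) ->
  (forall x, nrm (x - p) < rho -> differentiable v x) ->
  (forall x, nrm (x - p) < rho -> v x ^+ 2 - c * u x * v x = u x ^+ 3) ->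
  exists b, exists2 d : R, 0 < d & forall x, nrm (x - p) < d ->
    differentiable b x /\ b x * u x = v x.
Proof.
move=> r0 du dv uv.
have [c0|c0] := eqVneq c 0.
  apply: (cusp_quotient r0 du dv) => x xr.
  by rewrite -uv // c0 !mul0r subr0.
have cp : 0 < nrm c by rewrite nrm_gt0.
have pr : nrm (p - p) < rho by rewrite subrr nrm0.
have [up|up] := eqVneq (u p) 0; last first.
  have [d d0 hd] := nonzero_near (du p pr) up.
  exists (fun x => v x / u x), (Num.min d rho); first by rewrite lt_min d0.
  move=> x; rewrite lt_min => /andP[x1 x2]; have ux := hd x x1; split.
    by apply: diff_mul; [exact: dv|apply: diff_inv => //; exact: du].
  by rewrite mulfVK.
have e0 : 0 < (nrm c / 2) ^+ 2 by rewrite exprn_gt0 // divr_gt0.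
have [d d0 hd] := (nrm_continuousP u p).1 (diff_cont (du p pr)) _ e0.
pose m := Num.min d rho; have m0 : 0 < m by rewrite lt_min d0.
have mB x : nrm (x - p) < m -> nrm (x - p) < rho by rewrite lt_min => /andP[].
have us x : nrm (x - p) < m -> nrm (u x) < (nrm c / 2) ^+ 2.
  by rewrite lt_min => /andP[x1 _]; have := hd _ x1; rewrite [p + _]addrC subrK up subr0.
pose q x := v x / u x.
have qE x : nrm (x - p) < m -> u x != 0 -> q x * (q x - c) = u x.
  move=> xm u0; have -> : q x * (q x - c) = (v x ^+ 2 - c * u x * v x) / u x ^+ 2.
    by rewrite /q; field.
  by rewrite uv ?mB // exprSr mulrAC divff ?mul1r // expf_neq0.
have alt x : nrm (x - p) < m -> u x != 0 -> nrm c / 2 <= nrm (q x) -> nrm (q x - c) < nrm c / 2.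
  move=> xm u0 h; rewrite ltNge; apply/negP => h'; have := us x xm.
  by rewrite -(qE x xm u0) nrmM ltNge expr2 ler_pM // ltW // divr_gt0.
have far x : nrm (q x - c) < nrm c / 2 -> nrm c / 2 < nrm (q x).
  by move=> h; have := nrmD (q x - c) (- q x); rewrite addrC addKr !nrmN; lra.
have dq x : nrm (x - p) < m -> u x != 0 -> differentiable q x.
  move=> xm u0; apply: diff_mul; first by apply: dv; exact: mB.
  by apply: diff_inv => //; apply: du; exact: mB.
pose E x := if (u x != 0) && (nrm (q x) < nrm c / 2) then u x ^+ 2 else 0.
have dE x : nrm (x - p) < m -> differentiable E x.
  move=> xm; have [u0|u0] := eqVneq (u x) 0.
    apply: (@differentiable_square_bound R V u E x 1 1 ltr01 (du x (mB x xm)) u0).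
    move=> y _; rewrite mul1r /E; case: ifP => _; first by rewrite nrmX.
    by rewrite nrm0 sqr_ge0.
  have [d1 d10 hd1] := nonzero_near (du x (mB x xm)) u0.
  have cq := diff_cont (dq x xm u0).
  have [qs|qb] := ltP (nrm (q x)) (nrm c / 2).
    have q1 : 0 < nrm c / 2 - nrm (q x) by rewrite subr_gt0.
    have [d2 d20 hd2] := (nrm_continuousP q x).1 cq _ q1.
    apply: (@near_eq_differentiable (fun y => u y ^+ 2) E x (Num.min d1 d2)).
    - by rewrite lt_min d10.
    - move=> y; rewrite lt_min => /andP[/hd1 y1 y2]; rewrite /E y1 /=.
      have := hd2 _ y2; rewrite [x + _]addrC subrK => h.
      by rewrite ifT //; have := nrmD (q y - q x) (q x); rewrite subrK; lra.
    - by apply: diff_exp; apply: du; exact: mB.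
  have q1 : 0 < nrm c / 2 - nrm (q x - c) by rewrite subr_gt0 alt.
  have [d2 d20 hd2] := (nrm_continuousP q x).1 cq _ q1.
  apply: (@near_eq_differentiable (fun=> 0) E x d2 d20); last exact: diff_cst.
  move=> y /hd2; rewrite [x + _]addrC subrK => h.
  rewrite /E ifF //; apply/negP => /andP[_ h2].
  have : nrm c / 2 < nrm (q y).
    by apply: far; have := nrmD (q y - q x) (q x - c); rewrite addrA subrK; lra.
  by rewrite ltNge ltW.
have [||E0|E0] := @mul_zero_ball R V E (fun x => E x - u x ^+ 2) p m m0 dE.
- by move=> x xm; apply: diff_sub; [exact: dE|apply: diff_exp; apply: du; exact: mB].
- by move=> x xm; rewrite /E; case: ifP => _; rewrite ?mul0r // subrr mulr0.
- (* the root is close to c; use the other root *)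
  have m8 : 0 < m / 8 by rewrite divr_gt0.
  have in8 x : nrm (x - p) < m / 8 -> nrm (x - p) < m by lra.
  have [||||b hb] := @small_root_quotient c u (fun x => c * u x - v x) p (m / 8) c0 m8.
  + by move=> x /in8/mB; exact: du.
  + move=> x /in8/mB xr; apply: diff_sub; last exact: dv.
    by apply: diff_mul; [exact: diff_cst|exact: du].
  + by move=> x /in8/mB xr; rewrite -uv //; ring.
  + move=> x x8 u0; have := E0 x x8; rewrite /E u0 /=.
    have xm := in8 x x8; case: ltP => [_ /eqP|qb _]; first by rewrite expf_eq0 (negbTE u0).
    have := alt x xm u0 qb; rewrite nrmC; congr (nrm _ < _).
    by rewrite /q; field.
  exists (fun x => c - b x), (m / 8) => // x x8; have [db be] := hb x x8; split.
    by apply: diff_sub => //; exact: diff_cst.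
  by rewrite mulrBl be; ring.
have m8 : 0 < m / 8 by rewrite divr_gt0.
have in8 x : nrm (x - p) < m / 8 -> nrm (x - p) < m by lra.
have [||||b hb] := @small_root_quotient c u v p (m / 8) c0 m8.
- by move=> x /in8/mB; exact: du.
- by move=> x /in8/mB; exact: dv.
- by move=> x /in8/mB; exact: uv.
- move=> x x8 u0; have := E0 x x8; rewrite /E u0 /=; case: ltP => // _ /eqP.
  by rewrite sub0r oppr_eq0 expf_eq0 (negbTE u0).
by exists b, (m / 8).
Qed.

End Quotient.

(** * Holomorphic functions on a manifold *)

Local Notation coord := Defs.coord.

Section Manifold.
Variables (R : realType) (n : nat).
Local Notation C := (complex_field R).
Variable X : complexManifold R n.
Implicit Types (phi psi : chart R n X) (x y : X) (f g h : X -> C).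

Definition cball phi x (r : R) : set X :=
  [set y | dom phi y /\ nrm (coord phi y - coord phi x) < r].

Lemma cball_open phi x r : open (cball phi x r).
Proof.
rewrite openE => y [Dy yr]; rewrite /interior.
have /= cy := Defs.coord_continuous Dy.
have h1 : \forall z \near y, dom phi z.
  by apply: open_nbhs_nbhs; split; [exact: opens_open|].
have h2 : \forall z \near y, nrm (coord phi z - coord phi x) < r.
  have e0 : 0 < r - nrm (coord phi y - coord phi x) by rewrite subr_gt0.
  have /cy : nbhs (coord phi y) [set w : 'rV[C]_n | nrm (w - coord phi x) < r].
    apply/(near_nrmP (V := 'rV[C]_n)); exists (r - nrm (coord phi y - coord phi x)) => //.
    by move=> w wy /=; have := nrm_tri w (coord phi y) (coord phi x); lra.
  by [].
by near=> z; split; near: z.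
Unshelve. all: by end_near. Qed.

Lemma cball_center phi x r : dom phi x -> 0 < r -> cball phi x r x.
Proof. by move=> Dx r0; split=> //; rewrite subrr nrm0. Qed.

(** [psi] is a local inverse of the chart with values in a prescribed open set;
    it carries statements on balls of the coordinate space to the manifold. *)
Lemma chart_ball phi x (O : set X) : dom phi x -> open O -> O x ->
  exists2 r : R, 0 < r & exists psi : 'rV[C]_n -> X,
    (forall z, nrm (z - coord phi x) < r ->
      [/\ O (psi z), dom phi (psi z) & coord phi (psi z) = z]) /\
    (forall y, cball phi x r y -> O y /\ psi (coord phi y) = y).
Proof.
move=> Dx oO Ox.
have oI : open (coord phi @` (O `&` dom phi)).
  by apply: Defs.coord_open; [apply: openI => //; exact: opens_open|move=> y []].
have : \forall z \near coord phi x, (coord phi @` (O `&` dom phi)) z.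
  by apply: open_nbhs_nbhs; split=> //; exists x.
move=> /near_nrmP[r r0 hr]; exists r => //.
have ex z : exists y, nrm (z - coord phi x) < r -> [/\ O y, dom phi y & coord phi y = z].
  have [zr|zr] := pselect (nrm (z - coord phi x) < r); last by exists x.
  by have [y [Oy Dy] yz] := hr z zr; exists y.
have [psi hpsi] := choice ex; exists psi; split=> // y [Dy yr].
have [Op Dp pE] := hpsi _ yr.
have E : psi (coord phi y) = y by apply: (Defs.coord_inj (c := phi)).
by split=> //; rewrite -E.
Qed.

(** Holomorphy at a point is defined for total functions on [X], whose algebra is
    free of restrictions; [holoAt_in] shows that the choice of chart is
    immaterial. *)
Definition holo_in phi f x : Prop := exists g : 'rV[C]_n -> C,
  exists2 r : R, 0 < r &
    (forall z, nrm (z - coord phi x) < r -> differentiable g z) /\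
    (forall y, cball phi x r y -> f y = g (coord phi y)).

Definition holoAt f x : Prop :=
  exists phi, [/\ @atlas R n X phi, dom phi x & holo_in phi f x].

Lemma holoAt_in f x phi : @atlas R n X phi -> dom phi x -> holoAt f x -> holo_in phi f x.
Proof.
move=> Aphi Dx [psi [Apsi Dx' [g [r r0 [dg fg]]]]].
have [t dt tE] := atlas_compatible Aphi Apsi.
have Oo : open (cball psi x r) by exact: cball_open.
have [s s0 [pp [hp1 hp2]]] := chart_ball Dx Oo (cball_center Dx' r0).
exists (g \o t), s => //; split=> [z zs|y ys].
  have [[D' pr] Dp pE] := hp1 z zs.
  apply: differentiable_comp; first by apply: dt; exists (pp z).
  have -> : t z = coord psi (pp z) by rewrite (tE _ Dp D') pE.
  exact: dg.
have [[D'y yr] _] := hp2 y ys; have [Dy _] := ys.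
by rewrite (fg y (conj D'y yr)) (tE _ Dy D'y).
Qed.

Lemma holo_inW phi f x : @atlas R n X phi -> dom phi x -> holo_in phi f x -> holoAt f x.
Proof. by move=> A D h; exists phi. Qed.

Lemma holo_in_shrink phi f x (r0 : R) : 0 < r0 -> holo_in phi f x ->
  exists g : 'rV[C]_n -> C, exists2 r : R, 0 < r <= r0 &
    (forall z, nrm (z - coord phi x) < r -> differentiable g z) /\
    (forall y, cball phi x r y -> f y = g (coord phi y)).
Proof.
move=> r0_gt0 [g [r r_gt0 [dg fg]]]; exists g, (Num.min r0 r).
  by rewrite lt_min r0_gt0 r_gt0 ge_min lexx.
by split=> [z|y [Dy]]; rewrite lt_min => /andP[_ h]; [exact: dg|apply: fg].
Qed.

Lemma holoAt_eq f g x (O : set X) : open O -> O x -> (forall y, O y -> f y = g y) ->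
  holoAt f x -> holoAt g x.
Proof.
move=> oO Ox fg hf; have [phi [A D _]] := hf.
apply: (holo_inW A D).
have [s s0 [pp [_ hp2]]] := chart_ball D oO Ox.
have [k [r /andP[r0 rs] [dk fk]]] := holo_in_shrink s0 (holoAt_in A D hf).
exists k, r => //; split=> // y yr; rewrite -fk // fg //.
by have [] // := hp2 y; case: yr => ? h; split=> //; exact: lt_le_trans h rs.
Qed.

Lemma holoAt_op2 (op : C -> C -> C) f g x :
  (forall (a b : 'rV[C]_n -> C) z, differentiable a z -> differentiable b z ->
    differentiable (fun w => op (a w) (b w)) z) ->
  holoAt f x -> holoAt g x -> holoAt (fun y => op (f y) (g y)) x.
Proof.
move=> dop hf hg; have [phi [A D [a [r r0 [da fa]]]]] := hf.
have [b [s /andP[s0 sr] [db gb]]] := holo_in_shrink r0 (holoAt_in A D hg).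
apply: (holo_inW A D); exists (fun w => op (a w) (b w)), s => //; split=> [z zs|y ys].
  by apply: dop; [apply: da; exact: lt_le_trans zs sr|exact: db].
rewrite gb // fa //; case: ys => Dy h; split=> //; exact: lt_le_trans h sr.
Qed.

Lemma holoAtD f g x : holoAt f x -> holoAt g x -> holoAt (fun y => f y + g y) x.
Proof. by apply: (holoAt_op2 (op := fun a b => a + b)) => a b z; exact: diff_add. Qed.

Lemma holoAtB f g x : holoAt f x -> holoAt g x -> holoAt (fun y => f y - g y) x.
Proof. by apply: (holoAt_op2 (op := fun a b => a - b)) => a b z; exact: diff_sub. Qed.

Lemma holoAtM f g x : holoAt f x -> holoAt g x -> holoAt (fun y => f y * g y) x.
Proof. by apply: (holoAt_op2 (op := fun a b => a * b)) => a b z; exact: diff_mul. Qed.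

Lemma holoAt_cst c x : holoAt (fun=> c) x.
Proof.
have [phi A D] := atlas_cover x; apply: (holo_inW A D).
by exists (fun=> c), 1 => //; split=> // z _; exact: diff_cst.
Qed.

Lemma holoAt_nonzero f x : holoAt f x -> f x != 0 ->
  exists2 O : set X, open O /\ O x & forall y, O y -> f y != 0.
Proof.
move=> [phi [A D [g [r r0 [dg fg]]]]] fx.
have xr := cball_center D r0.
have gx : g (coord phi x) != 0 by rewrite -fg.
have dgx : differentiable g (coord phi x) by apply: dg; rewrite subrr nrm0.
have [d d0 hd] := nonzero_near dgx gx.
exists (cball phi x (Num.min d r)).
  by split; [exact: cball_open|apply: cball_center => //; rewrite lt_min d0].
move=> y [Dy]; rewrite lt_min => /andP[y1 y2]; rewrite fg ?hd //.
Qed.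

(** The local form of the identity theorem.  The neighbourhood [N'] is fixed
    before the set [O] on which [f] is assumed to vanish, so the lemma applies
    when such sets are only known to accumulate at [x]. *)
Lemma zero_spread f x : holoAt f x -> exists N N' : set X,
  [/\ open N, N x, open N', N' x & forall (O : set X) y, open O -> N y -> O y ->
     (forall y', O y' -> f y' = 0) -> forall y', N' y' -> f y' = 0].
Proof.
move=> [phi [A Dx [g [r r0 [dg fg]]]]].
exists (cball phi x (r / 4)), (cball phi x (r / 8)); split.
- exact: cball_open.
- by apply: cball_center => //; rewrite divr_gt0.
- exact: cball_open.
- by apply: cball_center => //; rewrite divr_gt0.
move=> O y oO [Dy yr] Oy f0 y' [Dy' yr'].
have oO' : open (O `&` cball phi x r) by apply: openI => //; exact: cball_open.
have Oy' : (O `&` cball phi x r) y by split=> //; split=> //; lra.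
have [s s0 [pp [hp1 hp2]]] := chart_ball Dy oO' Oy'.
rewrite fg; last by split=> //; lra.
have dgy z : nrm (z - coord phi y) < r * 3 / 4 -> differentiable g z.
  by move=> zr; apply: dg; have := nrm_tri z (coord phi y) (coord phi x); lra.
have g0 z : nrm (z - coord phi y) < s -> g z = 0.
  by move=> zs; have [[Op Bp] _ pE] := hp1 z zs; rewrite -pE -fg // f0.
apply: (zero_ball s0 dgy g0).
have := nrm_tri (coord phi y') (coord phi x) (coord phi y).
by rewrite [nrm (coord phi x - coord phi y)]nrmC; lra.
Qed.

End Manifold.

(** * The identity theorem *)

Section Connected.
Variable T : topologicalType.

Lemma connected_clopen (D A A' : set T) : connected D -> open A -> open A' ->
  D `<=` A `|` A' -> D `&` A `&` A' = set0 -> D `&` A !=set0 -> D `<=` A.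
Proof.
move=> cD oA oA' cov dis ne.
have E : D `&` A = D.
  apply: cD => //; first by exists A.
  exists (~` A'); first exact: open_closedC.
  apply/seteqP; split=> x [Dx h]; split=> //.
    by move=> A'x; have : (D `&` A `&` A') x by []; rewrite dis.
  by case: (cov x Dx).
by move=> x Dx; rewrite -E in Dx; case: Dx.
Qed.

Lemma connectedP (D : set T) :
  (forall A A' : set T, open A -> open A' -> D `<=` A `|` A' ->
     D `&` A `&` A' = set0 -> D `&` A !=set0 -> D `<=` A) -> connected D.
Proof.
move=> h B ne [A oA BA] [F cF BF].
have := h A (~` F) oA (closed_openC cF).
move=> {}h; apply/seteqP; split; first by rewrite BA => x [].
move=> x Dx; rewrite BA; split=> //; apply: h => //.
- move=> y Dy; have [Fy|nF] := pselect (F y); last by right.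
  have By : B y by rewrite BF; split.
  by left; rewrite BA in By; case: By.
- apply/seteqP; split=> y // [[Dy Ay] nFy]; apply: nFy.
  have By : B y by rewrite BA; split.
  by rewrite BF in By; case: By.
- by rewrite -BA.
Qed.

End Connected.

Section ManifoldTheorems.
Variables (R : realType) (n : nat).
Local Notation C := (complex_field R).
Variable X : complexManifold R n.
Implicit Types (phi psi : chart R n X) (x y : X) (f g h u v b : X -> C).

(** The points near which [f] vanishes form an open set, and so do the points that
    have a neighbourhood disjoint from it; by [zero_spread] there are no others. *)
Lemma identity_theorem (D O : set X) f : open D -> connected D ->
  (forall x, D x -> holoAt f x) -> open O -> D `&` O !=set0 ->
  (forall x, D x -> O x -> f x = 0) -> forall x, D x -> f x = 0.
Proof.
move=> oD cD hf oO [x0 [Dx0 Ox0]] f0.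
pose A := [set x | exists2 N : set X, open N /\ N x & forall y, N y -> f y = 0].
have oA : open A.
  apply: open_from => x [N [oN Nx] N0]; exists N => // y Ny; by exists N.
pose A' := [set x | exists2 N : set X, open N /\ N x & N `&` A = set0].
have oA' : open A'.
  apply: open_from => x [N [oN Nx] N0]; exists N => // y Ny; by exists N.
have DA : D `<=` A.
  apply: (connected_clopen cD oA oA').
  - move=> x Dx; have [N [N' [oN Nx oN' N'x hN]]] := zero_spread (hf x Dx).
    have [NA|NA] := pselect (N `&` A = set0); first by right; exists N.
    left; have /set0P[y [Ny [G [oG Gy] G0]]] : N `&` A != set0 by apply/eqP.
    by exists N' => // z N'z; exact: (hN G y).
  - apply/seteqP; split=> x // [[Dx Ax] [N [oN Nx] NA]].
    by have : (N `&` A) x by []; rewrite NA.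
  - exists x0; split=> //; exists (D `&` O); first by split=> //; exact: openI.
    by move=> y [Dy Oy]; exact: f0.
by move=> x /DA[N [_ Nx]]; apply.
Qed.

(** The value of a section, made total by [0] outside [U]. *)
Definition secval (U : opens X) (s : structure_sheaf X U) x : C :=
  if pselect (U x) is left Ux then lsub_val s (exist _ x (mem_set Ux)) else 0.

Lemma secvalE (U : opens X) (s : structure_sheaf X U) (y : set_type U) :
  secval s (val y) = lsub_val s y.
Proof.
rewrite /secval; case: y => y yU /=; case: pselect => [Uy|nU]; last by case: nU; exact: set_mem.
by congr (lsub_val s _); exact: val_inj.
Qed.

Lemma secval_inj (U : opens X) (s t : structure_sheaf X U) :
  (forall x, U x -> secval s x = secval t x) -> s = t.
Proof.
move=> h; apply: val_inj; apply: functional_extensionality_dep => y.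
by have := h (val y) (set_mem (valP y)); rewrite !secvalE.
Qed.

Lemma secval_holo (U : opens X) (s : structure_sheaf X U) x : U x -> holoAt (secval s) x.
Proof.
move=> Ux; have [phi A D] := atlas_cover x; apply: (holo_inW A D).
have hs : holomorphic (lsub_val s) := lsub_valP s.
have [g dg sg] := hs phi A.
have [r r0 [pp [hp1 hp2]]] := chart_ball D (opens_open U) Ux.
exists g, r => //; split=> [z zr|y yr].
  by apply: dg; have [Up Dp pE] := hp1 z zr; exists (pp z).
have [Uy _] := hp2 y yr; have [Dy _] := yr.
have -> : secval s y = lsub_val s (exist _ y (mem_set Uy)) by rewrite -secvalE.
exact: sg.
Qed.

Lemma holo_section (U : opens X) f : (forall x, U x -> holoAt f x) ->
  exists s : structure_sheaf X U, forall x, U x -> secval s x = f x.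
Proof.
move=> hf.
have hs : holomorphic_lsub U (fun y : set_type U => f (val y)).
  move=> phi A.
  have ex z : exists c, forall x, U x -> dom phi x -> coord phi x = z -> f x = c.
    have [[x [Ux Dx xz]]|no] := pselect (exists x, [/\ U x, dom phi x & coord phi x = z]).
      exists (f x) => y Uy Dy yz; congr f.
      by apply: (Defs.coord_inj (c := phi)) => //; rewrite xz.
    by exists 0 => x Ux Dx xz; case: no; exists x.
  have [g gE] := choice ex.
  exists g; last by move=> x Dx; apply: gE => //; exact: set_mem (valP x).
  move=> z [x [Ux Dx] <-].
  have [k [r r0 [dk fk]]] := holoAt_in A Dx (hf x Ux).
  have [s s0 [pp [hp1 hp2]]] := chart_ball Dx (opens_open U) Ux.
  have rs : 0 < Num.min r s by rewrite lt_min r0.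
  apply: (@near_eq_differentiable _ _ k _ _ _ rs); last by apply: dk; rewrite subrr nrm0.
  move=> w; rewrite lt_min => /andP[w1 w2]; have [Up Dp pE] := hp1 w w2.
  by rewrite -{1}pE -fk; [apply: gE|split=> //; rewrite pE].
exists (lsub_in hs) => x Ux; rewrite /secval; case: pselect => // Ux'.
Qed.

End ManifoldTheorems.

(** * The complement of a thin analytic set *)

Section Analytic.
Variables (R : realType) (n : nat).
Local Notation C := (complex_field R).
Variable X : complexManifold R n.
Implicit Types (phi psi : chart R n X) (x y : X) (f g h u v b : X -> C).

Definition thin (Z : set X) := forall O : set X, open O -> O !=set0 -> exists2 x, O x & ~ Z x.

Lemma finI_open k (N : 'I_k -> set X) x : (forall i, open (N i) /\ N i x) ->
  exists2 M : set X, open M /\ M x & forall i, M `<=` N i.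
Proof.
move=> hN.
have h : \forall y \near x, forall i, N i y.
  by apply: filter_forall => i; apply: open_nbhs_nbhs.
exists [set y | forall i, N i y]^°.
  by split; [exact: open_interior|].
by move=> i y /interior_subset; apply.
Qed.

(** Away from [Z] the single equation [1 = 0] serves, so no case distinction is
    needed later. *)
Lemma analytic_equations (Z : analyticSet X) x : exists O k (f : 'I_k -> X -> C),
  [/\ open O, O x, forall i y, O y -> holoAt (f i) y &
      forall y, O y -> (Z y <-> forall i, f i y = 0)].
Proof.
have [Zx|nZx] := pselect (Z x).
  have [U [k [f [Ux fZ]]]] := aset_local Zx.
  exists U, k, (fun i => secval (f i)); split=> //.
  - exact: opens_open.
  - by move=> i y Uy; exact: secval_holo.
  move=> y Uy; have := fZ (exist _ y (mem_set Uy)) => /= ->.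
  by split=> h i; have := h i; rewrite -secvalE.
exists (~` Z), 1%N, (fun _ _ => 1); split=> //.
- by apply: closed_openC; exact: aset_closed.
- by move=> i y _; exact: holoAt_cst.
move=> y nZy; split=> // h; have /eqP := h ord0.
by rewrite oner_eq0.
Qed.

Lemma near_param phi x (r : R) (psi : 'rV[C]_n -> X) (A : set X) z :
  (forall z, nrm (z - coord phi x) < r -> dom phi (psi z) /\ coord phi (psi z) = z) ->
  nrm (z - coord phi x) < r -> open A -> A (psi z) ->
  exists2 d : R, 0 < d & forall w, nrm (w - z) < d -> A (psi w).
Proof.
move=> hp zr oA Az; have [Dz zE] := hp z zr.
have [d d0 [pp [hp1 _]]] := chart_ball Dz oA Az.
have e0 : 0 < r - nrm (z - coord phi x) by rewrite subr_gt0.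
exists (Num.min d (r - nrm (z - coord phi x))); first by rewrite lt_min d0.
move=> w; rewrite lt_min => /andP[w1 w2].
have wr : nrm (w - coord phi x) < r by have := nrm_tri w z (coord phi x); lra.
have [Dw wE] := hp w wr; rewrite -{1}zE in w1.
have [Ap Dp pE] := hp1 w w1.
suff -> : psi w = pp w by [].
by apply: (Defs.coord_inj (c := phi)) => //; rewrite wE pE.
Qed.

(** The zeros of [f] separate [A] from [A'].  The function is of second order at
    these zeros, hence differentiable there too. *)
Lemma holo_square f (A A' O : set X) x : open O -> O x ->
  (forall y, O y -> holoAt f y) -> open A -> open A' -> A `&` A' = set0 ->
  (forall y, O y -> f y != 0 -> A y \/ A' y) ->
  holoAt (fun y => if pselect (A y) then f y ^+ 2 else 0) x.
Proof.
move=> oO Ox hf oA oA' AA' cov; have [phi Aphi Dx] := atlas_cover x.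
apply: (holo_inW Aphi Dx).
have [r r0 [psi [hp1 hp2]]] := chart_ball Dx oO Ox.
have [g [s /andP[s0 sr] [dg fg]]] := holo_in_shrink r0 (holoAt_in Aphi Dx (hf x Ox)).
pose h y := if pselect (A y) then f y ^+ 2 else 0.
have hps z : nrm (z - coord phi x) < s -> dom phi (psi z) /\ coord phi (psi z) = z.
  by move=> zs; have [] := hp1 z (lt_le_trans zs sr).
have fps z : nrm (z - coord phi x) < s -> f (psi z) = g z.
  move=> zs; have [Dz zE] := hps z zs; rewrite fg ?zE //; split=> //; by rewrite zE.
exists (fun z => h (psi z)), s => //; split=> [z zs|y ys]; last first.
  have ys' : cball phi x r y by have [Dy h1] := ys; split=> //; exact: lt_le_trans h1 sr.
  by have [_ ->] := hp2 y ys'.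
have [Oz Dz zE] := hp1 z (lt_le_trans zs sr).
have s1 : 0 < s - nrm (z - coord phi x) by rewrite subr_gt0.
have [gz|gz] := eqVneq (g z) 0.
  apply: (@differentiable_square_bound _ _ g _ z 1 _ s1 (dg z zs) gz) => w wz.
  have ws : nrm (w - coord phi x) < s by have := nrm_tri w z (coord phi x); lra.
  rewrite mul1r /h; case: pselect => ?; last by rewrite nrm0 sqr_ge0.
  by rewrite nrmX fps.
case: (cov (psi z) Oz); first by rewrite fps.
  move=> Az; have [d d0 hd] := near_param hps zs oA Az.
  apply: (@near_eq_differentiable _ _ (fun w => g w ^+ 2) _ _ (Num.min d (s - nrm (z - coord phi x)))).
  - by rewrite lt_min d0.
  - move=> w; rewrite lt_min => /andP[/hd Aw wz].
    have ws : nrm (w - coord phi x) < s by have := nrm_tri w z (coord phi x); lra.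
    by rewrite /h; case: pselect => // ?; rewrite fps.
  - by apply: diff_exp; exact: dg.
move=> Az; have [d d0 hd] := near_param hps zs oA' Az.
apply: (@near_eq_differentiable _ _ (fun=> 0) _ _ d d0); last exact: diff_cst.
move=> w /hd A'w; rewrite /h; case: pselect => // Aw.
by have : (A `&` A') (psi w) by []; rewrite AA'.
Qed.

(** Suppose that [A] and [A'] split [U \ Z], where [Z] is given by [f i = 0].  Near
    a point that both sets approach, [f i ^+ 2] times the indicator of [A] is
    holomorphic and vanishes on the open set [A'], so it vanishes.  Hence, near that
    point, [A] lies in the zeros of the [f i], that is in [Z], which is absurd.
    So the points approached by [A'] only and those approached by [A] only split
    [U]. *)
Lemma connected_diff_thin (Z : analyticSet X) (U : set X) :
  open U -> connected U -> thin Z -> connected (U `\` Z).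
Proof.
move=> oU cU tZ; apply: connectedP => A0 A0' oA0 oA0' cov0 dis0 [a0 [a0U a0A]].
have oUZ : open (U `\` Z).
  by rewrite setDE; apply: openI => //; apply: closed_openC; exact: aset_closed.
pose A := (U `\` Z) `&` A0; pose A' := (U `\` Z) `&` A0'.
have oA : open A by exact: openI.
have oA' : open A' by exact: openI.
have AA' : A `&` A' = set0.
  apply/seteqP; split=> x // [[Ux Ax] [_ A'x]].
  by have : ((U `\` Z) `&` A0 `&` A0') x by []; rewrite dis0.
have cov x : U x -> ~ Z x -> A x \/ A' x.
  by move=> Ux nZ; case: (cov0 x (conj Ux nZ)) => h; [left|right]; split.
suff noA' : forall y, ~ A' y.
  by move=> y [Uy nZ]; case: (cov y Uy nZ) => [[]//|/noA'].
move=> y0 A'y0.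
pose B := [set x | exists2 N : set X, open N /\ N x & N `&` A' = set0].
pose B' := [set x | exists2 N : set X, open N /\ N x & N `&` A = set0].
have oB : open B.
  apply: open_from => x [N [oN Nx] N0]; exists N => // y Ny; by exists N.
have oB' : open B'.
  apply: open_from => x [N [oN Nx] N0]; exists N => // y Ny; by exists N.
have [[Uy0 nZy0] _] := A'y0.
have UB : U `<=` B.
  apply: (connected_clopen cU oB oB').
  - move=> x Ux; have [nB|nB] := pselect (B x); first by left.
    right; have hA' : forall N : set X, open N -> N x -> exists2 y, N y & A' y.
      move=> N oN Nx; apply: contrapT => no; apply: nB; exists N => //.
      by apply/seteqP; split=> y // [Ny A'y]; apply: no; exists y.
    have [D [k [f [oO Ox hf fZ]]]] := analytic_equations Z x.
    pose h i y := if pselect (A y) then f i y ^+ 2 else 0.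
    have hh i : holoAt (h i) x.
      apply: (@holo_square _ A A' (D `&` U)) => //; first exact: openI.
        by move=> y [Oy _]; exact: hf.
      move=> y [Oy Uy] fy; apply: cov => // Zy.
      by move/eqP: fy; apply; have [+ _] := fZ y Oy; apply.
    have sp i := zero_spread (hh i).
    have [N hN] := choice sp; have [N' hN'] := choice hN.
    have [i|M [oM Mx] hM] := @finI_open k (fun i => N i `&` N' i) x.
      by have [oN Nx oN' N'x _] := hN' i; split; [exact: openI|].
    exists (M `&` D); first by split; [exact: openI|].
    apply/seteqP; split=> a // [[Ma Oa] Aa].
    have [y My A'y] := hA' M oM Mx.
    have Za : Z a.
      apply/(fZ a Oa) => i; have [_ _ _ _ hz] := hN' i.
      have : h i a = 0.
        apply: (hz A' y) => //.
        - by have [] := hM i y My.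
        - move=> z A'z; rewrite /h; case: pselect => // Az.
          by have : (A `&` A') z by []; rewrite AA'.
        - by have [] := hM i a Ma.
      by rewrite /h; case: pselect => // ? /eqP; rewrite expf_eq0 /= => /eqP.
    by case: Aa => [[_ +] _]; apply.
  - apply/seteqP; split=> x // [[Ux [N [oN Nx] NA']] [N1 [oN1 N1x] NA]].
    have [||y [[Ny N1y] Uy] nZ] := tZ (N `&` N1 `&` U).
    + by apply: openI => //; exact: openI.
    + by exists x.
    case: (cov y Uy nZ) => h.
      by have : (N1 `&` A) y by []; rewrite NA.
    by have : (N `&` A') y by []; rewrite NA'.
  - case: a0U => Ua0 nZa0; exists a0; split=> //; exists A => //.
have [N [oN Ny0] NA'] := UB y0 Uy0.
by have : (N `&` A') y0 by []; rewrite NA'.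
Qed.

(** The interior of [Z] is closed by the identity theorem for the local
    equations, so if it is not empty then [Z] is everything.  But near a regular
    point of dimension [d < n] the coordinate of index [d] vanishes on [Z] and not
    on [X]. *)
Lemma codim1_thin (Z : analyticSet X) :
  connected [set: X] -> analytic_codim Z 1 -> thin Z.
Proof.
move=> cX [d [[x0 [phi [_ Zx0 Dx0 dn Zeq]]] _] d1] O oO [p0 Op0].
apply: contrapT => no.
have OZ : O `<=` Z by move=> x Ox; apply: contrapT => nZ; apply: no; exists x.
pose A := [set x | exists2 N : set X, open N /\ N x & N `<=` Z].
pose A' := [set x | exists2 N : set X, open N /\ N x & N `&` A = set0].
have oA : open A.
  apply: open_from => x [N [oN Nx] N0]; exists N => // y Ny; by exists N.
have oA' : open A'.
  apply: open_from => x [N [oN Nx] N0]; exists N => // y Ny; by exists N.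
have full : [set: X] `<=` A.
  apply: (connected_clopen cX oA oA').
  - move=> x _; have [D [k [f [oO' O'x hf fZ]]]] := analytic_equations Z x.
    have sp i := zero_spread (hf i x O'x).
    have [N hN] := choice sp; have [N' hN'] := choice hN.
    have [i|M [oM Mx] hM] := @finI_open k (fun i => N i `&` N' i) x.
      by have [oN Nx oN' N'x _] := hN' i; split; [exact: openI|].
    have [MA|MA] := pselect ((M `&` D) `&` A = set0).
      by right; exists (M `&` D) => //; split; [exact: openI|].
    left; have /set0P[y [[My O'y] [G [oG Gy] GZ]]] : (M `&` D) `&` A != set0 by apply/eqP.
    exists (M `&` D); first by split; [exact: openI|].
    move=> z [Mz O'z]; apply/(fZ z O'z) => i; have [_ _ _ _ hz] := hN' i.
    apply: (hz (G `&` D) y) => //.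
    + exact: openI.
    + by have [] := hM i y My.
    + by move=> w [Gw O'w]; have [+ _] := fZ w O'w; apply; exact: GZ.
    + by have [] := hM i z Mz.
  - apply/seteqP; split=> x // [[_ Ax] [N [oN Nx] NA]].
    by have : (N `&` A) x by []; rewrite NA.
  - by exists p0; split=> //; exists O.
have allZ y : Z y by have [N [_ Ny]] := full y I; apply.
have [r r0 [psi [hp1 hp2]]] := chart_ball Dx0 (@openT X) I.
have dlt : (d < n)%N by rewrite -d1 addn1.
pose i := Ordinal dlt.
pose dl : 'rV[C]_n := delta_mx 0 i.
have dl1 : 0 < nrm dl + 1 by rewrite ltr_wpDl ?nrm_ge0.
pose e := r / (nrm dl + 1); have e0 : 0 < e by rewrite divr_gt0.
pose w : 'rV[C]_n := coord phi x0 + rc e *: dl.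
have wr : nrm (w - coord phi x0) < r.
  rewrite /w addrAC subrr add0r nrmZ nrm_rc gtr0_norm //.
  by rewrite /e mulrAC ltr_pdivrMr // ltr_pM2l // ltrDl.
have [_ Dw wE] := hp1 w wr.
have [+ _] := Zeq _ Dw; move=> /(_ (allZ _) i (leqnn d)).
have [+ _] := Zeq _ Dx0; move=> /(_ (allZ _) i (leqnn d)) z0.
rewrite wE /w !mxE z0 add0r !eqxx mulr1 => /eqP.
by rewrite -nrm_eq0 nrm_rc normr_eq0 gt_eqF.
Qed.

End Analytic.

(** * Connected neighbourhoods and quotients on a manifold *)

Section Extension.
Variables (R : realType) (n : nat).
Local Notation C := (complex_field R).
Variable X : complexManifold R n.
Implicit Types (phi psi : chart R n X) (x y : X) (f g h u v b : X -> C).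

(** The indicator of one side of a separation of a coordinate ball would be
    holomorphic, against the identity theorem. *)
Lemma ball_not_separated (U : set X) x : open U -> U x ->
  exists2 N : set X, open N /\ N x & N `<=` U /\
    forall A A' : set X, open A -> open A' -> U `<=` A `|` A' ->
      U `&` A `&` A' = set0 -> A x -> N `<=` A.
Proof.
move=> oU Ux; have [phi Aphi Dx] := atlas_cover x.
have [r r0 [psi [hp1 hp2]]] := chart_ball Dx oU Ux.
have r2 : 0 < r / 2 by rewrite divr_gt0.
exists (cball phi x (r / 2)).
  by split; [exact: cball_open|exact: cball_center].
have inr y : cball phi x (r / 2) y -> cball phi x r y.
  by move=> [Dy h]; split=> //; lra.
split=> [y /inr/hp2[]//|A A' oA oA' cov dis Ax y yr].
have [Uy yE] := hp2 y (inr y yr).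
have [//|nA] := pselect (A y).
have hps z : nrm (z - coord phi x) < r -> dom phi (psi z) /\ coord phi (psi z) = z.
  by move=> zs; have [] := hp1 z zs.
pose g z : C := if pselect (A (psi z)) then 0 else 1.
have dg z : nrm (z - coord phi x) < r -> differentiable g z.
  move=> zr; have [Uz Dz zE] := hp1 z zr.
  case: (cov _ Uz) => Az.
    have [d d0 hd] := near_param hps zr oA Az.
    apply: (@near_eq_differentiable _ _ (fun=> 0) _ _ d d0); last exact: diff_cst.
    by move=> w /hd Aw; rewrite /g; case: pselect.
  have [d d0 hd] := near_param hps zr (openI oU oA') (conj Uz Az).
  apply: (@near_eq_differentiable _ _ (fun=> 1) _ _ d d0); last exact: diff_cst.
  move=> w /hd [Uw Aw]; rewrite /g; case: pselect => // Aw'.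
  by have : (U `&` A `&` A') (psi w) by []; rewrite dis.
have [_ xE] := hp2 x (cball_center Dx r0).
have rx : nrm (coord phi x - coord phi x) < r by rewrite subrr nrm0.
have Ax' : A (psi (coord phi x)) by rewrite xE.
have [d d0 hd] := near_param hps rx oA Ax'.
have g0 z : nrm (z - coord phi x) < d -> g z = 0.
  by move=> /hd Az; rewrite /g; case: pselect.
have [_ yr2] := yr.
have := zero_ball d0 dg g0 yr2; rewrite /g yE; case: pselect => // ? /eqP.
by rewrite oner_eq0.
Qed.

(** [Q] is the intersection of the relatively clopen subsets of [U] that contain
    [Z].  It is open because coordinate balls are connected, and a separation of
    [Q] would extend to one of [U]. *)
Lemma connected_nbhd (Z U : set X) : connected Z -> Z !=set0 -> open U -> Z `<=` U ->
  exists Q : set X, [/\ open Q, connected Q, Z `<=` Q & Q `<=` U].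
Proof.
move=> cZ nZ oU ZU.
pose sep (A A' : set X) := [/\ open A, open A', U `<=` A `|` A', U `&` A `&` A' = set0 & Z `<=` A].
pose Q := [set x | U x /\ forall A A', sep A A' -> A x].
have oQ : open Q.
  rewrite openE => x [Ux Qx]; rewrite /interior.
  have [N [oN Nx] [NU hN]] := ball_not_separated oU Ux.
  apply: (@filterS _ _ _ N); last exact: open_nbhs_nbhs.
  move=> y Ny; split; first exact: NU.
  move=> A A' AA'; have [oA oA' cov dis ZA] := AA'.
  by apply: (hN A A') => //; exact: Qx AA'.
have ZQ : Z `<=` Q by move=> z Zz; split; [exact: ZU|move=> A A' [_ _ _ _]; apply].
have QU : Q `<=` U by move=> x [].
pose P := [set x | exists A A', [/\ sep A A', U x & A' x]].
have oP : open P.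
  rewrite openE => x [A [A' [AA' Ux A'x]]]; rewrite /interior.
  apply: (@filterS _ _ _ (U `&` A')).
    by move=> y [Uy A'y]; exists A, A'.
  have [_ oA' _ _ _] := AA'.
  by apply: open_nbhs_nbhs; split; [exact: openI|].
have UQP : U `<=` Q `|` P.
  move=> x Ux; have [Qx|nQ] := pselect (Q x); first by left.
  right; apply: contrapT => nP; apply: nQ; split=> // A A' AA'.
  have [_ _ cov _ _] := AA'; case: (cov x Ux) => // A'x.
  by case: nP; exists A, A'.
have QP x : Q x -> P x -> False.
  move=> [Ux Qx] [A [A' [AA' _ A'x]]]; have Ax := Qx _ _ AA'.
  have [_ _ _ dis _] := AA'.
  by have : (U `&` A `&` A') x by []; rewrite dis.
have key A A' : open A -> open A' -> Q `<=` A `|` A' -> Q `&` A `&` A' = set0 ->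
    Z `<=` A -> Q `<=` A.
  move=> oA oA' cov dis ZA x Qx.
  suff : sep (Q `&` A) ((Q `&` A') `|` P) by have [_ h] := Qx; move=> /h[].
  split.
  - exact: openI.
  - by apply: openU => //; exact: openI.
  - move=> y Uy; case: (UQP y Uy) => [Qy|Py]; last by right; right.
    by case: (cov y Qy) => h; [left|right; left].
  - apply/seteqP; split=> y // [[Uy [Qy Ay]] [[_ A'y]|Py]]; last exact: QP Qy Py.
    by have : (Q `&` A `&` A') y by []; rewrite dis.
  - by move=> z Zz; split; [exact: ZQ|exact: ZA].
exists Q; split=> //; apply: connectedP => A A' oA oA' cov dis [a [Qa Aa]].
have [ZA|ZA] := pselect (Z `&` A !=set0).
  apply: (key A A') => //; apply: (connected_clopen cZ oA oA') => //.
    by move=> z /ZQ; exact: cov.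
  apply/seteqP; split=> y // [[/ZQ Qy Ay] A'y].
  by have : (Q `&` A `&` A') y by []; rewrite dis.
have QA' : Q `<=` A'.
  apply: (key A' A) => //.
  - by rewrite setUC.
  - by rewrite setIAC.
  - move=> z Zz; case: (cov z (ZQ z Zz)) => // Az.
    by case: ZA; exists z.
have : (Q `&` A `&` A') a by split=> //; exact: QA'.
by rewrite dis.
Qed.

Lemma local_quotient_manifold (c : C) u v x : holoAt u x -> holoAt v x ->
  (forall y, v y ^+ 2 - c * u y * v y = u y ^+ 3) ->
  exists b, exists2 N : set X, open N /\ N x & forall y, N y ->
    holoAt b y /\ b y * u y = v y.
Proof.
move=> [phi [Aphi Dx [gu [r r0 [dgu ugu]]]]] hv uv.
have [gv [s /andP[s0 sr] [dgv vgv]]] := holo_in_shrink r0 (holoAt_in Aphi Dx hv).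
have [t t0 [psi [hp1 hp2]]] := chart_ball Dx (@openT X) I.
pose m := Num.min s t; have m0 : 0 < m by rewrite lt_min s0.
have ms z : nrm (z - coord phi x) < m -> nrm (z - coord phi x) < s.
  by rewrite lt_min => /andP[].
have mr z : nrm (z - coord phi x) < m -> nrm (z - coord phi x) < r.
  by move=> /ms h; exact: lt_le_trans h sr.
have [|||b [d d0 hb]] := @local_quotient R _ c gu gv (coord phi x) m m0.
- by move=> z /mr; exact: dgu.
- by move=> z /ms; exact: dgv.
- move=> z zm; have zt : nrm (z - coord phi x) < t.
    by move: zm; rewrite lt_min => /andP[].
  have [_ Dz zE] := hp1 z zt; rewrite -zE.
  rewrite -ugu; last by split=> //; rewrite zE; exact: mr.
  by rewrite -vgv //; split=> //; rewrite zE; exact: ms.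
pose e := Num.min m d; have e0 : 0 < e by rewrite lt_min m0.
have em z : nrm (z - coord phi x) < e -> nrm (z - coord phi x) < m.
  by rewrite lt_min => /andP[].
have ed z : nrm (z - coord phi x) < e -> nrm (z - coord phi x) < d.
  by rewrite lt_min => /andP[].
exists (b \o coord phi), (cball phi x e).
  by split; [exact: cball_open|exact: cball_center].
move=> y [Dy ye]; split.
  apply: (holo_inW Aphi Dy); exists b, (e - nrm (coord phi y - coord phi x)).
    by rewrite subr_gt0.
  split=> // z zy; have ze : nrm (z - coord phi x) < e.
    by have := nrm_tri z (coord phi y) (coord phi x); lra.
  by have [] := hb z (ed z ze).
have [_ /= bu] := hb _ (ed _ ye).
rewrite /= ugu; last by split=> //; exact/mr/em.
by rewrite bu vgv //; split=> //; exact/ms/em.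
Qed.

(** The equation [v ^ 2 - c u v = u ^ 3] holds on [D], hence on [X] by the identity
    theorem.  By [local_quotient] the meromorphic function [v / u] is
    holomorphic; it equals [b] on [D].  The local quotients agree because [u] does
    not vanish on open sets, unless [u = 0], in which case [b] is a constant. *)
Lemma quotient_extends (D : set X) (c : C) b u v :
  connected [set: X] -> open D -> connected D -> D !=set0 ->
  (forall x, holoAt u x) -> (forall x, holoAt v x) ->
  (forall x, D x -> holoAt b x) ->
  (forall x, D x -> b x ^+ 2 - c * b x = u x) ->
  (forall x, D x -> b x * u x = v x) ->
  exists beta, (forall x, holoAt beta x) /\ forall x, D x -> beta x = b x.
Proof.
move=> cX oD cD neD hu hv hb beq buv.
have neTD : [set: X] `&` D !=set0 by rewrite setTI.
have rel x : v x ^+ 2 - c * u x * v x = u x ^+ 3.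
  apply: subr0_eq.
  apply: (@identity_theorem _ _ _ setT D (fun x => v x ^+ 2 - c * u x * v x - u x ^+ 3)) => //.
  - exact: openT.
  - move=> y _; have -> : (fun x => v x ^+ 2 - c * u x * v x - u x ^+ 3) =
       (fun x => (v x * v x - (c * u x) * v x) - u x * (u x * u x)).
      by apply/funext => z; ring.
    apply: holoAtB; last by apply: holoAtM => //; exact: holoAtM.
    apply: holoAtB; first exact: holoAtM.
    by apply: holoAtM => //; apply: holoAtM => //; exact: holoAt_cst.
  - move=> y _ Dy; rewrite -buv // -beq //; ring.
have [u0|nu0] := pselect (forall x, u x = 0).
  (* b is one of the constants 0 and c *)
  have bc x : D x -> b x * (b x - c) = 0.
    by move=> Dx; rewrite mulrBr -expr2 [_ * c]mulrC beq.
  have [b0|nb0] := pselect (forall x, D x -> b x = 0).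
    by exists (fun=> 0); split=> [x|x /b0 ->//]; exact: holoAt_cst.
  have [y0 Dy0 by0] : exists2 y, D y & b y != 0.
    apply: contrapT => no; apply: nb0 => x Dx; apply/eqP/negPn/negP => bx.
    by apply: no; exists x.
  have [G [oG Gy] G0] := holoAt_nonzero (hb y0 Dy0) by0.
  exists (fun=> c); split=> [x|x Dx]; first exact: holoAt_cst.
  apply/esym/eqP; rewrite -subr_eq0; apply/eqP.
  apply: (@identity_theorem _ _ _ D G (fun x => b x - c)) => //.
  - by move=> y Dy; apply: holoAtB; [exact: hb|exact: holoAt_cst].
  - by exists y0.
  - move=> y Dy Gy'; have /eqP := bc y Dy.
    by rewrite mulf_eq0 (negbTE (G0 y Gy')) => /eqP.
have thin_u (N : set X) x : open N -> N x -> (forall y, N y -> u y = 0) -> False.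
  move=> oN Nx N0; apply: nu0 => y.
  apply: (@identity_theorem _ _ _ setT N u) => //; first exact: openT.
    by exists x.
  by move=> y1 _; exact: N0.
have uniq (b1 b2 : X -> C) x1 (N : set X) : holoAt b1 x1 -> holoAt b2 x1 -> open N -> N x1 ->
    (forall y, N y -> b1 y * u y = b2 y * u y) -> b1 x1 = b2 x1.
  move=> h1 h2 oN Nx hN; apply/eqP; rewrite -subr_eq0; apply/negPn/negP => ne.
  have [G [oG Gx] G0] := holoAt_nonzero (holoAtB h1 h2) ne.
  apply: (thin_u (N `&` G) x1) => //; first exact: openI.
  move=> y [Ny Gy]; have /eqP := hN y Ny.
  by rewrite -subr_eq0 -mulrBl mulf_eq0 (negbTE (G0 y Gy)) => /eqP.
have loc x := local_quotient_manifold (hu x) (hv x) rel.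
have [B hB] := choice loc.
have betaE x : exists2 N : set X, open N /\ N x & forall y, N y -> B y y = B x y.
  have [N [oN Nx] hN] := hB x; exists N => // y Ny.
  have [N' [oN' N'y] hN'] := hB y.
  apply: (uniq _ _ _ (N `&` N')).
  - by have [] := hN' y N'y.
  - by have [] := hN y Ny.
  - exact: openI.
  - by [].
  - by move=> z [Nz N'z]; have [_ ->] := hN z Nz; have [_ ->] := hN' z N'z.
exists (fun x => B x x); split=> [x|x Dx].
  have [N [oN Nx] hN] := betaE x; have [N' [oN' N'x] hN'] := hB x.
  by apply: (@holoAt_eq _ _ _ (B x) _ x N) => // [y /hN ->//|]; have [] := hN' x N'x.
have [N [oN Nx] hN] := hB x.
apply: (uniq _ _ _ (N `&` D)).
- by have [] := hN x Nx.
- exact: hb.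
- exact: openI.
- by [].
- by move=> y [Ny Dy]; have [_ ->] := hN y Ny; rewrite buv.
Qed.

End Extension.

(** * Subalgebras of finite codimension in a polynomial ring *)

Section Conductor.
Variable K : closedFieldType.

Lemma poly_dependence N (G : {linear {poly K} -> 'rV[K]_N}) :
  exists2 P : {poly K}, P != 0 & G P = 0.
Proof.
pose M : 'M[K]_(N.+1, N) := \matrix_(i < N.+1) G 'X^i.
have kM : kermx M != 0.
  rewrite -mxrank_eq0 mxrank_ker subn_eq0 -ltnNge.
  by apply: leq_ltn_trans (rank_leq_col M) _.
have /rowV0Pn[a /sub_kermxP aM a0] : kermx M != 0 by [].
exists (\poly_(i < N.+1) a 0 (inord i)).
  apply: contra a0 => /eqP P0; apply/eqP/rowP => i; rewrite mxE.
  by have := congr1 (fun p : {poly K} => p`_i) P0; rewrite coef_poly coef0 ltn_ord inord_val.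
rewrite poly_def linear_sum /= -[RHS]aM mulmx_sum_row.
by apply: eq_bigr => i _; rewrite linearZ /= inord_val rowK.
Qed.

Variables (S : {poly K} -> Prop) (k : nat) (L : {linear {poly K} -> 'rV[K]_k}).
Hypothesis S1 : S 1.
Hypothesis SD : forall p q, S p -> S q -> S (p + q).
Hypothesis SM : forall p q, S p -> S q -> S (p * q).
Hypothesis SZ : forall c p, S p -> S (c *: p).
Hypothesis LS : forall p, L p = 0 -> S p.

(** [p = p0 * 'X] is a nonconstant element of [S], so the quotient of the
    polynomials by multiples of [p] is spanned by finitely many ['X^j].  By a
    dimension count some [P != 0] has all ['X^j * P] in [S], and division by [p]
    shows that [P] generates an ideal inside [S]. *)
Lemma conductor_ex : exists2 q : {poly K}, q != 0 & forall A, S (A * q).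
Proof.
have linX : linear (fun p => L (p * 'X)).
  by move=> a u v; rewrite mulrDl -scalerAl linearP.
have [p0 p00 Lp] := poly_dependence (linear_of linX).
pose p := p0 * 'X; have Sp : S p by exact: LS.
have p_neq0 : p != 0 by rewrite mulf_neq0 // polyX_eq0.
have sp : (1 < size p)%N by rewrite size_mulX // ltnS size_poly_gt0.
pose d := (size p).-1.
have linG : linear (fun P => mxvec (\matrix_(j < d) L ('X^j * P))).
  move=> a u v; rewrite -linearP; congr mxvec; apply/row_matrixP => j.
  by rewrite linearP /= !rowK mulrDr -scalerAr linearP.
have [P P0 GP] := poly_dependence (linear_of linG).
have SP j : (j < d)%N -> S ('X^j * P).
  move=> jd; apply: LS.
  have : \matrix_(j < d) L ('X^j * P) = 0.
    by apply: (can_inj mxvecK); rewrite linear0; exact: GP.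
  by move=> /(congr1 (row (Ordinal jd))); rewrite rowK row0.
exists P => // A.
have [m sA] := ubnP (size A); elim: m A sA => // m IH A sA.
have Ssmall (B : {poly K}) : (size B <= d)%N -> S (B * P).
  move=> sB; rewrite -[B]coefK poly_def mulr_suml.
  elim/big_ind: _ => [|x y|i _].
  - by have := SZ 0 S1; rewrite scale0r.
  - exact: SD.
  by rewrite -scalerAl; apply: SZ; apply: SP; exact: leq_trans (ltn_ord i) sB.
rewrite (divp_eq A p) mulrDl; apply: SD.
  rewrite -mulrA [p * P]mulrC mulrA; apply: SM => //.
  have [sAp|sAp] := ltnP (size A) (size p).
    by rewrite divp_small // mul0r; have := SZ 0 S1; rewrite scale0r.
  apply: IH; rewrite size_divp //.
  have sA0 : (0 < size A)%N by exact: leq_trans (ltnW sp) sAp.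
  by apply: leq_trans (_ : size A <= m)%N; [rewrite ltn_subrL -subn1 subn_gt0 sp sA0|rewrite -ltnS].
by apply: Ssmall; rewrite -ltnS prednK ?ltn_modpN0 // (ltn_trans _ sp).
Qed.

Hypothesis Sclosed : forall P c,
  S (P * P - c *: P) -> S (P * (P * P - c *: P)) -> S P.

(** Let the ideal of [q] lie in [S], and let [q = q1 * ('X - l)].  With
    [c = q1.[l]], the polynomial [q1 * q1 - c *: q1] is a multiple of [q], so
    [q1] is in [S] by the closure hypothesis, and so is the ideal that [q1]
    generates.  The degree decreases until [q] is constant. *)
Lemma finite_codim_full : S 'X.
Proof.
have [q0 q00 hq0] := conductor_ex.
have [m] := ubnP (size q0); elim: m q0 q00 hq0 => // m IH q q_neq0 hq sq.
have [s1|s1] := eqVneq (size q) 1%N.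
  have [c c0 qc] := size_poly1P _ (introT eqP s1).
  have := SZ c^-1 (hq 'X); rewrite qc mulrC -mul_polyC mulrA -polyCM mulVf //.
  by rewrite mul1r.
have [l rl] := closed_rootP q s1.
have [q1 qE] := factor_theorem q l rl.
have q10 : q1 != 0 by apply: contraNneq q_neq0 => q1z; rewrite qE q1z mul0r.
pose c := q1.[l].
have [B BE] : exists B, q1 - c%:P = B * ('X - l%:P).
  by apply: factor_theorem; rewrite /root !hornerE subrr.
have E : q1 * q1 - c *: q1 = B * q.
  by rewrite -mul_polyC -mulrBl BE qE -mulrA [('X - _) * q1]mulrC.
have Sq1 : S q1.
  by apply: (Sclosed (c := c)); rewrite E ?mulrA; exact: hq.
apply: (IH q1) => //.
  move=> A; have [B' BE'] : exists B', A - (A.[l])%:P = B' * ('X - l%:P).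
    by apply: factor_theorem; rewrite /root !hornerE subrr.
  have -> : A * q1 = A.[l] *: q1 + B' * q.
    rewrite qE [q1 * _]mulrC mulrA -BE' -mul_polyC.
    by rewrite -mulrDl addrC subrK.
  by apply: SD; [exact: SZ|exact: hq].
move: sq; rewrite qE size_Mmonic ?monicXsubC // size_XsubC addn2 /=.
by rewrite ltnS.
Qed.

End Conductor.

(** * Families of germs *)

Section PresheafSections.
Variables (K : fieldType) (T : topologicalType).

Lemma germ_atP (F : presheaf K T) x (U V : opens T) (Ux : U x) (Vx : V x) s t :
  germ_at (F := F) Ux s = germ_at Vx t <->
  exists (W : opens T) (WU : W `<=` U) (WV : W `<=` V), W x /\ res F WU s = res F WV t.
Proof.
split.
  move=> /germ_eq[W [WU [WV [Wx e]]]]; exists W, WU, WV; split=> //; exact: Wx.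
move=> [W [WU [WV [Wx e]]]]; apply/germ_eq; exists W, WU, WV; split=> //.
by move=> y ->.
Qed.

Lemma germ_at_res (F : presheaf K T) x (U V : opens T) (Ux : U x) (Vx : V x)
  (VU : V `<=` U) s : germ_at Vx (res F VU s) = germ_at Ux s.
Proof. exact: germ_res. Qed.

Lemma germ_at_irr (F : presheaf K T) x (U : opens T) (p q : U x) (s : F U) :
  germ_at p s = germ_at q s.
Proof. by congr germ_at; exact: Prop_irrelevance. Qed.

Lemma germ_at_surj (F : presheaf K T) x (g : stalk F x) :
  exists (U : opens T) (Ux : U x) s, g = germ_at Ux s.
Proof.
have [U [AU [s gE]]] := germ_surj g; exists U, (AU x erefl), s.
by rewrite gE /germ_at; congr germ; exact: Prop_irrelevance.
Qed.

(** The global sections of the sheaf of discontinuous sections, the first term of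
    Godement's resolution. *)
Definition dsections (F : presheaf K T) : lmodType K := dprod (stalk F).

Definition issec (F : presheaf K T) (s : dsections F) (x : T) : Prop :=
  exists (U : opens T) (t : F U), U x /\ forall y (Uy : U y), s y = germ_at Uy t.

Section Presheaf.
Variable F : presheaf K T.
Implicit Types (s : dsections F) (x y : T).

Lemma issecP a s s' x : issec s x -> issec s' x -> issec (a *: s + s') x.
Proof.
move=> [U [t [Ux st]]] [V [t' [Vx st']]].
exists (opensI U V), (a *: res F (@opensIl _ _ _) t + res F (@opensIr _ _ _) t').
split=> // y [Uy Vy].
transitivity (a *: s y + s' y); first by [].
by rewrite (st y Uy) (st' y Vy) germ_at_linear (germ_at_res Uy) (germ_at_res Vy).
Qed.

Lemma issec0 x : issec (0 : dsections F) x.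
Proof. by exists (opensT T), 0; split=> // y Uy; rewrite linear0. Qed.

Lemma issecD s s' x : issec s x -> issec s' x -> issec (s + s') x.
Proof. by move=> h h'; rewrite -[s]scale1r; exact: issecP. Qed.

Lemma issecZ a s x : issec s x -> issec (a *: s) x.
Proof. by move=> h; rewrite -[_ *: _]addr0; apply: issecP => //; exact: issec0. Qed.

Lemma issecN s x : issec s x -> issec (- s) x.
Proof. by move=> h; rewrite -scaleN1r; exact: issecZ. Qed.

Lemma issecB s s' x : issec s x -> issec s' x -> issec (s - s') x.
Proof. by move=> h h'; apply: issecD => //; exact: issecN. Qed.

Lemma issec_eq s s' x (U : opens T) : U x -> (forall y, U y -> s y = s' y) ->
  issec s x -> issec s' x.
Proof.
move=> Ux ss [V [t [Vx st]]]; exists (opensI V U), (res F (@opensIl _ _ _) t).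
split=> // y [Vy Uy]; rewrite -ss // (st y Vy).
by rewrite (germ_at_res Vy).
Qed.

Lemma issec_zero s x (U : opens T) : U x -> (forall y, U y -> s y = 0) -> issec s x.
Proof. by move=> Ux s0; apply: (issec_eq Ux _ (issec0 x)) => y Uy; rewrite s0. Qed.

Lemma issec_germ0 s x : issec s x -> s x = 0 ->
  exists2 U : opens T, U x & forall y, U y -> s y = 0.
Proof.
move=> [U [t [Ux st]]] s0.
have : germ_at Ux t = germ_at Ux 0 by rewrite -st s0 linear0.
move=> /germ_atP[W [WU [WV [Wx e]]]]; exists W => // y Wy.
by rewrite (st y (WU y Wy)) -(germ_at_res _ Wy WU) e linear0 linear0.
Qed.

End Presheaf.

Section Sheaf.
Variable F : sheaf K T.

Lemma germ_sep (U : opens T) (t t' : F U) :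
  (forall y (Uy : U y), germ_at Uy t = germ_at Uy t') -> t = t'.
Proof.
move=> h.
have ex (y : set_type U) : exists W : opens T, exists WU : W `<=` U,
    W (val y) /\ res F WU t = res F WU t'.
  have /germ_atP[W [WU [WV [Wx e]]]] := h _ (set_mem (valP y)).
  exists W, WU; split=> //; rewrite e; congr (res F _ t').
  exact: Prop_irrelevance.
have [W hW] := choice ex.
have WU y : W y `<=` U by have [] := hW y.
have hWU y : W y (val y) /\ res F (WU y) t = res F (WU y) t'.
  have [WU' [Wy e]] := hW y; split=> //.
  by rewrite (Prop_irrelevance (WU y) WU').
have cov : U `<=` \bigcup_y W y.
  by move=> y Uy; exists (exist _ y (mem_set Uy)) => //; have [] := hWU (exist _ y (mem_set Uy)).
have [|t0 [_ uniq]] := @sheafP K T F _ U W WU (fun y => res F (WU y) t) cov.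
  move=> i j; rewrite (res_comp (WU i) _ (subset_trans (@opensIl _ _ _) (WU i))).
  exact/esym/res_comp.
rewrite -(uniq t) // -(uniq t') // => i.
by have [_ ->] := hWU i.
Qed.

(** The local sections agree on overlaps since their germs do. *)
Lemma glue (U : opens T) (s : dsections F) : (forall x, U x -> issec s x) ->
  exists t : F U, forall y (Uy : U y), s y = germ_at Uy t.
Proof.
move=> h.
have ex (y : set_type U) : exists V : opens T, exists t : F V,
    [/\ V `<=` U, V (val y) & forall z (Vz : V z), s z = germ_at Vz t].
  have [V [t [Vy st]]] := h _ (set_mem (valP y)).
  exists (opensI V U), (res F (@opensIl _ _ _) t); split.
  - exact: opensIr.
  - by split=> //; exact: set_mem (valP y).
  by move=> z [Vz Uz]; rewrite (germ_at_res Vz).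
have [V hV] := choice ex.
pose t y := projT1 (cid (hV y)); have ht y := projT2 (cid (hV y)); rewrite -/(t _) in ht.
have VU y : V y `<=` U by have [] := ht y.
have cov : U `<=` \bigcup_y V y.
  by move=> y Uy; exists (exist _ y (mem_set Uy)) => //; have [] := ht (exist _ y (mem_set Uy)).
have [|t0 [t0E _]] := @sheafP K T F _ U V VU t cov.
  move=> i j; apply: germ_sep => y [Viy Vjy].
  rewrite (germ_at_res Viy) (germ_at_res Vjy).
  have [_ _ <-] := ht i; have [_ _ <-] := ht j; by [].
exists t0 => y Uy; pose i : set_type U := exist _ y (mem_set Uy).
have [_ Vy hi] := ht i.
by rewrite (hi y Vy : _ = germ_at Vy (t i)) -(t0E i) (germ_at_res Uy).
Qed.

End Sheaf.
End PresheafSections.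

(** * First cohomology through families of germs *)

Section FirstCohomology.
Variables (K : fieldType) (T : topologicalType).

Section QuotientGerms.
Variable F : presheaf K T.
Implicit Types (s : dsections F) (x y : T).

Definition dsec s (U : opens T) : godement0 F U :=
  lsub_in (S := all_families F U) (v := fun y : set_type U => s (val y)) I.

Lemma dsec_res s (U V : opens T) (VU : V `<=` U) : res (godement0 F) VU (dsec s U) = dsec s V.
Proof. by apply: val_inj. Qed.

Lemma dsec_linear U : linear (fun s => dsec s U).
Proof. by move=> a s t; apply: val_inj. Qed.

Lemma dsec_ex (U : opens T) (t : godement0 F U) : exists s, t = dsec s U.
Proof.
pose s y : stalk F y := if pselect (U y) is left Uy then lsub_val t (exist _ y (mem_set Uy)) else 0.
exists (s : dsections F); apply: val_inj; apply: functional_extensionality_dep => -[y yU] /=.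
rewrite /s; case: pselect => [Uy|nU]; last by case: nU; exact: set_mem.
exact: (family_irr (E := stalk F) (lsub_val t)).
Qed.

(** The germ at [x] of the class of [s] in the quotient of the sheaf of
    discontinuous sections by [F]. *)
Definition quot_germ s x : stalk (coker_presheaf F) x :=
  germ_at (F := coker_presheaf F) (I : opensT T x)
    (lpi (godement_im F (opensT T)) (dsec s (opensT T))).

Lemma quot_germ_linear x : linear (quot_germ^~ x).
Proof.
by move=> a s t; rewrite /quot_germ dsec_linear lpi_linear germ_at_linear.
Qed.

Lemma quot_germB s t x : quot_germ (s - t) x = quot_germ s x - quot_germ t x.
Proof.
have -> : s - t = -1 *: t + s by rewrite scaleN1r addrC.
by rewrite (quot_germ_linear x (-1) t s) scaleN1r addrC.
Qed.

Lemma quot_germ_germ s x (U : opens T) (Ux : U x) :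
  quot_germ s x = germ_at (F := coker_presheaf F) Ux (lpi (godement_im F U) (dsec s U)).
Proof.
have UT : U `<=` opensT T by exact: subsetT.
rewrite /quot_germ -(@germ_at_res K T (coker_presheaf F) x (opensT T) U I Ux UT).
congr germ_at; rewrite /= (lquot_mapE (godement_im_res UT)).
by congr lpi; exact: dsec_res.
Qed.

Lemma quot_germ0P s x : quot_germ s x = 0 <-> issec s x.
Proof.
split.
  move=> k0.
  have : germ_at (F := coker_presheaf F) (I : opensT T x)
    (lpi (godement_im F (opensT T)) (dsec s (opensT T))) =
    germ_at (F := coker_presheaf F) (I : opensT T x) 0 by rewrite linear0; exact: k0.
  move=> /germ_atP[W [WU [WV [Wx e]]]].
  move: e; rewrite linear0 /= (lquot_mapE (godement_im_res WU)).
  rewrite -[0](linear0 (linear_of (lpi_linear (godement_im F W)))) => /lpi_eq.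
  rewrite subr0 => -[t _ tE]; exists W, t; split=> // y Wy.
  have e := congr1 (fun f : godement0 F W => lsub_val f (exist _ y (mem_set Wy))) tE.
  exact: etrans (esym e) (germ_at_irr _ _ _).
move=> [U [t [Ux st]]]; rewrite (quot_germ_germ _ Ux).
have -> : lpi (godement_im F U) (dsec s U) = 0; last exact: linear0.
rewrite -[RHS](linear0 (linear_of (lpi_linear (godement_im F U)))); apply/lpi_eq.
rewrite subr0; exists t => //; apply: val_inj; apply: functional_extensionality_dep => y.
by rewrite /= (st _ (set_mem (valP y))).
Qed.

Lemma quot_germ_eqP s t x : quot_germ s x = quot_germ t x <-> issec (s - t) x.
Proof.
rewrite -quot_germ0P quot_germB; split=> [->|/eqP]; first by rewrite subrr.
by rewrite subr_eq0 => /eqP.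
Qed.

Lemma quot_germ_surj x (g : stalk (coker_presheaf F) x) : exists s, g = quot_germ s x.
Proof.
have [U [Ux [q ->]]] := germ_at_surj g.
have [s sE] := dsec_ex (repr q : godement0 F U).
by exists s; rewrite (quot_germ_germ _ Ux) -sE lpiK.
Qed.

Lemma syzygy_val_germ0 (U : opens T) (z : syzygy F U) x (Ux : U x) :
  germ_at Ux z = 0 -> lsub_val z (exist _ x (mem_set Ux)) = 0.
Proof.
move=> h; have : germ_at Ux z = germ_at Ux 0 by rewrite linear0.
move=> /germ_atP[W [WU [WV [Wx e]]]].
have e' := congr1 (fun f : syzygy F W => lsub_val f (exist _ x (mem_set Wx))) e.
rewrite linear0 in e'; apply: (etrans _ e').
exact: (family_irr (E := fun y => stalk (coker_presheaf F) (id y)) (lsub_val z)).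
Qed.

End QuotientGerms.

Section Representation.
Variables (F : sheaf K T) (Phi : @support_family T).
Implicit Types (s : dsections F) (c : T -> dsections F) (x y : T).

Definition locally_constant c := forall x, exists2 U : opens T, U x &
  forall y, U y -> issec (c y - c x) y.

Definition off (P : T -> Prop) := exists A : set T, [/\ closed A, Phi A & forall y, ~ A y -> P y].

(** A cocycle is a section of the quotient of the sheaf [C] of discontinuous
    sections by [F].  It is given by a representative [c x] of its germ at each
    point [x], subject to local compatibility; it is a coboundary if one
    discontinuous section represents all these germs.  In this form no quotients
    or germs of germs are left, and cochains can be pushed from one space to
    another by hand. *)
Definition cocyc c := locally_constant c /\ off (fun y => issec (c y) y).

Definition cobound c := exists s, off (fun y => s y = 0) /\ forall x, issec (c x - s) x.

Let zfam c : Defs.family (fun y => stalk (coker_presheaf F) (id y)) (opensT T) :=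
  fun y : set_type (opensT T) => quot_germ (c (val y)) (val y).

Let zfam_ind c : locally_constant c -> inverse_image_lsub id (coker_presheaf F) (opensT T) (zfam c).
Proof.
move=> lc x _; have [U Ux hU] := lc x.
exists U, (opensT T), (lpi (godement_im F (opensT T)) (dsec (c x) (opensT T))).
split=> // y Vy Uy; transitivity (quot_germ (c x) (val y)); last exact: germ_at_irr.
by apply/quot_germ_eqP; exact: hU.
Qed.

Let zsec c (lc : locally_constant c) : syzygy F (opensT T) := lsub_in (zfam_ind lc).

Lemma off_supp (G : presheaf K T) (t : godement0 G (opensT T)) :
  off (fun y => lsub_val t (exist _ y (mem_set I)) = 0) <-> Phi (supp t).
Proof.
split.
  move=> [A [cA PA hA]]; apply: (@support_sub T Phi A _ PA (@supp_closed _ _ _ t)) => x.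
  rewrite /supp /= => /eqP nz; apply: contrapT => nA; apply: nz.
  rewrite -[0](linear0 (germ_at (I : opensT T x))).
  apply/germ_atP; exists (Opens (closed_openC cA)), (fun _ _ => I), (fun _ _ => I).
  split=> //; apply: val_inj; apply: functional_extensionality_dep => -[y Ay] /=.
  rewrite /family_res /= -[RHS](hA y (set_mem Ay)).
  exact: (family_irr (E := stalk G) (lsub_val t)).
move=> Ps; exists (supp t); split=> //; first exact: supp_closed.
move=> y ny; have : germ_at (I : opensT T y) t = 0.
  by apply/eqP/negPn/negP => h; apply: ny.
rewrite -[0](linear0 (germ_at (I : opensT T y))).
move=> /germ_atP[W [WU [WV [Wx e]]]].
have := congr1 (fun f : godement0 G W => lsub_val f (exist _ y (mem_set Wx))) e.
rewrite /= /family_res /= => h; rewrite -[RHS]h.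
exact: (family_irr (E := stalk G) (lsub_val t)).
Qed.

Lemma diff0P (G : presheaf K T) (s : dsections G) :
  godement_unit (F := syzygy G) (inverse_image_unit id (F := coker_presheaf G)
    (lpi (godement_im G (opensT T)) (dsec s (opensT T)))) = 0 ->
  forall x, issec s x.
Proof.
move=> h x; apply/quot_germ0P.
set z := inverse_image_unit _ _ in h.
have e : germ_at (F := syzygy G) (I : opensT T x) z = 0.
  have := congr1 (fun f : godement0 (syzygy G) (opensT T) =>
    lsub_val f (exist _ x (mem_set I))) h.
  exact: etrans (germ_at_irr _ _ _).
have := syzygy_val_germ0 e; apply: etrans; exact: germ_at_irr.
Qed.

Let zg c (lc : locally_constant c) : godement F 1 (opensT T) :=
  godement_unit (F := syzygy F) (zsec lc).

Let zsec_germ c (lc : locally_constant c) y :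
  germ_at (F := syzygy F) (I : opensT T y) (zsec lc) = 0 <-> 
  exists2 W : opens T, W y & forall x, W x -> issec (c x) x.
Proof.
split.
  move=> h; have : germ_at (F := syzygy F) (I : opensT T y) (zsec lc) =
      germ_at (F := syzygy F) (I : opensT T y) 0 by rewrite linear0.
  move=> /germ_atP[W [WU [WV [Wy e]]]]; exists W => // x Wx; apply/quot_germ0P.
  have e' := congr1 (fun f : syzygy F W => lsub_val f (exist _ x (mem_set Wx))) e.
  rewrite linear0 in e'; exact: e'.
move=> [W Wy hW]; rewrite -[RHS](linear0 (germ_at (F := syzygy F) (I : opensT T y))).
apply/germ_atP; exists W, (fun _ _ => I), (fun _ _ => I); split=> //.
rewrite linear0; apply: val_inj; apply: functional_extensionality_dep => -[x Wx] /=.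
by apply/quot_germ0P; apply: hW; exact: set_mem.
Qed.

Let zg_val c (lc : locally_constant c) y (p : y \in [set: T]) :
  lsub_val (zg lc) (exist _ y p) = germ_at (F := syzygy F) (I : opensT T y) (zsec lc).
Proof. exact: germ_at_irr. Qed.

Let zg_cocycle c (hc : cocyc c) : cocycles Phi F 1 (zg hc.1).
Proof.
have [lc [A [cA PA hA]]] := hc; split.
  apply/off_supp; exists A; split=> // y nA.
  have oA : open (~` A) by exact: closed_openC.
  by rewrite zg_val; apply/zsec_germ; exists (Opens oA).
rewrite /lker /= /preimage /= /godement_diff.
have -> : lpi (godement_im (syzygies F 1) (opensT T)) (zg hc.1) = 0.
  rewrite -[RHS](linear0 (linear_of (lpi_linear (godement_im (syzygies F 1) (opensT T))))).
  by apply/lpi_eq; rewrite subr0; exists (zsec hc.1).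
by rewrite !linear0.
Qed.

Let zg_ex (t : godement F 1 (opensT T)) : cocycles Phi F 1 t ->
  exists c (hc : cocyc c), t = zg hc.1.
Proof.
move=> [supt dt].
have [s sE] := dsec_ex (F := syzygy F) t.
have sh : forall x, issec (F := syzygy F) s x.
  by apply: diff0P; rewrite -sE; exact: dt.
have [z zE] := glue (F := syzygy F) (U := opensT T) (fun x _ => sh x).
have ex x : exists s' : dsections F, lsub_val z (exist _ x (mem_set I)) = quot_germ s' x.
  have [s' h] := quot_germ_surj (lsub_val z (exist _ x (mem_set (I : opensT T x)))); by exists s'.
have [c cE] := choice ex.
have zl : inverse_image_lsub id (coker_presheaf F) (opensT T) (lsub_val z) := lsub_valP z.
have zval y (p : y \in [set: T]) : lsub_val z (exist _ y p) = quot_germ (c y) y.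
  rewrite -cE; exact: (family_irr (E := fun y => stalk (coker_presheaf F) (id y)) (lsub_val z)).
have lc : locally_constant c.
  move=> x; have [W [V [t' [Wx WV ind]]]] := zl x I.
  have Vx : V x by exact: WV.
  have e0 : germ_at Vx t' = quot_germ (c x) x.
    by rewrite -(ind (exist _ x (mem_set I)) Vx Wx) zval.
  have /germ_atP[W' [W'V [W'T [W'x e]]]] := e0.
  exists (opensI W W'); first by split.
  move=> y [Wy W'y]; apply/quot_germ_eqP.
  rewrite -(zval y (mem_set I)) (ind (exist _ y (mem_set I)) (WV y Wy) Wy) /=.
  rewrite -(germ_at_res _ W'y W'V) e; exact: germ_at_res.
have zc : z = zsec lc.
  apply: val_inj; apply: functional_extensionality_dep => -[y yT].
  exact: zval.
have tz : t = zg lc.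
  rewrite sE; apply: val_inj; apply: functional_extensionality_dep => -[y yT] /=.
  by rewrite (zE y I) zc; exact: germ_at_irr.
have hc : cocyc c.
  split=> //; have /off_supp[A [cA PA hA]] := supt.
  exists A; split=> // y nA; have := hA y nA.
  rewrite tz => h0.
  by move: h0; rewrite zg_val => /zsec_germ[W Wy hW]; exact: hW.
exists c, hc; rewrite tz; congr zg; exact: Prop_irrelevance.
Qed.

Let zg_cobound c (hc : cocyc c) : coboundaries Phi F 1 (zg hc.1) <-> cobound c.
Proof.
split.
  move=> [t supt tE]; have [s sE] := dsec_ex (F := F) t.
  exists s; split.
    have /off_supp[A [cA PA hA]] := supt; exists A; split=> // y nA.
    by have := hA y nA; rewrite sE.
  move=> x; apply/quot_germ_eqP.
  have tE' : godement_unit (F := syzygy F) (inverse_image_unit id (F := coker_presheaf F)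
    (lpi (godement_im F (opensT T)) (dsec s (opensT T)))) = godement_unit (F := syzygy F) (zsec hc.1).
    by rewrite -sE; exact: tE.
  set z1 := inverse_image_unit _ _ in tE'.
  have e : z1 = zsec hc.1.
    apply: germ_sep => y Uy.
    have h := congr1 (fun f : godement0 (syzygy F) (opensT T) =>
      lsub_val f (exist _ y (mem_set I))) tE'.
    apply: etrans (germ_at_irr _ _ _) (etrans h _); exact: germ_at_irr.
  have := congr1 (fun f : syzygy F (opensT T) => lsub_val f (exist _ x (mem_set I))) e.
  move=> /esym h; apply: etrans h _; exact: germ_at_irr.
move=> [s [[A [cA PA hA]] hs]].
exists (dsec s (opensT T)).
  by apply/off_supp; exists A; split=> // y nA; exact: hA.
suff e : inverse_image_unit id (F := coker_presheaf F)
    (lpi (godement_im F (opensT T)) (dsec s (opensT T))) = zsec hc.1.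
  by rewrite /godement_diff; congr godement_unit; exact: e.
apply: val_inj; apply: functional_extensionality_dep => -[y yT] /=.
apply: (@etrans _ _ (quot_germ s y)); first exact: germ_at_irr.
by apply/esym/quot_germ_eqP; exact: hs.
Qed.

Let H1 := cohomology_with_supports Phi F 1.

Definition cocycle_class c : H1 :=
  if pselect (cocyc c) is left hc then lpi _ (lsub_in (zg_cocycle hc)) else 0.

Lemma cocycle_class_surj (h : H1) : exists2 c, cocyc c & h = cocycle_class c.
Proof.
have [c [hc hE]] := zg_ex (lsub_valP (repr h)).
exists c => //; rewrite /cocycle_class; case: pselect => // hc'.
rewrite -[LHS]lpiK; congr lpi; apply: val_inj; rewrite /= hE.
by congr zg; exact: Prop_irrelevance.
Qed.

Lemma cocycle_class_eq0 c : cocyc c -> cocycle_class c = 0 <-> cobound c.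
Proof.
move=> hc; rewrite /cocycle_class; case: pselect => // hc'.
rewrite -(zg_cobound hc').
set S := lpreim _ _.
have e0 : lpi S 0 = 0 by exact: (linear0 (linear_of (lpi_linear S))).
rewrite -[X in _ = X]e0; split=> [/lpi_eq|h]; first by rewrite subr0.
by apply/lpi_eq; rewrite subr0.
Qed.

Lemma cocycP a c c' : cocyc c -> cocyc c' -> cocyc (fun x => a *: c x + c' x).
Proof.
move=> [lc [A [cA PA hA]]] [lc' [A' [cA' PA' hA']]]; split.
  move=> x; have [U Ux hU] := lc x; have [U' U'x hU'] := lc' x.
  exists (opensI U U') => [//|y [Uy U'y]].
  have -> : a *: c y + c' y - (a *: c x + c' x) = a *: (c y - c x) + (c' y - c' x).
    by rewrite scalerBr opprD addrACA.
  by apply: issecP; [exact: hU|exact: hU'].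
exists (A `|` A'); split; [exact: closedU|exact: supportU|].
move=> y nA; apply: issecP; [apply: hA|apply: hA'] => h; apply: nA; [by left|by right].
Qed.

Lemma cocycle_class_linear a c c' : cocyc c -> cocyc c' ->
  cocycle_class (fun x => a *: c x + c' x) = a *: cocycle_class c + cocycle_class c'.
Proof.
move=> hc hc'; have hcc := cocycP a hc hc'.
rewrite /cocycle_class; case: pselect => // h1; case: pselect => // h2; case: pselect => // h3.
rewrite -lpi_linear; congr lpi; apply: val_inj.
transitivity (a *: zg h2.1 + zg h3.1); last by [].
rewrite -[RHS](godement_unit_linear (F := syzygy F)).
rewrite /= /zg; congr godement_unit; apply: val_inj.
apply: functional_extensionality_dep => y; exact: quot_germ_linear.
Qed.

End Representation.
End FirstCohomology.

(** * Restriction of sheaves to an open set *)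

Section Isomorphic.
Variables (K : fieldType) (T : topologicalType).
Implicit Types F G H : presheaf K T.

Lemma isomorphic_sym F G : isomorphic F G -> isomorphic G F.
Proof.
move=> [phi [nat bij]].
have ex U : exists psi : {linear G U -> F U}, cancel (phi U) psi /\ cancel psi (phi U).
  have [psi phiK psiK] := bij U.
  have lin : linear psi by move=> a x y; apply: (can_inj phiK); rewrite linearP !psiK.
  by exists (linear_of lin).
pose psi U := projT1 (cid (ex U)).
have psiK U : cancel (phi U) (psi U) := (projT2 (cid (ex U))).1.
have phiK U : cancel (psi U) (phi U) := (projT2 (cid (ex U))).2.
exists psi; split=> [U V VU s|U]; last exact: Bijective (phiK U) (psiK U).
apply: (can_inj (psiK V)); by rewrite phiK nat phiK.
Qed.

Lemma isomorphic_trans F G H : isomorphic F G -> isomorphic G H -> isomorphic F H.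
Proof.
move=> [phi [nat bij]] [psi [nat' bij']].
have lin U : linear (psi U \o phi U) by move=> a x y /=; rewrite !linearP.
exists (fun U => linear_of (lin U)); split=> [U V VU s|U].
  by rewrite /= nat nat'.
exact: (bij_comp (bij' U) (bij U)).
Qed.

End Isomorphic.

Section Transport.
Variables (K : fieldType) (T : topologicalType) (A : opens T).
Local Notation S := (set_type A).
Local Notation i := (set_val : S -> T).
Variables (G : sheaf K S) (F : sheaf K T).

Lemma image_open (V : set S) : open V -> open (i @` V).
Proof.
move=> [B oB <-].
have -> : i @` (i @^-1` B) = B `&` A.
  apply/seteqP; split=> [_ [y By <-]|x [Bx Ax]].
    by split=> //; exact: set_mem (valP y).
  by exists (exist _ x (mem_set Ax)).
by apply: openI => //; exact: opens_open.
Qed.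

Definition opens_image (V : opens S) : opens T := Opens (image_open (opens_open V)).

Lemma preim_open (V : set T) : open V -> open (i @^-1` V).
Proof. by move=> oV; exists V. Qed.

Definition opens_preimage (V : opens T) : opens S := Opens (preim_open (opens_open V)).

Hypothesis iso : isomorphic G (inverse_image i F).

(** The isomorphism is used only through the induced isomorphisms of stalks and
    the fact that they match the families of germs that come from sections.  The
    second clause is local in the base, so families on [S] and on [T] need only
    correspond near the point. *)
Lemma stalk_iso : exists (th : forall y : S, {linear stalk G y -> stalk F (i y)}),
  (forall y, bijective (th y)) /\
  forall (s : dsections G) (d : dsections F) y (N : opens S), N y ->
    (forall y', N y' -> th y' (s y') = d (i y')) -> issec s y <-> issec d (i y).
Proof.
have [psi [nat bij]] := iso.
pose ev (y : S) (U : opens S) (Uy : U y) (s : G U) : stalk F (i y) :=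
  lsub_val (psi U s) (exist _ y (mem_set Uy)).
have ev_res y (U V : opens S) (Uy : U y) (Vy : V y) (VU : V `<=` U) s :
    ev y V Vy (res G VU s) = ev y U Uy s.
  rewrite /ev nat /=; exact: (family_irr (E := fun y => stalk F (i y)) (lsub_val (psi U s))).
have ev_irr y (U : opens S) (p q : U y) s : ev y U p s = ev y U q s.
  by congr ev; exact: Prop_irrelevance.
have ev_eq y (U V : opens S) (Uy : U y) (Vy : V y) s t :
    germ_at Uy s = germ_at Vy t <-> ev y U Uy s = ev y V Vy t.
  split=> [/germ_atP[W [WU [WV [Wy e]]]]|e].
    by rewrite -(ev_res y U W Uy Wy WU) e ev_res.
  have lU : inverse_image_lsub i F U (lsub_val (psi U s)) := lsub_valP (psi U s).
  have lV : inverse_image_lsub i F V (lsub_val (psi V t)) := lsub_valP (psi V t).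
  have [W1 [B1 [t1 [W1y WB1 h1]]]] := lU y Uy.
  have [W2 [B2 [t2 [W2y WB2 h2]]]] := lV y Vy.
  have g12 : germ_at (WB1 y W1y : B1 (i y)) t1 = germ_at (WB2 y W2y : B2 (i y)) t2.
    rewrite -(h1 (exist _ y (mem_set Uy)) (WB1 y W1y) W1y).
    by rewrite -(h2 (exist _ y (mem_set Vy)) (WB2 y W2y) W2y).
  have /germ_atP[B [BB1 [BB2 [By eB]]]] := g12.
  pose W := opensI (opensI (opensI U V) (opensI W1 W2)) (opens_preimage B).
  have Wy : W y by split; [split; split|].
  have WU : W `<=` U by move=> z [[[]]].
  have WV : W `<=` V by move=> z [[[]]].
  have eW : res G WU s = res G WV t.
    apply: (bij_inj (bij W)); apply: val_inj; apply: functional_extensionality_dep => -[z Wz].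
    rewrite !nat; have [[[Uz Vz] [W1z W2z]] Bz] := set_mem Wz.
    transitivity (germ_at (WB1 z W1z : B1 (i z)) t1).
      rewrite -(h1 (exist _ z (mem_set Uz)) (WB1 z W1z) W1z) /=.
      exact: (family_irr (E := fun y => stalk F (i y)) (lsub_val (psi U s))).
    transitivity (germ_at (WB2 z W2z : B2 (i z)) t2).
      by rewrite -(germ_at_res _ (Bz : B (i z)) BB1) eB; exact: germ_at_res.
    rewrite -(h2 (exist _ z (mem_set Vz)) (WB2 z W2z) W2z) /=.
    exact: (family_irr (E := fun y => stalk F (i y)) (lsub_val (psi V t))).
  by apply/germ_atP; exists W, WU, WV.
have th_ex y (g : stalk G y) : exists a : stalk F (i y),
    forall (U : opens S) (Uy : U y) s, g = germ_at Uy s -> a = ev y U Uy s.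
  have [U [Uy [s ->]]] := germ_at_surj g.
  by exists (ev y U Uy s) => V Vy t /ev_eq.
pose th0 y g := projT1 (cid (th_ex y g)).
have th0E y (U : opens S) (Uy : U y) s : th0 y (germ_at Uy s) = ev y U Uy s.
  exact: (projT2 (cid (th_ex y (germ_at Uy s)))).
have th_lin y : linear (th0 y).
  move=> a g g'; have [U [Uy [s ->]]] := germ_at_surj g.
  have [V [Vy [t ->]]] := germ_at_surj g'.
  have Wy : opensI U V y by split.
  rewrite -(germ_at_res Uy Wy (@opensIl _ _ _)) -(germ_at_res Vy Wy (@opensIr _ _ _)).
  rewrite -germ_at_linear !th0E /ev linearP //.
pose th y := linear_of (th_lin y).
have th_inj y : injective (th y).
  move=> g g'; have [U [Uy [s ->]]] := germ_at_surj g.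
  have [V [Vy [t ->]]] := germ_at_surj g'.
  by rewrite /= !th0E => h; apply/ev_eq.
have sec_of (V : opens T) (t : F V) : exists g : G (opens_preimage V),
    forall y (Uy : opens_preimage V y), ev y _ Uy g = germ_at (Uy : V (i y)) t.
  have loc : inverse_image_lsub i F (opens_preimage V)
      (fun y : set_type (opens_preimage V) => germ_at (set_mem (valP y) : V (i (val y))) t).
    move=> y Vy; exists (opens_preimage V), V, t; split=> // z Vz _; exact: germ_at_irr.
  have [psi' _ psiK] := bij (opens_preimage V).
  exists (psi' (lsub_in loc)) => y Uy; rewrite /ev psiK; exact: germ_at_irr.
have th_surj y (a : stalk F (i y)) : exists g, th y g = a.
  have [V [Vy [t ->]]] := germ_at_surj a.
  have [g hg] := sec_of V t.
  by exists (germ_at (Vy : opens_preimage V y) g); rewrite /= th0E hg.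
exists th; split.
  move=> y; have [f hf] := choice (@th_surj y).
  by exists f => [g|a]; [apply: (th_inj y); rewrite hf|exact: hf].
move=> s d y N Ny sd; split.
  move=> [U [g [Uy sg]]].
  have lU : inverse_image_lsub i F U (lsub_val (psi U g)) := lsub_valP (psi U g).
  have [W1 [B1 [t1 [W1y WB1 h1]]]] := lU y Uy.
  pose W := opens_image (opensI (opensI U W1) N).
  have WB : opensI W B1 `<=` B1 by exact: opensIr.
  exists (opensI W B1), (res F WB t1); split.
    by split; [exists y|exact: WB1].
  move=> x [Wx Bx]; rewrite (germ_at_res Bx).
  case: Wx Bx => z [[Uz W1z] Nz] zx; rewrite -zx => Bz.
  rewrite -(sd z Nz) (sg z Uz) /= th0E /ev.
  exact: (h1 (exist _ z (mem_set Uz)) Bz W1z).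
move=> [V [t [Vy dt]]].
have [g hg] := sec_of V t.
pose U := opensI (opens_preimage V) N.
have Uy : U y by split.
exists U, (res G (@opensIl _ _ _) g); split=> // z [Vz Nz].
rewrite (germ_at_res (Vz : opens_preimage V z)); apply: (th_inj z).
by rewrite sd // (dt (i z) Vz) /= th0E hg.
Qed.

End Transport.

(** * Extension by zero *)

Section Restricted.
Variables (K : fieldType) (T : topologicalType) (F : sheaf K T).

Definition global_germs (t : F (opensT T)) : dsections F :=
  fun x => germ_at (I : opensT T x) t.

Lemma global_germs_issec t x : issec (global_germs t) x.
Proof. by exists (opensT T), t; split=> // y Uy; exact: germ_at_irr. Qed.

Lemma induced_on (Z : set T) (s : dsections F) : (forall x, Z x -> issec s x) ->
  inverse_image_lsub (set_val : Z -> T) F (opensT (set_type Z))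
    (fun y : set_type (opensT (set_type Z)) => s (set_val (val y))).
Proof.
move=> hs y _; have Zy : Z (set_val y) by exact: set_mem (valP y).
have [V [t [Vy st]]] := hs _ Zy.
have oV : open ((set_val : Z -> T) @^-1` V) by exists V => //; exact: opens_open.
by exists (Opens oV), V, t; split=> // z Vz _; exact: st.
Qed.

End Restricted.

Section ExtensionByZero.
Variables (K : fieldType) (T : topologicalType) (A : opens T).
Local Notation S := (set_type A).
Local Notation i := (set_val : S -> T).
Variables (G : sheaf K S) (F : sheaf K T).

Lemma compact_preimage (B : set T) : compact B -> B `<=` A -> compact (i @^-1` B).
Proof.
move=> cB BA Fl PFl FB.
have [x [Bx clx]] := cB (i @ Fl) _ FB.
have Ax : A x by exact: BA.
exists (exist _ x (mem_set Ax)); split=> // P Q FP.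
rewrite nbhsE => -[V' [[U oU UV'] V'x] V'Q].
have Ux : U x by move: V'x; rewrite -UV'.
have h1 : (i @ Fl) (i @` P).
  by apply: (@filterS _ Fl _ P) => // z Pz; exists z.
have [y [[z Pz zy] Uy]] := clx _ _ h1 (open_nbhs_nbhs (conj oU Ux)).
rewrite -zy in Uy.
by exists z; split=> //; apply: V'Q; rewrite -UV'.
Qed.

Lemma set_val_cont : continuous i.
Proof. exact: initial_continuous. Qed.

Lemma compact_image (B : set S) : compact B -> compact (i @` B).
Proof.
by move=> cB; apply: continuous_compact => //; apply: continuous_subspaceT => y; exact: set_val_cont.
Qed.

Variable th : forall y : S, {linear stalk G y -> stalk F (i y)}.
Hypothesis thbij : forall y, bijective (th y).
Hypothesis thP : forall (s : dsections G) (d : dsections F) y (N : opens S), N y ->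
    (forall y', N y' -> th y' (s y') = d (i y')) -> issec s y <-> issec d (i y).

Definition ext_germs (s : dsections G) : dsections F := fun x =>
  if pselect (A x) is left Ax then th (exist _ x (mem_set Ax)) (s (exist _ x (mem_set Ax)))
  else 0.

Lemma ext_germs_val s y : ext_germs s (i y) = th y (s y).
Proof.
rewrite /ext_germs; case: y => x xA /=; case: pselect => [Ax|nA]; last by case: nA; exact: set_mem.
by rewrite (bool_irrelevance (mem_set Ax) xA).
Qed.

Lemma ext_germs_linear : linear ext_germs.
Proof.
move=> a s t; apply: functional_extensionality_dep => x.
transitivity (a *: ext_germs s x + ext_germs t x); last by [].
rewrite /ext_germs; case: pselect => [Ax|_]; last by rewrite scaler0 addr0.
by rewrite -linearP.
Qed.

Lemma ext_germs_issec s y : issec (ext_germs s) (i y) <-> issec s y.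
Proof.
apply: iff_sym; apply: (thP (N := opensT S)) => // y' _.
by rewrite ext_germs_val.
Qed.

Definition pull (d : dsections F) : dsections G := fun y =>
  projT1 (cid (let: Bijective f _ fK := thbij y in ex_intro (fun a => th y a = d (i y)) (f (d (i y))) (fK _))).

Lemma pull_val d y : th y (pull d y) = d (i y).
Proof. by rewrite /pull; case: cid. Qed.

Lemma pull_issec d y : issec (pull d) y <-> issec d (i y).
Proof. by apply: (thP (N := opensT S)) => // y' _; rewrite pull_val. Qed.

Hypothesis hT : hausdorff_space T.
Hypothesis cT : compact [set: T].

Definition ext_cochain (c : S -> dsections G) : T -> dsections F := fun x =>
  if pselect (A x) is left Ax then ext_germs (c (exist _ x (mem_set Ax))) else 0.

Lemma ext_cochain_val c y : ext_cochain c (i y) = ext_germs (c y).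
Proof.
rewrite /ext_cochain; case: y => x xA /=; case: pselect => [Ax|nA]; last by case: nA; exact: set_mem.
by rewrite (bool_irrelevance (mem_set Ax) xA).
Qed.

Lemma ext_cochain_out c x : ~ A x -> ext_cochain c x = 0.
Proof. by rewrite /ext_cochain; case: pselect. Qed.

Lemma ext_cochain_linear a c c' : ext_cochain (fun y => a *: c y + c' y) = (fun x => a *: ext_cochain c x + ext_cochain c' x).
Proof.
apply/funext => x; rewrite /ext_cochain; case: pselect => [Ax|_]; first exact: ext_germs_linear.
by rewrite scaler0 addr0.
Qed.

Lemma ext_germsB s t : ext_germs s - ext_germs t = ext_germs (s - t).
Proof.
have -> : s - t = -1 *: t + s by rewrite scaleN1r addrC.
by rewrite ext_germs_linear scaleN1r addrC.
Qed.

Lemma in_or_out x : (exists y : S, x = i y) \/ ~ A x.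
Proof.
have [Ax|] := pselect (A x); last by right.
by left; exists (exist _ x (mem_set Ax)).
Qed.

(** Outside the compact support the extended cochain is trivial; the support is
    closed in [T] because [T] is Hausdorff, so its complement is a neighbourhood
    of each point outside [A]. *)
Lemma ext_cochain_cocyc c : cocyc (@compact_supports S) c -> cocyc (@closed_supports T) (ext_cochain c).
Proof.
move=> [lc [B [cB /= kB hB]]].
have clB : closed (i @` B) by apply: compact_closed => //; exact: compact_image.
have outB y : ~ (i @` B) (i y) -> issec (ext_germs (c y)) (i y).
  by move=> nB; apply/ext_germs_issec; apply: hB => By; apply: nB; exists y.
split; last by exists setT; split=> //=; exact: closedT.
move=> x; case: (in_or_out x) => [[y ->]|nA].
  have [U Uy hU] := lc y.
  exists (opens_image U); first by exists y.
  move=> _ [z Uz <-]; rewrite !ext_cochain_val ext_germsB; apply/ext_germs_issec; exact: hU.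
exists (Opens (closed_openC clB)).
  by move=> [y _ yx]; apply: nA; rewrite -yx; exact: set_mem (valP y).
move=> z nz; rewrite (ext_cochain_out _ nA) subr0; case: (in_or_out z) => [[y zE]|nA'].
  by rewrite zE ext_cochain_val; apply: outB; rewrite -zE.
by rewrite ext_cochain_out //; exact: issec0.
Qed.

Variable Z : set T.
Hypothesis AZ : forall x, A x <-> ~ Z x.

(** If [s] cobounds the extension, then near [Z] the cochain is trivial and [s] is a
    section of [F] there.  By hypothesis it has the same germs along [Z] as a
    global section [t].  Then [s - t] vanishes near [Z], and its restriction to
    [A] cobounds [c] with compact support. *)
Lemma ext_cochain_cobound c :
  (forall t : inverse_image (set_val : Z -> T) F (opensT (set_type Z)),
     exists s : F (opensT T), inverse_image_unit (set_val : Z -> T) s = t) ->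
  cocyc (@compact_supports S) c -> cobound (@closed_supports T) (ext_cochain c) ->
  cobound (@compact_supports S) c.
Proof.
move=> surj [lc [B [cB /= kB hB]]] [s [_ hs]].
have clB : closed (i @` B) by apply: compact_closed => //; exact: compact_image.
have sU x : ~ (i @` B) x -> issec s x.
  move=> nB; have -> : s = ext_cochain c x - (ext_cochain c x - s) by rewrite opprB addrC subrK.
  apply: issecB; last exact: hs.
  case: (in_or_out x) => [[y xE]|nA].
    rewrite xE ext_cochain_val; apply/ext_germs_issec; apply: hB => By; apply: nB.
    by exists y.
  by rewrite ext_cochain_out //; exact: issec0.
have ZB x : Z x -> ~ (i @` B) x.
  move=> Zx [y _ yx]; have /AZ : A (i y) by exact: set_mem (valP y).
  by rewrite yx.
have [t tE] := surj (lsub_in (induced_on (fun x Zx => sU x (ZB x Zx)))).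
pose s1 : dsections F := s - global_germs t.
have s1sec x : ~ (i @` B) x -> issec s1 x.
  by move=> nB; apply: issecB; [exact: (sU _ nB)|exact: global_germs_issec].
have s1Z x : Z x -> s1 x = 0.
  move=> Zx; have := congr1 (fun f : inverse_image (set_val : Z -> T) F (opensT (set_type Z)) =>
    lsub_val f (exist _ (exist _ x (mem_set Zx) : set_type Z) (mem_set I))) tE.
  move=> /= h; apply/eqP; rewrite [_ == _]subr_eq0; apply/eqP; exact: esym h.
pose N : set T := [set x | exists2 U : opens T, U x & forall y, U y -> s1 y = 0].
have oN : open N.
  rewrite openE => x [U Ux hU]; rewrite /interior /=.
  apply: (@filterS _ _ _ U); last by apply: open_nbhs_nbhs; split=> //; exact: opens_open.
  by move=> y Uy; exists U.
have ZN : Z `<=` N by move=> x Zx; exact: issec_germ0 (s1sec x (ZB x Zx)) (s1Z x Zx).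
have NA : ~` N `<=` A by move=> x nN; apply/AZ => Zx; apply: nN; exact: ZN.
have cN : compact (~` N) by apply: (subclosed_compact _ cT) => //; exact: open_closedC.
exists (pull s1); split.
  exists (i @^-1` (~` N)); split.
  - by apply: closed_comp; [move=> ? _; exact: set_val_cont|exact: open_closedC].
  - exact: compact_preimage.
  move=> y /= /contrapT [U Uy hU]; apply: (bij_inj (thbij y)).
  by rewrite pull_val linear0 hU.
move=> y; apply/ext_germs_issec; rewrite -ext_germsB -ext_cochain_val.
have -> : ext_cochain c (i y) - ext_germs (pull s1) = (ext_cochain c (i y) - s1) + (s1 - ext_germs (pull s1)).
  by rewrite addrA subrK.
apply: issecD.
  have -> : ext_cochain c (i y) - s1 = (ext_cochain c (i y) - s) + global_germs t.
    by rewrite /s1 opprB addrCA addrC -addrA addrC.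
  by apply: issecD => //; exact: global_germs_issec.
apply: (issec_zero (U := A)); first exact: set_mem (valP y).
move=> x Ax; pose z : S := exist _ x (mem_set Ax).
transitivity (s1 (i z) - ext_germs (pull s1) (i z)); first by [].
by rewrite ext_germs_val pull_val subrr.
Qed.

End ExtensionByZero.

(** * The structure sheaf of an open submanifold *)

Section Values.
Variables (R : realType) (n : nat) (X : complexManifold R n).

Lemma secval_res (U V : opens X) (VU : V `<=` U) (s : structure_sheaf X U) x :
  V x -> secval (res (structure_sheaf X) VU s) x = secval s x.
Proof.
move=> Vx; pose y : set_type V := exist _ x (mem_set Vx).
rewrite (secvalE _ y : secval _ x = _) /= /family_res -secvalE //.
Qed.

Lemma secval_linear (U : opens X) a (s t : structure_sheaf X U) x :
  secval (a *: s + t) x = a * secval s x + secval t x.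
Proof.
rewrite /secval; case: pselect => // _; by rewrite mulr0 addr0.
Qed.

Lemma germ_secval (U V : opens X) x (Ux : U x) (Vx : V x)
  (s : structure_sheaf X U) (t : structure_sheaf X V) :
  germ_at Ux s = germ_at Vx t -> secval s x = secval t x.
Proof.
by move=> /germ_atP[N [NU [NV [Nx e]]]]; rewrite -(secval_res NU s Nx) e secval_res.
Qed.

Lemma secval_germ (U V N : opens X) x (Ux : U x) (Vx : V x)
  (s : structure_sheaf X U) (t : structure_sheaf X V) : N x ->
  (forall y, N y -> U y -> V y -> secval s y = secval t y) -> germ_at Ux s = germ_at Vx t.
Proof.
move=> Nx st; pose M := opensI N (opensI U V).
have MU : M `<=` U by move=> y [_ []].
have MV : M `<=` V by move=> y [_ []].
apply/germ_atP; exists M, MU, MV; split=> //; apply: secval_inj => y My.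
by rewrite !secval_res //; have [Ny [Uy Vy]] := My; exact: st.
Qed.

End Values.

Section Submanifold.
Variables (R : realType) (n : nat) (X : complexManifold R n) (W : opens X).
Local Notation C := (complex_field R).
Local Notation M := (open_submanifold W).
Local Notation i := (set_val : M -> X).

Lemma holoAt_sub (f : X -> C) (y : M) : holoAt f (i y) <-> holoAt (fun z : M => f (i z)) y.
Proof.
split.
  move=> [phi [A D [g [r r0 [dg fg]]]]]; exists (restr_chart W phi); split.
  - by exists phi.
  - exact: D.
  - by exists g, r => //; split=> // z hz; apply: fg.
move=> [_ [[phi A <-] D [g [r r0 [dg fg]]]]]; exists phi; split=> //.
have [s s0 [pp [_ hp2]]] := chart_ball (D : dom phi (i y)) (opens_open W) (set_mem (valP y)).
have h x : cball phi (i y) (Num.min r s) x -> cball phi (i y) r x /\ cball phi (i y) s x.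
  by move=> [Dx]; rewrite lt_min => /andP[h1 h2].
exists g, (Num.min r s); first by rewrite lt_min r0.
split=> [z|x /h[[Dx xr] xs]]; first by rewrite lt_min => /andP[h1 _]; exact: dg.
have [Wx _] := hp2 x xs.
exact: (fg (exist _ x (mem_set Wx) : M)).
Qed.

Definition ext_fun (f : M -> C) (x : X) : C :=
  if pselect (W x) is left Wx then f (exist _ x (mem_set Wx)) else 0.

Lemma ext_fun_val f y : ext_fun f (i y) = f y.
Proof.
rewrite /ext_fun; case: y => x xA /=; case: pselect => [Ax|nA]; last by case: nA; exact: set_mem.
by rewrite (bool_irrelevance (mem_set Ax) xA).
Qed.

Lemma ext_fun_holo f y : holoAt (ext_fun f) (i y) <-> holoAt f y.
Proof.
rewrite holoAt_sub; have -> : (fun z : M => ext_fun f (i z)) = f.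
  by apply/funext => z; exact: ext_fun_val.
by [].
Qed.

Let push_ex (U : opens M) (f : structure_sheaf M U) :
  exists t : structure_sheaf X (opens_image U), forall y, U y -> secval t (i y) = secval f y.
Proof.
have [|t tE] := @holo_section _ _ X (opens_image U) (ext_fun (secval f)).
  by move=> _ [y Uy <-]; apply/ext_fun_holo; exact: secval_holo.
exists t => y Uy; rewrite tE ?ext_fun_val //; by exists y.
Qed.

Let push (U : opens M) f := projT1 (cid (@push_ex U f)).

Let pushE (U : opens M) f y : U y -> secval (@push U f) (i y) = secval f y.
Proof. by rewrite /push; case: cid => t h /= Uy; exact: h. Qed.

Let in_image (U : opens M) (y : set_type U) : opens_image U (i (val y)).
Proof. by exists (val y) => //; exact: set_mem (valP y). Qed.

Let push_loc (U : opens M) f : inverse_image_lsub i (structure_sheaf X) U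
  (fun y : set_type U => germ_at (in_image y) (@push U f)).
Proof.
move=> y Uy; exists U, (opens_image U), (push f); split=> //.
  by move=> z Uz; exists z.
by move=> z Vz _; exact: germ_at_irr.
Qed.

Let alpha U (f : structure_sheaf M U) : inverse_image i (structure_sheaf X) U :=
  lsub_in (push_loc f).

Let alpha_linear U : linear (@alpha U).
Proof.
move=> a f g; apply: val_inj; apply: functional_extensionality_dep => y.
transitivity (a *: germ_at (in_image y) (push f) + germ_at (in_image y) (push g)); last by [].
rewrite -germ_at_linear; apply: (secval_germ (N := opens_image U)); first exact: in_image.
by move=> _ [z Uz <-] _ _; rewrite secval_linear !pushE // secval_linear.
Qed.

(** A holomorphic function on an open set of [M] is one on its image in [X]; it is
    sent to the family of its germs. *)
Lemma submanifold_sheaf :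
  isomorphic (structure_sheaf M) (inverse_image i (structure_sheaf X)).
Proof.
exists (fun U => linear_of (@alpha_linear U)); split.
  move=> U V VU f; apply: val_inj; apply: functional_extensionality_dep => y /=.
  apply: (secval_germ (N := opens_image V)); first exact: in_image.
  move=> _ [z Vz <-] _ _; rewrite !pushE ?secval_res //; exact: VU.
move=> U.
have surj (t : inverse_image i (structure_sheaf X) U) : exists f, alpha f = t.
  pose s : dsections (structure_sheaf X) := fun x =>
    if pselect (W x) is left Wx then
      if pselect (U (exist _ x (mem_set Wx))) is left Ux
      then lsub_val t (exist _ (exist _ x (mem_set Wx) : M) (mem_set Ux)) else 0
    else 0.
  have sE (y : set_type U) : s (i (val y)) = lsub_val t y.
    rewrite /s; case: y => -[x xW] yU /=; case: pselect => [Wx|nW]; last by case: nW; exact: set_mem.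
    move: yU; rewrite (bool_irrelevance xW (mem_set Wx)) => yU.
    case: pselect => [Ux|nU]; last by case: nU; exact: set_mem.
    exact: (family_irr (E := fun y => stalk (structure_sheaf X) (i y)) (lsub_val t)).
  have hs x : opens_image U x -> issec s x.
    move=> [y Uy <-].
    have ht : inverse_image_lsub i (structure_sheaf X) U (lsub_val t) := lsub_valP t.
    have [N [V [t' [Ny NV tE]]]] := ht y Uy.
    exists (opensI (opens_image (opensI N U)) V), (res _ (@opensIr _ _ _) t'); split.
      by split; [exists y|exact: NV].
    move=> x' [Nx' Vx']; rewrite (germ_at_res Vx').
    case: Nx' Vx' => z [Nz Uz] <- Vz.
    by rewrite (sE (exist _ z (mem_set Uz))); exact: (tE (exist _ z (mem_set Uz)) Vz Nz).
  have [tau tauE] := glue hs.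
  have [|f fE] := @holo_section _ _ M U (fun y => secval tau (i y)).
    by move=> y Uy; apply/holoAt_sub; apply: secval_holo; exists y.
  exists f; apply: val_inj; apply: functional_extensionality_dep => y /=.
  rewrite -sE (tauE _ (in_image y)).
  apply: (secval_germ (N := opens_image U)); first exact: in_image.
  by move=> _ [z Uz <-] _ _; rewrite pushE // fE.
have inj : injective (@alpha U).
  move=> f g e; apply: secval_inj => y Uy.
  have := congr1 (fun t : inverse_image i (structure_sheaf X) U =>
    lsub_val t (exist _ y (mem_set Uy))) e.
  by move=> /germ_secval; rewrite !pushE.
have [h hE] := choice surj.
by exists h => [f|t]; [apply: inj; rewrite hE|exact: hE].
Qed.

End Submanifold.

(** * Germs along a closed set *)

Section FiniteCovers.
Variable T : topologicalType.

Lemma near_all (Fl : set_system T) (D : seq T) (f : T -> set T) : Filter Fl ->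
  (forall b, b \in D -> Fl (f b)) -> Fl [set y | forall b, b \in D -> f b y].
Proof.
move=> FF; elim: D => [|a D IH] h; first exact: (@filterS _ _ _ setT _ _ filterT).
have h1 : Fl (f a) by apply: h; rewrite inE eqxx.
have h2 : Fl [set y | forall b, b \in D -> f b y].
  by apply: IH => b bD; apply: h; rewrite inE bD orbT.
apply: filterS (filterI h1 h2) => y [fa fD] b; rewrite inE => /orP[/eqP->//|]; exact: fD.
Qed.

(** The filter of the finite sequences containing a given one turns the covering
    form of compactness, stated for filters, into finite subcovers. *)
Lemma finite_subcover (A : set T) (v : T -> set T) : compact A ->
  (forall x, A x -> open (v x) /\ v x x) ->
  exists2 D : seq T, forall a, a \in D -> A a & forall x, A x -> exists2 a, a \in D & v a x.
Proof.
move=> cA hv.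
pose Fl : set_system (seq T) := [set P | exists D0 : seq T, forall D : seq T, {subset D0 <= D} -> P D].
have FF : Filter Fl.
  split; first by exists [::].
    move=> P Q [D1 h1] [D2 h2]; exists (D1 ++ D2) => D sD; split.
      by apply: h1 => a aD; apply: sD; rewrite mem_cat aD.
    by apply: h2 => a aD; apply: sD; rewrite mem_cat aD orbT.
  by move=> P Q PQ [D0 h0]; exists D0 => D /h0 /PQ.
have /compact_near_coveringP/(_ _ Fl (fun D x => exists2 a, a \in D & A a /\ v a x) FF) := cA.
case=> [x Ax|D0 /(_ D0 (fun _ h => h)) hD].
  have [ovx vxx] := hv x Ax.
  exists (v x, [set D : seq T | x \in D]); first split=> /=.
  - exact: open_nbhs_nbhs.
  - by exists [:: x] => D sD; apply: sD; rewrite inE.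
  by move=> [y D] /= [vy xD]; exists x.
exists [seq a <- D0 | `[< A a >]] => [a|x /hD[a aD [Aa vax]]].
  by rewrite mem_filter => /andP[/asboolP].
by exists a => //; rewrite mem_filter aD andbT; apply/asboolP.
Qed.

End FiniteCovers.

Section GermsAlongClosed.
Variables (K : fieldType) (T : topologicalType) (F : sheaf K T) (Z : set T).

Lemma germs_to_sections_inj : injective (germs_to_sections (F := F) (A := Z)).
Proof.
move=> g h e; have [U [ZU [s [t [gE hE]]]]] := germ_surj2 g h.
pose N : set T := [set x | exists Ux : U x, germ_at Ux s = germ_at Ux t].
have oN : open N.
  rewrite openE => x [Ux /germ_atP[W [WU [WU' [Wx eW]]]]]; rewrite /interior /=.
  apply: (@filterS _ _ _ W); last by apply: open_nbhs_nbhs; split=> //; exact: opens_open.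
  move=> y Wy; exists (WU y Wy); apply/germ_atP; exists W, WU, WU'; by split.
have ZN : Z `<=` N.
  move=> x Zx; exists (ZU x Zx).
  have := congr1 (fun f : inverse_image (set_val : Z -> T) F (opensT (set_type Z)) =>
    lsub_val f (exist _ (exist _ x (mem_set Zx) : set_type Z) (mem_set I))) e.
  by rewrite gE hE /= !germs_at_germ => h'; apply: etrans (etrans h' _); exact: germ_at_irr.
have NU : Opens oN `<=` U by move=> x [].
rewrite gE hE; apply/germ_eq; exists (Opens oN), NU, NU; split=> //=.
apply: germ_sep => y Ny; have [Uy st] := Ny.
by rewrite !(germ_at_res Uy).
Qed.

Hypotheses (hT : hausdorff_space T) (cT : compact [set: T]) (cZ : closed Z).

(** Finitely many local sections [d a], defined near closed sets [k a] whose
    interiors cover [Z], induce [t].  The set [U] of the points covered by some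
    [v a] at which all [d b] with [k b x] agree is open, since the [k b] are
    closed and finite in number, and it contains [Z]; on [U] the sections glue. *)
Lemma germs_to_sections_surj t : exists g, germs_to_sections (F := F) (A := Z) g = t.
Proof.
pose tau (z : set_type Z) : stalk F (set_val z) := lsub_val t (exist _ z (mem_set I)).
have loc x : exists dKV : dsections F * set T * set T, Z x ->
    [/\ open dKV.2, closed dKV.1.2, dKV.2 x, dKV.2 `<=` dKV.1.2 &
        (forall y, dKV.1.2 y -> issec dKV.1.1 y) /\
        forall z : set_type Z, dKV.1.2 (set_val z) -> dKV.1.1 (set_val z) = tau z].
  have [Zx|nZ] := pselect (Z x); last by exists (0, set0, set0).
  pose x' : set_type Z := exist _ x (mem_set Zx).
  have ht : inverse_image_lsub (set_val : Z -> T) F (opensT (set_type Z)) (lsub_val t) := lsub_valP t.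
  have [N [V [t' [Nx NV tE]]]] := ht x' I.
  have [B oB BN] := opens_open N.
  have Bx : B x by move: Nx; rewrite -BN.
  have Vx : V x by exact: (NV x').
  have nBV : nbhs x (B `&` V).
    by apply: open_nbhs_nbhs; split=> //; apply: openI => //; exact: opens_open.
  have [P nP clP] := compact_regular hT cT (@filterT _ (nbhs x) _) nBV.
  pose d : dsections F := fun y => if pselect (V y) is left Vy then germ_at Vy t' else 0.
  have dE y (Vy : V y) : d y = germ_at Vy t'.
    by rewrite /d; case: pselect => // Vy'; exact: germ_at_irr.
  exists (d, closure P, P°) => _ /=; split.
  - exact: open_interior.
  - exact: closed_closure.
  - exact: nP.
  - by move=> y /interior_subset; exact: subset_closure.
  split=> [y /clP[_ Vy]|z /clP[Bz Vz]]; first by exists V, t'.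
  rewrite (dE _ Vz); apply/esym.
  have Nz : N z by rewrite -BN.
  exact: (tE (exist _ z (mem_set I)) Vz Nz).
have [f fE] := choice loc.
pose d x := (f x).1.1; pose k x := (f x).1.2; pose v x := (f x).2.
have hf x : Z x -> [/\ open (v x), closed (k x), v x x, v x `<=` k x &
    (forall y, k x y -> issec (d x) y) /\
    forall z : set_type Z, k x (set_val z) -> d x (set_val z) = tau z] by exact: fE.
have compZ : compact Z by apply: (subclosed_compact cZ cT).
have [|D DZ cov] := finite_subcover compZ (v := v); first by move=> x /hf[].
pose U : set T := [set x | exists2 a, a \in D & v a x /\
  forall b, b \in D -> k b x -> d b x = d a x].
(* agreement persists near x: the k b missing x also miss its neighbours *)
have near_ex x a : a \in D -> v a x -> (forall b, b \in D -> k b x -> d b x = d a x) ->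
    exists2 N : set T, open N /\ N x & forall y, N y -> v a y /\
      forall b, b \in D -> k b y -> d b y = d a y.
  move=> aD vax hx; have [ova cka _ vka [ska _]] := hf a (DZ a aD).
  have nb b : b \in D -> \forall y \near x, k b y -> d b y = d a y.
    move=> bD; have [_ ckb _ _ [skb _]] := hf b (DZ b bD).
    have [kbx|nkbx] := pselect (k b x).
      have dab : issec (d b - d a) x by apply: issecB; [exact: skb|exact/ska/vka].
      have [|N Nx N0] := issec_germ0 dab.
        by apply/eqP; rewrite [_ == _]subr_eq0; apply/eqP; exact: hx.
      apply: (@filterS _ _ _ N); last by apply: open_nbhs_nbhs; split=> //; exact: opens_open.
      move=> y Ny _; apply: subr0_eq; exact: N0.
    apply: (@filterS _ _ _ (~` k b)) => //.
    by apply: open_nbhs_nbhs; split=> //; exact: closed_openC.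
  have := near_all (nbhs_filter x) nb; rewrite nbhsE => -[N [oN Nx] hN].
  exists (N `&` v a); first by split; [exact: openI|].
  by move=> y [Ny vy]; split=> // b bD; exact: (hN y Ny b bD).
have oU : open U.
  rewrite openE => x [a aD [vax hx]]; rewrite /interior /=.
  have [N [oN Nx] hN] := near_ex x a aD vax hx.
  apply: (@filterS _ _ _ N); last exact: open_nbhs_nbhs.
  by move=> y Ny; exists a => //; exact: hN.
pose s : dsections F := fun x => if pselect (U x) is left Ux
  then d (projT1 (cid2 Ux)) x else 0.
have sE x a : U x -> a \in D -> k a x -> s x = d a x.
  move=> Ux aD kax; rewrite /s; case: pselect => // Ux'.
  by case: cid2 => b bD [vb hb] /=; rewrite hb.
have ss x : U x -> issec s x.
  move=> [a aD [vax hx]].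
  have [N [oN Nx] hN] := near_ex x a aD vax hx.
  have [_ _ _ vka [ska _]] := hf a (DZ a aD).
  apply: (issec_eq (U := Opens oN) Nx _ (ska x (vka x vax))) => y Ny.
  apply/esym/sE => //; first by exists a => //; exact: hN.
  by apply: vka; have [] := hN y Ny.
have ZU : Z `<=` U.
  move=> x Zx; have [a aD vax] := cov x Zx; have [_ _ _ vka [_ ta]] := hf a (DZ a aD).
  exists a => //; split=> // b bD kb; have [_ _ _ _ [_ tb]] := hf b (DZ b bD).
  pose x' : set_type Z := exist _ x (mem_set Zx).
  by rewrite (tb x' kb) (ta x' (vka _ vax)).
have [u uE] := glue (U := Opens oU) ss.
exists (germ (ZU : Z `<=` Opens oU) u); apply: val_inj.
apply: functional_extensionality_dep => -[x p] /=.
rewrite germs_at_germ -uE.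
have Zx : Z (set_val x) by exact: set_mem (valP x).
have [a aD vax] := cov _ Zx; have [_ _ _ vka [_ ta]] := hf a (DZ a aD).
rewrite (sE _ a (ZU _ Zx) aD (vka _ vax)) (ta x (vka _ vax)) /tau.
exact: (family_irr (E := fun y => stalk F (set_val y)) (lsub_val t)).
Qed.

Lemma germs_to_sections_bij : bijective (germs_to_sections (F := F) (A := Z)).
Proof.
have [h hE] := choice germs_to_sections_surj.
by exists h => [g|t]; [apply: germs_to_sections_inj; rewrite hE|exact: hE].
Qed.

End GermsAlongClosed.

(** * Dimension *)

Section Dimension.
Variable K : fieldType.
Implicit Types V W : lmodType K.

Lemma coordinates V k : has_dim V k -> exists phi : {linear V -> 'rV[K]_k}, injective phi.
Proof.
move=> [e he].
have [f fE] := choice (fun v => let: ex_intro c h := he v in ex_intro (fun c => unique _ c) c h).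
have sumL a (c d : 'rV[K]_k) : \sum_(i < k) (a *: c + d) 0 i *: e i =
    a *: (\sum_(i < k) c 0 i *: e i) + \sum_(i < k) d 0 i *: e i.
  rewrite scaler_sumr -big_split /=; apply: eq_bigr => i _.
  by rewrite !mxE scalerDl scalerA.
have lin : linear f.
  move=> a u v; apply: (fE (a *: u + v)).2.
  by rewrite sumL -(fE u).1 -(fE v).1.
exists (linear_of lin) => u v /= uv.
by rewrite (fE u).1 (fE v).1 uv.
Qed.

Definition independent V k (e : 'I_k -> V) :=
  forall c : 'rV[K]_k, \sum_(i < k) c 0 i *: e i = 0 -> c = 0.

Lemma independent_bound V m k (e : 'I_k -> V) : has_dim V m -> independent e -> (k <= m)%N.
Proof.
move=> /coordinates[phi phi_inj] ie.
pose M : 'M[K]_(k, m) := \matrix_i phi (e i).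
suff /eqP <- : row_free M by exact: rank_leq_col.
apply: inj_row_free => v vM; apply: ie; apply: phi_inj.
rewrite linear0 -vM mulmx_sum_row linear_sum; apply: eq_bigr => i _.
by rewrite linearZ rowK.
Qed.

(** An independent family of largest size is a basis. *)
Lemma dim_le_independent V m : (forall k (e : 'I_k -> V), independent e -> (k <= m)%N) ->
  dim_le V m.
Proof.
move=> bnd; pose P k := `[< exists e : 'I_k -> V, independent e >].
have P0 : exists k, P k.
  by exists 0%N; apply/asboolP; exists (fun=> 0) => c _; apply/rowP => -[].
have Pm k : P k -> (k <= m)%N by move=> /asboolP[e /bnd].
case: (ex_maxnP P0 Pm) => k /asboolP[e ie] kmax.
exists k; first exact: bnd ie.
exists e => v.
have [[c vc]|no] := pselect (exists c : 'rV[K]_k, v = \sum_(i < k) c 0 i *: e i).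
  exists c; split=> // d vd; apply: subr0_eq; apply: ie.
  under eq_bigr do rewrite !mxE scalerBl.
  by rewrite sumrB -vc -vd subrr.
pose e' (i : 'I_k.+1) : V := if unlift ord0 i is Some j then e j else v.
suff /kmax : P k.+1 by rewrite ltnn.
apply/asboolP; exists e' => c; rewrite big_ord_recl {1}/e' unlift_none.
under eq_bigr do rewrite /e' liftK.
move=> c0; have c00 : c 0 ord0 = 0.
  apply: contrapT => /eqP nz; apply: no.
  exists (\row_i (- (c 0 ord0)^-1 * c 0 (lift ord0 i))).
  under eq_bigr do rewrite mxE -scalerA.
  rewrite -scaler_sumr scaleNr; move/eqP: c0; rewrite addr_eq0 => /eqP c0.
  by rewrite -scalerN -c0 scalerA mulVf // scale1r.
move: c0; rewrite c00 scale0r add0r => c0.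
have h : \row_i c 0 (lift ord0 i) = 0.
  by apply: ie; under eq_bigr do rewrite mxE.
apply/rowP => i; rewrite mxE; case: (unliftP ord0 i) => [j ->|->] //.
by have /rowP/(_ j) := h; rewrite !mxE.
Qed.

(** Lifts along [r] of an independent family are independent.  With a relation
    in place of a linear map, a map between cohomology spaces can be described on
    cocycles. *)
Lemma dim_le_relation V W m (r : V -> W -> Prop) : has_dim W m ->
  (forall v, exists w, r v w) ->
  (forall a u v u' v', r u u' -> r v v' -> r (a *: u + v) (a *: u' + v')) ->
  (forall v, r v 0 -> v = 0) -> dim_le V m.
Proof.
move=> dW ex rP inj; apply: dim_le_independent => k e ie.
have [f fE] := choice ex.
apply: (independent_bound dW (e := f \o e)) => c c0; apply: ie; apply: inj.
rewrite -c0 => {c0}.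
have r0 : r 0 0.
  have := rP (-1) _ _ _ _ (fE 0) (fE 0); by rewrite !scaleN1r !addNr.
apply: (big_ind2 r) => // [u u' v v' h h'|i _].
  by have := rP 1 _ _ _ _ h h'; rewrite !scale1r.
by have := rP (c 0 i) _ _ _ _ (fE (e i)) r0; rewrite !addr0.
Qed.

End Dimension.

(** * Hartogs extension from finite cohomology *)

Section ExtendOverCompact.
Variables (R : realType) (n : nat) (M : complexManifold R n).
Local Notation C := (complex_field R).
Local Notation OM := (structure_sheaf M).

Hypothesis cM : connected [set: M].
Hypothesis ncM : ~ compact [set: M].
Variables (K : set M) (cK : compact K).
Hypothesis conK : connected (~` K).
Local Notation D := (compact_compl cK).

(** [M] is not the union of two compact sets. *)
Let D_meets (A : set M) : compact A -> exists2 x, D x & ~ A x.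
Proof.
move=> cA; apply: contrapT => no; apply: ncM.
have -> : [set: M] = K `|` A; last exact: compactU.
apply/seteqP; split=> // x _; apply: contrapT => h; apply: no; exists x.
  by move=> Kx; apply: h; left.
by move=> Ax; apply: h; right.
Qed.

Let neD : (D : set M) !=set0.
Proof. by have [x Dx _] := D_meets cK; exists x. Qed.

Let hol_eq (f g : M -> C) (U : set M) : open U -> D `&` U !=set0 ->
  (forall x, D x -> holoAt f x) -> (forall x, D x -> holoAt g x) ->
  (forall x, D x -> U x -> f x = g x) -> forall x, D x -> f x = g x.
Proof.
move=> oU DU hf hg fg x Dx; apply: subr0_eq.
apply: (@identity_theorem _ _ _ D U (fun x => f x - g x)) => //.
- exact: opens_open.
- by move=> y Dy; apply: holoAtB; [exact: hf|exact: hg].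
- by move=> y Dy Uy; rewrite fg // subrr.
Qed.

Lemma restriction_inj : injective (res OM (@subsetT _ _ : D `<=` opensT M)).
Proof.
move=> s t st; apply: secval_inj => x _.
apply: subr0_eq.
apply: (@identity_theorem _ _ _ setT D (fun x => secval s x - secval t x)) => //.
- exact: openT.
- by move=> y _; apply: holoAtB; exact: secval_holo.
- exact: opens_open.
- by have [y Dy] := neD; exists y.
- by move=> y _ Dy; rewrite -(secval_res (@subsetT _ _ : D `<=` opensT M) s Dy) st secval_res // subrr.
Qed.

Let zext (s : OM D) : dsections OM := fun x =>
  if pselect (D x) is left Dx then germ_at Dx s else 0.

Let zextE s x (Dx : D x) : zext s x = germ_at Dx s.
Proof. by rewrite /zext; case: pselect => // Dx'; exact: germ_at_irr. Qed.

Let zext_linear a s t : zext (a *: s + t) = a *: zext s + zext t.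
Proof.
apply: functional_extensionality_dep => x.
transitivity (a *: zext s x + zext t x); last by [].
rewrite /zext; case: pselect => [Dx|_]; first exact: germ_at_linear.
by rewrite scaler0 addr0.
Qed.

Let zext_cocyc s : cocyc (@compact_supports M) (fun=> zext s).
Proof.
split; first by move=> x; exists (opensT M) => // y _; rewrite subrr; exact: issec0.
exists K; split=> //; first exact: (compact_closed (@mhausdorff _ _ M)).
by move=> y nK; exists D, s; split=> // z Dz; exact: zextE.
Qed.

(** The connecting map from the functions on [D] to the first cohomology of [M]
    with compact supports. *)
Let delta s := cocycle_class (@compact_supports M) (fun=> zext s).

Let delta_linear : linear delta.
Proof.
move=> a s t; rewrite /delta -cocycle_class_linear; [|exact: zext_cocyc|exact: zext_cocyc].
by congr cocycle_class; apply/funext => x; exact: zext_linear.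
Qed.

(** If [sg] with compact support [A] cobounds, then [zext s - sg] is a global
    holomorphic function that equals [s] on [D] outside [A], hence on [D]. *)
Let delta_extends s : delta s = 0 -> exists g, (forall x, holoAt g x) /\
  forall x, D x -> g x = secval s x.
Proof.
move=> /(cocycle_class_eq0 (zext_cocyc s)) [sg [[A [clA cA sgA]] hs]].
have [tau tauE] := glue (U := opensT M) (fun x _ => hs x).
exists (secval tau); split; first by move=> x; exact: secval_holo.
have [x0 Dx0 nAx0] := D_meets cA.
apply: (hol_eq (U := ~` A)).
- exact: closed_openC.
- by exists x0.
- by move=> x _; exact: secval_holo.
- by move=> x; exact: secval_holo.
move=> x Dx nAx; apply: (germ_secval (Ux := I : opensT M x) (Vx := Dx)).
rewrite -tauE -(zextE s Dx); transitivity (zext s x - sg x); first by [].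
by rewrite sgA // subr0.
Qed.

Variable m : nat.
Hypothesis dimM : dim_le (compact_cohomology 1 OM) m.

Let poly_holo (f : M -> C) (P : {poly C}) x : holoAt f x -> holoAt (fun y => P.[f y]) x.
Proof.
move=> hf; elim/poly_ind: P => [|P c IH].
  have -> : (fun y => (0 : {poly C}).[f y]) = (fun=> 0) by apply/funext => y; rewrite horner0.
  exact: holoAt_cst.
have -> : (fun y => (P * 'X + c%:P).[f y]) = (fun y => P.[f y] * f y + c).
  by apply/funext => y; rewrite hornerMXaddC.
by apply: holoAtD; [exact: holoAtM|exact: holoAt_cst].
Qed.

(** The polynomials [P] for which [P(f)] extends form a subalgebra of finite
    codimension, by [delta_extends].  The closure property required by
    [finite_codim_full] is [quotient_extends]. *)
Lemma restriction_surj (f0 : OM D) :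
  exists f, res OM (@subsetT _ _ : D `<=` opensT M) f = f0.
Proof.
have [k _ /coordinates[phi phi_inj]] := dimM.
pose f := secval f0; have hf x : D x -> holoAt f x by exact: secval_holo.
have ex P := @holo_section _ _ M D _ (fun x Dx => poly_holo P (hf x Dx)).
pose sec P := projT1 (cid (ex P)).
have secE P x : D x -> secval (sec P) x = P.[f x].
  by rewrite /sec; case: cid => s h /= Dx; exact: h.
have linL : linear (fun P => phi (delta (sec P))).
  move=> a P Q; rewrite -linearP -delta_linear; congr (phi (delta _)).
  by apply: secval_inj => x Dx; rewrite secval_linear !secE // hornerD hornerZ.
pose S (P : {poly C}) := exists g, (forall x, holoAt g x) /\ forall x, D x -> g x = P.[f x].
have [||||||g [hg gE]] := @finite_codim_full _ S k (linear_of linL).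
- by exists (fun=> 1); split=> [x|x _]; [exact: holoAt_cst|rewrite hornerC].
- move=> P Q [g [hg gE]] [h [hh hE]]; exists (fun x => g x + h x).
  by split=> [x|x Dx]; [exact: holoAtD|rewrite hornerD gE ?hE].
- move=> P Q [g [hg gE]] [h [hh hE]]; exists (fun x => g x * h x).
  by split=> [x|x Dx]; [exact: holoAtM|rewrite hornerM gE ?hE].
- move=> c P [g [hg gE]]; exists (fun x => c * g x).
  by split=> [x|x Dx]; [apply: holoAtM => //; exact: holoAt_cst|rewrite hornerZ gE].
- move=> P /= L0; have [|g [hg gE]] := @delta_extends (sec P).
    by apply: phi_inj; rewrite L0 linear0.
  by exists g; split=> // x Dx; rewrite gE // secE.
- move=> P c [u [hu uE]] [v [hv vE]].
  apply: (@quotient_extends _ _ _ D c (fun x => P.[f x]) u v) => //.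
  + exact: opens_open.
  + by move=> x Dx; exact/poly_holo/hf.
  + by move=> x Dx; rewrite uE // !hornerE expr2.
  + by move=> x Dx; rewrite uE // vE // !hornerE.
have [s sE] := @holo_section _ _ M (opensT M) g (fun x _ => hg x).
exists s; apply: secval_inj => x Dx; rewrite secval_res // sE // gE // hornerX //.
Qed.

End ExtendOverCompact.

Lemma hartogs_of_finite_dim (R : realType) (n m : nat) (M : complexManifold R n) :
  connected [set: M] -> ~ compact [set: M] ->
  dim_le (compact_cohomology 1 (structure_sheaf M)) m -> hartogs_phenomenon M.
Proof.
move=> cM ncM dM; split=> // K cK conK.
have [h hE] := choice (restriction_surj cM ncM conK dM).
by exists h => [s|t]; [apply: (restriction_inj cM ncM (cK := cK)); rewrite hE|exact: hE].
Qed.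

(** * The complement of a hypersurface *)

(** Connectedness does not depend on the ambient space. *)
Lemma connected_preimage (T : topologicalType) (A : opens T) (D : set T) :
  D `<=` A -> connected D -> connected ((set_val : set_type A -> T) @^-1` D).
Proof.
move=> DA cD; apply: connectedP => U U' oU oU' cov dis [y [Dy Uy]] z Dz.
have : opens_image (Opens oU) (set_val z).
  apply: (connected_clopen cD (image_open oU) (image_open oU')) => //.
  - move=> x Dx; pose x' : set_type A := exist _ x (mem_set (DA x Dx)).
    by case: (cov x' Dx) => h; [left|right]; exists x'.
  - apply/seteqP; split=> // x [[Dx [a Ua ax]] [b U'b bx]].
    have ab : a = b by apply: val_inj; rewrite [LHS]ax.
    have : (set_val @^-1` D `&` U `&` U') a.
      by split; [split=> //; rewrite /preimage /= ax|rewrite ab].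
    by rewrite dis.
  - by exists (set_val y); split=> //; exists y.
by move=> [w Uw wz]; have <- : w = z by exact: val_inj.
Qed.

Section Complement.
Variables (R : realType) (n : nat) (X : complexManifold R n).
Local Notation C := (complex_field R).
Hypotheses (X_compact : compact [set: X]) (X_connected : connected [set: X]).
Variable Z : analyticSet X.
Hypotheses (Z_connected : connected Z) (Z_codim : analytic_codim Z 1).
Local Notation W := (analytic_compl Z).
Local Notation M := (open_submanifold W).
Local Notation i := (set_val : M -> X).

Let Z_ne : (Z : set X) !=set0.
Proof. by have [d [[x [phi [_ Zx _ _ _]]] _] _] := Z_codim; exists x. Qed.

Let Z_thin : thin Z := codim1_thin X_connected Z_codim.

Lemma complement_connected : connected [set: M].
Proof.
have -> : [set: M] = i @^-1` ([set: X] `\` Z).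
  by apply/seteqP; split=> // y _; split=> //; exact: (set_mem (valP y)).
apply: connected_preimage; first by move=> x [].
by apply: connected_diff_thin => //; exact: openT.
Qed.

Lemma complement_noncompact : ~ compact [set: M].
Proof.
move=> cM; have [z Zz] := Z_ne.
have cW : closed (W : set X).
  have -> : (W : set X) = i @` [set: M].
    apply/seteqP; split=> [x Wx|_ [y _ <-]]; first by exists (exist _ x (mem_set Wx)).
    exact: (set_mem (valP y)).
  by apply: compact_closed; [exact: mhausdorff|exact: compact_image].
have [x _ nZx] : exists2 x, [set: X] x & ~ Z x.
  by apply: Z_thin; [exact: openT|exists z].
have : [set: X] `<=` W.
  apply: (connected_clopen X_connected (opens_open W) (closed_openC cW)).
  - by move=> y _; have [|] := pselect (W y); [left|right].
  - by apply/seteqP; split=> // y [[_ h] /(_ h)].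
  - by exists x.
by move=> /(_ z I) /(_ Zz).
Qed.

Variable F : sheaf C X.
Hypothesis FO : isomorphic (inverse_image i F) (inverse_image i (structure_sheaf X)).

Let iso : isomorphic (structure_sheaf M) (inverse_image i F) :=
  isomorphic_trans (submanifold_sheaf W) (isomorphic_sym FO).

Let hX : hausdorff_space X := @mhausdorff _ _ X.

Let clZ : closed Z := @aset_closed _ _ X Z.

(** [t] is the germ of a section [s0] on a neighbourhood [U] of [Z], and [Q] is a
    connected neighbourhood of [Z] inside [U].  Off [Z], where [F] is the structure
    sheaf, [s0] is a holomorphic function on the complement [Q \ Z] of a compact
    set, and its Hartogs extension glues with [s0]. *)
Lemma hartogs_germs_extend (H : hartogs_phenomenon M)
  (t : inverse_image (set_val : Z -> X) F (opensT (set_type Z))) :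
  exists s : F (opensT X), inverse_image_unit (set_val : Z -> X) s = t.
Proof.
have [g gt] := germs_to_sections_surj hX X_compact clZ t.
have [U [ZU [s0 gE]]] := germ_surj g.
have [Q [oQ cQ ZQ QU]] := connected_nbhd Z_connected Z_ne (opens_open U) ZU.
have [th [thbij thP]] := stalk_iso iso.
have QW : ~` Q `<=` W by move=> x nQ Zx; apply: nQ; exact: ZQ.
have cQ' : compact (~` Q) by apply: (subclosed_compact _ X_compact) => //; exact: open_closedC.
pose K : set M := i @^-1` (~` Q).
have cK : compact K by exact: compact_preimage.
have conK : connected (~` K).
  have -> : ~` K = i @^-1` (Q `\` Z).
    apply/seteqP; split=> y /=.
      by move=> /contrapT Qy; split=> //; exact: (set_mem (valP y)).
    by move=> [Qy _]; exact.
  apply: connected_preimage; first by move=> x [].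
  exact: connected_diff_thin.
pose d : dsections F := fun x => if pselect (U x) is left Ux then germ_at Ux s0 else 0.
have dE x (Ux : U x) : d x = germ_at Ux s0.
  by rewrite /d; case: pselect => // Ux'; exact: germ_at_irr.
have ds x : U x -> issec d x by move=> Ux; exists U, s0.
have KQ y : ~ K y -> Q (i y) by move=> /contrapT.
have [f0 f0E] : exists f0 : structure_sheaf M (compact_compl cK),
    forall y (Vy : compact_compl cK y), pull thbij d y = germ_at Vy f0.
  by apply: glue => y /KQ Qy; apply/(pull_issec thbij thP)/ds/QU.
have [f ff0] : exists f, res (structure_sheaf M) (@subsetT _ _ : compact_compl cK `<=` opensT M) f = f0.
  by have [h _ hK] := H.2 K cK conK; exists (h f0); exact: hK.
pose e := ext_germs th (global_germs f).
have eE y : Q (i y) -> e (i y) = d (i y).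
  move=> Qy; have nK : compact_compl cK y by exact.
  rewrite /e ext_germs_val -(pull_val thbij) (f0E y nK) -ff0; congr (th _ _).
  exact/esym/germ_at_res.
pose sg : dsections F := fun x => if pselect (Q x) then d x else e x.
have sgQ x : Q x -> sg x = d x by rewrite /sg; case: pselect.
have sgW y : sg (i y) = e (i y) by rewrite /sg; case: pselect => // Qy; rewrite eE.
have sgs x : issec sg x.
  have [Qx|nQx] := pselect (Q x).
    apply: (issec_eq (U := Opens oQ) Qx _ (ds x (QU x Qx))) => y Qy.
    by rewrite sgQ.
  have Wx := QW x nQx; pose y : M := exist _ x (mem_set Wx).
  apply: (issec_eq (U := W) Wx (s := e)).
    by move=> z Wz; rewrite (sgW (exist _ z (mem_set Wz) : M)).
  by apply: (iffRL (ext_germs_issec thP _ y)); exact: global_germs_issec.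
have [s sE] := glue (U := opensT X) (fun x _ => sgs x).
exists s; rewrite -gt gE; apply: val_inj; apply: functional_extensionality_dep => -[x p] /=.
have Zx : Z (set_val x) by exact: (set_mem (valP x)).
rewrite germs_at_germ -sE sgQ; last exact: ZQ.
exact: dE.
Qed.

(** Extension by zero from the complement of [Z] to [X] is injective on first
    cohomology by [ext_cochain_cobound]. *)
Lemma compact_cohomology_dim m : has_dim (cohomology 1 F) m ->
  (forall t : inverse_image (set_val : Z -> X) F (opensT (set_type Z)),
     exists s : F (opensT X), inverse_image_unit (set_val : Z -> X) s = t) ->
  dim_le (compact_cohomology 1 (structure_sheaf M)) m.
Proof.
move=> dF surj; have [th [thbij thP]] := stalk_iso iso.
have cc c : cocyc (@compact_supports M) c -> cocyc (@closed_supports X) (ext_cochain th c).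
  exact: (ext_cochain_cocyc thP hX).
apply: (@dim_le_relation _ _ _ m (fun h k => exists c,
  [/\ cocyc (@compact_supports M) c, h = cocycle_class (@compact_supports M) c &
      k = cocycle_class (@closed_supports X) (ext_cochain th c)]) dF).
- move=> h; have [c hc ->] := cocycle_class_surj h.
  by exists (cocycle_class (@closed_supports X) (ext_cochain th c)), c.
- move=> a u v u' v' [c [hc -> ->]] [c' [hc' -> ->]].
  exists (fun x => a *: c x + c' x); split; first exact: cocycP.
    by rewrite cocycle_class_linear.
  by rewrite ext_cochain_linear cocycle_class_linear //; exact: cc.
move=> h [c [hc -> /esym k0]]; apply/cocycle_class_eq0 => //.
apply: (ext_cochain_cobound (Z := Z) thbij thP hX X_compact _ surj) => //.
by apply/cocycle_class_eq0 => //; exact: cc.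
Qed.

End Complement.

Theorem lemma2p1 (R : realType) (n : nat) (X : complexManifold R n)
  (X_compact : compact [set: X]) (X_connected : connected [set: X])
  (Z : analyticSet X) (Z_connected : connected Z) (Z_codim : analytic_codim Z 1)
  (F : sheaf (complex_field R) X) (m : nat)
  (FO : isomorphic
     (inverse_image (set_val : analytic_compl Z -> X) F)
     (inverse_image (set_val : analytic_compl Z -> X) (structure_sheaf X)))
  (F_dim : has_dim (cohomology 1 F) m) :
  bijective (germs_to_sections (F := F) (A := Z)) /\
  [<-> hartogs_phenomenon (open_submanifold (analytic_compl Z));
       forall t : inverse_image (set_val : Z -> X) F (opensT Z),
         exists s : F (opensT X), inverse_image_unit (set_val : Z -> X) s = t;
       dim_le (compact_cohomology 1
         (structure_sheaf (open_submanifold (analytic_compl Z)))) m].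
Proof.
split.
  by apply: germs_to_sections_bij => //; [exact: mhausdorff|exact: aset_closed].
tfae.
- by move=> H; exact: hartogs_germs_extend.
- exact: compact_cohomology_dim.
- apply: hartogs_of_finite_dim; first exact: complement_connected.
  exact: complement_noncompact.
Qed.
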